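(* Let $X$ be a Kaplansky module over $C(K)$, let $U$ be a $d$-isomorphism of $X$ with $\sigma(U)\subseteq\mathbb{T}$ (the unit circle), let $w\in C(K)$ and $T=wU$. Let $\varphi$ be the homeomorphism of $K$ onto itself such that $UfU^{-1}=f\circ\varphi$ for all $f\in C(K)$. With $X_m$, $X_\Pi$, $X_{N\Pi}$, $N\Pi$ as defined in the context and $\sigma_m=\sigma(T|X_m)$: (1) $\sigma_{a.p.}(T|X_m)=\sigma_m$ for every $m\in\mathbb{N}$. (2) $\sigma(T|X_\Pi)=\sigma_{a.p.}(T|X_\Pi)=\mathrm{cl}\bigcup_{m=1}^\infty\sigma(T|X_m)\cup\sigma$, where $\sigma$ is a rotation invariant subset of $\mathbb{C}$. (3) $\sigma(T|X_{N\Pi})=\sigma(S,C(N\Pi))$ and $\sigma_{a.p.}(T|X_{N\Pi})=\sigma_{a.p.}(S,C(N\Pi))$, where $S$ is the operator on $C(N\Pi)$ given by $Sf=w(f\circ\varphi)$, $f\in C(N\Pi)$.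
   Context: All spaces are over $\mathbb{C}$; $L(X)$ is the algebra of bounded linear operators on $X$. A set $A\subseteq\mathbb{C}$ is rotation invariant if $\alpha A=A$ for all $|\alpha|=1$. Banach $C(K)$-module: $K$ is a compact Hausdorff space, $X$ a Banach space, $m:C(K)\to L(X)$ a bounded unital homomorphism. It is always assumed that $m$ is injective and isometric and that $m(C(K))$ is closed in $L(X)$ in the weak operator topology; $f\in C(K)$ is identified with $m(f)$. For $x\in X$ the cyclic subspace $X(x)=\mathrm{cl}\{fx: f\in C(K)\}$, with the norm of $X$ and the cone $X_+(x)=\mathrm{cl}\{fx: f\in C(K), f\ge0\}$, is a (complex) Banach lattice. $X$ is a Kaplansky module if $K$ is extremally disconnected and for every $x$ the set $\{f\in C(K): fx=0\}$ is a band in $C(K)$. $d$-endomorphism: $T\in L(X)$ such that for every $x\in X$, $T(X(x))\subseteq X(Tx)$ and $T|X(x):X(x)\to X(Tx)$ is disjointness preserving ($u\perp v\Rightarrow Tu\perp Tv$). A $d$-isomorphism is an invertible $d$-endomorphism whose inverse is also a $d$-endomorphism. For a $d$-isomorphism $U$ of a Kaplansky module the map $f\mapsto UfU^{-1}$ is an automorphism of $C(K)$, hence induced by a homeomorphism $\varphi$ of $K$. A point $k$ is $\varphi$-periodic if $\varphi^m(k)=k$ for some $m\in\mathbb{N}$; the smallest such $m$ is its period. $\Pi_m$ ($m\in\mathbb{N}$) is the set of all $\varphi$-periodic points of period $m$; $\Pi=\mathrm{cl}\bigcup_{m=1}^\infty\Pi_m$; $N\Pi=K\setminus\Pi$. These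 sets are clopen in $K$ (possibly empty); $\chi_m,\chi_\Pi,\chi_{N\Pi}$ are their characteristic functions, and $X_m=\chi_mX$, $X_\Pi=\chi_\Pi X$, $X_{N\Pi}=\chi_{N\Pi}X$; these are invariant under $U$ and $T$. $\sigma_{a.p.}(A)=\{\lambda\in\mathbb{C}:\exists x_n,\ \|x_n\|=1,\ Ax_n-\lambda x_n\to0\}$; $\sigma(S,C(N\Pi))$ denotes the spectrum of $S$ on $C(N\Pi)$. *)

(* Defs.v *)
From HB Require Import structures.
From mathcomp Require Import all_boot all_order all_algebra complex.
From mathcomp Require Import all_classical all_reals all_analysis.

Set Implicit Arguments.
Unset Strict Implicit.
Unset Printing Implicit Defensive.

Import Order.TTheory GRing.Theory Num.Theory.
Import numFieldNormedType.Exports.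

Local Open Scope classical_set_scope.
Local Open Scope ring_scope.

(* [R[i]^o] is the complex field with its usual topology and norm. The order
   of [R[i]] is such that [0 <= z] iff [z] is real and nonnegative; norms take
   their values in [R[i]]. *)

Section bounded_continuous.
Context {R : realType} {K : topologicalType}.

Definition bounded_continuous : {pred K -> R[i]^o} :=
  fun f => `[< continuous f /\ exists M : R, forall k, `|f k| <= M%:C%C >].

Lemma bounded_continuousP (f : K -> R[i]^o) :
  reflect (continuous f /\ exists M : R, forall k, `|f k| <= M%:C%C)
    (f \in bounded_continuous).
Proof. exact: asboolP. Qed.

Lemma bounded_continuous_subring : GRing.subring_closed bounded_continuous.
Proof.
split.
- apply/bounded_continuousP; split; first exact: cst_continuous.
  by exists 1 => k; rewrite normr1.
- move=> f g /bounded_continuousP[cf [M fM]] /bounded_continuousP[cg [N gN]].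
  apply/bounded_continuousP; split.
    by move=> k; exact: (@continuousB _ R[i]^o K f g k (cf k) (cg k)).
  exists (M + N) => k; rewrite (le_trans (ler_normB _ _))// rmorphD /=.
  exact: lerD.
- move=> f g /bounded_continuousP[cf [M fM]] /bounded_continuousP[cg [N gN]].
  apply/bounded_continuousP; split.
    by move=> k; exact: (@continuousM R[i] K f g k (cf k) (cg k)).
  by exists (M * N) => k; rewrite normrM rmorphM /= ler_pM.
Qed.

HB.instance Definition _ := GRing.isSubringClosed.Build (K -> R[i]^o)
  bounded_continuous bounded_continuous_subring.

Lemma bounded_continuous_scaler : GRing.scaler_closed bounded_continuous.
Proof.
move=> a f /bounded_continuousP[cf [M fM]]; apply/bounded_continuousP; split.
  by move=> k; exact: (@continuousZl_tmp R[i] R[i]^o K f a k (cf k)).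
exists (complex.Re `|a| * M) => k; rewrite normrZ rmorphM /=.
exact: ler_pM.
Qed.

HB.instance Definition _ := GRing.isScaleClosed.Build R[i] (K -> R[i]^o)
  bounded_continuous bounded_continuous_scaler.

End bounded_continuous.

(* [Cb R K] is the algebra of bounded continuous functions [K -> C] with the
   supremum norm. For compact [K] it is C(K): see [continuous_bounded]. *)
Record Cb (R : realType) (K : topologicalType) := MkCb {
  Cb_fun :> K -> R[i]^o;
  Cb_funP : Cb_fun \in bounded_continuous }.

Section Cb_algebra.
Context {R : realType} {K : topologicalType}.

HB.instance Definition _ := [isSub for @Cb_fun R K].
HB.instance Definition _ := [Choice of Cb R K by <:].
HB.instance Definition _ := GRing.SubChoice_isSubComPzRing.Build _ _ (Cb R K)
  (GRing.subringClosedP _).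
HB.instance Definition _ := [SubZmodule_isSubLmodule of Cb R K by <:].
End Cb_algebra.

Section Cb_norm.
Context {R : realType} {K : topologicalType}.
Implicit Types f g : Cb R K.

Lemma CbP f g : f =1 g -> f = g.
Proof. by move=> fg; apply/val_inj/funext. Qed.

Definition supnorm f : R := sup [set complex.Re `|f k| | k in [set: K]].

Lemma supnorm_ge f k : `|f k| <= (supnorm f)%:C%C.
Proof.
have [_ [M fM]] := bounded_continuousP _ (Cb_funP f).
rewrite -[leLHS]complex.RRe_real ?ger0_real// lecR; apply: ub_le_sup; last by exists k.
by exists M => _ [j _ <-]; rewrite -lecR complex.RRe_real ?ger0_real.
Qed.

Lemma supnorm_le f (M : R) :
  0 <= M -> (forall k, `|f k| <= M%:C%C) -> supnorm f <= M.
Proof.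
move=> M0 fM; have [[k _]|] := pselect (exists k : K, True).
  apply: ge_sup; first by exists (complex.Re `|f k|), k.
  by move=> _ [j _ <-]; rewrite -lecR complex.RRe_real ?ger0_real.
move=> K0; rewrite /supnorm (_ : [set _ | _ in _] = set0) ?sup0//.
by apply/seteqP; split=> // x [k _ _]; apply: K0; exists k.
Qed.

Lemma supnorm_ge0 f : 0 <= supnorm f.
Proof.
have [[k _]|] := pselect (exists k : K, True).
  by rewrite -lecR; exact: le_trans (normr_ge0 (f k)) (supnorm_ge f k).
move=> K0; rewrite /supnorm (_ : [set _ | _ in _] = set0) ?sup0//.
by apply/seteqP; split=> // x [k _ _]; apply: K0; exists k.
Qed.

Lemma Cb_norm_triangle f g :
  (supnorm (f + g))%:C%C <= (supnorm f)%:C%C + (supnorm g)%:C%C :> R[i].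
Proof.
rewrite -rmorphD /= lecR; apply: supnorm_le.
  by rewrite addr_ge0// supnorm_ge0.
move=> k; rewrite rmorphD /= (le_trans (ler_normD _ _))//.
by rewrite lerD// supnorm_ge.
Qed.

Lemma Cb_normZ (a : R[i]) f :
  (supnorm (a *: f))%:C%C = `|a| * (supnorm f)%:C%C.
Proof.
have ReN (z : R[i]) : (complex.Re `|z|)%:C%C = `|z|.
  by rewrite complex.RRe_real ?ger0_real.
have Re_ge0 (z : R[i]) : 0 <= complex.Re `|z|.
  by rewrite -lecR ReN; exact: normr_ge0.
have le_scale (b : R[i]) g : supnorm (b *: g) <= complex.Re `|b| * supnorm g.
  apply: supnorm_le => [|k]; first by rewrite mulr_ge0 ?supnorm_ge0.
  by rewrite rmorphM /= ReN normrZ ler_wpM2l ?supnorm_ge.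
rewrite -[in RHS]ReN -rmorphM; congr (_%:C)%C; apply/le_anti.
rewrite le_scale andTb.
have [->|a0] := eqVneq a 0; first by rewrite normr0 [leLHS]mul0r supnorm_ge0.
have := le_scale a^-1 (a *: f); rewrite scalerA mulVf// scale1r.
move=> /(ler_wpM2l (Re_ge0 a)) /le_trans; apply.
have ReV : complex.Re `|a| * complex.Re `|a^-1| = 1.
  apply: complexI; rewrite rmorphM /= !ReN normfV divff//.
  by rewrite normr_eq0.
by rewrite mulrA ReV mul1r.
Qed.

Lemma Cb_norm_eq0 f : (supnorm f)%:C%C = 0 :> R[i] -> f = 0.
Proof.
move=> f0; apply: CbP => k; apply/eqP.
by rewrite -normr_le0 -f0 supnorm_ge.
Qed.

HB.instance Definition _ := @Lmodule_isNormed.Build R[i] (Cb R K)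
  (fun f => (supnorm f)%:C%C) Cb_norm_triangle Cb_normZ Cb_norm_eq0.

End Cb_norm.

Section Cb_constructions.
Context {R : realType}.

Lemma continuous_bounded (K : topologicalType) (f : K -> R[i]^o) :
  compact [set: K] -> continuous f -> f \in bounded_continuous.
Proof.
move=> cK cf; apply/bounded_continuousP; split=> //.
have /compact_near_coveringP/(_ R +oo_R (fun M k => `|f k| < M%:C%C)) := cK.
case=> [|M [_ Mf]]; last first.
  exists (M + 1) => k; apply/ltW/Mf => //; by rewrite ltrDl.
move=> k _; pose r := complex.Re `|f k|.
have rE : r%:C%C = `|f k| by rewrite /r complex.RRe_real ?ger0_real.
have cfk : \forall j \near k, `|f k - f j| < 1.
  by have /cvgrPdist_lt := cf k; apply; exact: ltr01.
exists ([set j | `|f k - f j| < 1], [set M | r + 1 < M]).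
  by split=> //=; exists (r + 1); rewrite ?num_real.
move=> [j M] [/= fkj rM].
have : (r + 1)%:C%C < M%:C%C :> R[i] by rewrite ltcR.
apply: le_lt_trans; rewrite rmorphD /= rE.
rewrite -[f j](subrK (f k)) (le_trans (ler_normD _ _))// addrC lerD2l.
by rewrite distrC ltW.
Qed.

Lemma Cb_comp_subproof (K L : topologicalType) (f : Cb R K)
  (h : continuousType L K) : (f \o h : L -> R[i]^o) \in bounded_continuous.
Proof.
have [cf [M fM]] := bounded_continuousP _ (Cb_funP f).
apply/bounded_continuousP; split; last by exists M => l; exact: fM.
by move=> l; apply: continuous_comp; [exact: cts_fun|exact: cf].
Qed.

Definition Cb_comp (K L : topologicalType) (f : Cb R K)
  (h : continuousType L K) : Cb R L := MkCb (Cb_comp_subproof f h).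

Lemma indic_clopen_subproof (K : topologicalType) (A : set K) :
  clopen A -> (\1_A : K -> R[i]^o) \in bounded_continuous.
Proof.
move=> [oA cA]; apply/bounded_continuousP; split; last first.
  by exists 1 => k; rewrite indicE; case: (k \in A); rewrite ?normr1 ?normr0 ?ler01.
move=> k; have [Ak|nAk] := pselect (A k).
  apply: (@near_cst_continuous K R[i]^o (\1_A k : R[i]^o)).
  apply: filterS (open_nbhs_nbhs (conj oA Ak)) => j Aj.
  by rewrite !indicE !mem_set.
apply: (@near_cst_continuous K R[i]^o (\1_A k : R[i]^o)).
have oC : open (~` A) by exact: closed_openC.
apply: filterS (open_nbhs_nbhs (conj oC nAk)) => j Aj.
by rewrite !indicE !memNset.
Qed.

(* Characteristic function of a clopen set. The fallback value 0 plays no role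
   for the sets considered below, which are clopen when [K] is compact
   Hausdorff and extremally disconnected. *)
Definition chi (K : topologicalType) (A : set K) : Cb R K :=
  match pselect (clopen A) with
  | left cA => MkCb (indic_clopen_subproof cA)
  | right _ => 0
  end.

End Cb_constructions.

Section operators.
Context {R : realType}.
Implicit Types V W : normedModType R[i].

Record blin V W := MkBlin {
  blin_fun :> {linear V -> W};
  blin_cont : continuous blin_fun }.

Definition opnorm V W (A : blin V W) : R :=
  sup [set complex.Re `|A x| | x in [set x | `|x| <= 1]].

(* The weak operator topology is the coarsest topology on L(V) that makes all
   the maps [A |-> xi (A x)] continuous, [xi] ranging over the dual of [V]. *)
Definition wot_map V (A : blin V V) : {ptws V * blin V R[i]^o -> R[i]^o} :=
  fun p => p.2 (A p.1).

HB.instance Definition _ V W := gen_eqMixin (blin V W).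
HB.instance Definition _ V W := gen_choiceMixin (blin V W).

Definition wot V : topologicalType := initial_topology (@wot_map V).

Definition inverse_op V (A B : blin V V) : Prop := cancel A B /\ cancel B A.

(* The restrictions [A|Y] are represented by [A] itself, together with the
   subspace [Y]. *)
Definition bounded_linear_on V (Y : set V) (A : V -> V) : Prop :=
  [/\ forall u, Y u -> Y (A u),
      forall (a : R[i]) u v, Y u -> Y v -> A (a *: u + v) = a *: A u + A v
    & exists M : R, forall u, Y u -> `|A u| <= M%:C%C * `|u| ].

Definition spectrum_on V (Y : set V) (A : V -> V) : set R[i]^o :=
  [set lambda | ~ exists B : V -> V, bounded_linear_on Y B /\
    forall u, Y u ->
      B (A u - lambda *: u) = u /\ A (B u) - lambda *: B u = u].

Definition ap_spectrum_on V (Y : set V) (A : V -> V) : set R[i]^o :=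
  [set lambda | exists x : nat -> V,
    (forall n, Y (x n) /\ `|x n| = 1) /\
    (fun n => A (x n) - lambda *: x n) @ \oo --> (0 : V)].

Definition unit_circle : set R[i]^o := [set z | `|z| = 1].

Definition rotation_invariant (A : set R[i]^o) : Prop :=
  forall alpha : R[i]^o, unit_circle alpha -> [set alpha * z | z in A] = A.

End operators.

Section lattice.
Context {R : realType} {V : lmodType R[i]}.
Implicit Types (P D : set V) (u v p q : V).

Definition real_part P : set V := [set a - b | a in P & b in P].

Definition is_lub P D p : Prop :=
  [/\ real_part P p, forall d, D d -> P (p - d)
    & forall q, real_part P q -> (forall d, D d -> P (q - d)) -> P (q - p)].

Definition is_glb P D p : Prop :=
  [/\ real_part P p, forall d, D d -> P (d - p)
    & forall q, real_part P q -> (forall d, D d -> P (d - q)) -> P (p - q)].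

(* [|u| = sup {Re (z u) : |z| = 1}] in the real part of the lattice, where
   [Re (z u) = Re z a - Im z b] for [u = a + i b] with [a] and [b] real. *)
Definition is_modulus P u p : Prop :=
  exists a b, [/\ real_part P a, real_part P b, u = a + 'i%C *: b &
    is_lub P [set (complex.Re z)%:C%C *: a - (complex.Im z)%:C%C *: b
             | z in [set z : R[i] | `|z| = 1]] p].

Definition disjoint_in P u v : Prop :=
  exists p q, [/\ is_modulus P u p, is_modulus P v q & is_glb P [set p; q] 0].

End lattice.

Section modules.
Context {R : realType} {K : topologicalType} {X : completeNormedModType R[i]}.
Implicit Types (f g h : Cb R K) (x u v : X) (m : Cb R K -> blin X X).

Definition extremally_disconnected (T : topologicalType) : Prop :=
  forall A : set T, open A -> open (closure A).

Definition Cb_nonneg : set (Cb R K) := [set f | forall k, 0 <= f k].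

Definition is_Cb_sup (D : set (Cb R K)) h : Prop :=
  is_lub Cb_nonneg D h.

(* Bands of the complex Riesz space C(K): order ideals which contain the
   suprema of their sets of real elements. *)
Definition is_band (B : set (Cb R K)) : Prop :=
  [/\ B 0, forall (a : R[i]) f g, B f -> B g -> B (a *: f + g),
      forall f g, B f -> (forall k, `|g k| <= `|f k|) -> B g
    & forall (D : set (Cb R K)) h, D `<=` B ->
        (forall f k, D f -> f k \is Num.real) -> is_Cb_sup D h -> B h].

Record banach_CK_module m : Prop := {
  module_compact : compact [set: K];
  module_hausdorff : hausdorff_space K;
  module_add : forall f g x, m (f + g) x = m f x + m g x;
  module_scale : forall (a : R[i]) f x, m (a *: f) x = a *: m f x;
  module_mul : forall f g x, m (f * g) x = m f (m g x);
  module_unit : forall x, m 1 x = x;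
  module_inj : injective m;
  module_isometric : forall f, (opnorm (m f))%:C%C = `|f|;
  module_wot_closed : closed (range m : set (wot X)) }.

Record kaplansky_module m : Prop := {
  kaplansky_banach :> banach_CK_module m;
  kaplansky_ed : extremally_disconnected K;
  kaplansky_band : forall x, is_band [set f | m f x = 0] }.

Definition cyclic m x : set X := closure [set m f x | f in [set: Cb R K]].

Definition cyclic_cone m x : set X :=
  closure [set m f x | f in Cb_nonneg].

Definition d_endomorphism m (T : blin X X) : Prop :=
  forall x, T @` cyclic m x `<=` cyclic m (T x) /\
    forall u v, cyclic m x u -> cyclic m x v ->
      disjoint_in (cyclic_cone m x) u v ->
      disjoint_in (cyclic_cone m (T x)) (T u) (T v).

Definition d_isomorphism m (U : blin X X) : Prop :=
  d_endomorphism m U /\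
  exists V, inverse_op U V /\ d_endomorphism m V.

Definition range_chi m (A : set K) : set X := range (m (chi A)).

End modules.

Section periodic.
Context {K : topologicalType}.
Implicit Type phi : continuousType K K.

Definition homeomorphism phi : Prop :=
  bijective phi /\ forall A : set K, open A -> open (phi @` A).

Definition Pi_ phi (n : nat) : set K :=
  [set k | [/\ (0 < n)%N, iter n phi k = k &
    forall j, (0 < j < n)%N -> iter j phi k <> k]].

Definition Pi phi : set K := closure (\bigcup_(n in [set n | (0 < n)%N]) Pi_ phi n).

Definition NPi phi : set K := ~` Pi phi.

Lemma NPi_invariant phi k : homeomorphism phi -> NPi phi k -> NPi phi (phi k).
Proof.
move=> [bphi ophi] nk; apply: contra_not nk => clk V /nbhs_interior nV.
have [|l [[n n0 [_ ln lj]]]] := clk (phi @` V°).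
  apply: open_nbhs_nbhs; split; last by exists k => //; exact: nbhs_singleton nV.
  by apply: ophi; exact: open_interior.
move=> [v vV vl]; exists v; split; last exact: interior_subset.
have iphi := bij_inj bphi.
exists n => //; split=> //.
  by apply: iphi; rewrite -iterS iterSr vl.
by move=> j jn vj; apply: (lj j jn); rewrite -vl -iterSr iterS vj.
Qed.

Lemma set_val_continuous (A : set K) : continuous (set_val : A -> K).
Proof. exact: initial_continuous. Qed.

Definition incl (A : set K) : continuousType A K := mkcts (@set_val_continuous A).

Definition NPi_map_fun phi (hphi : homeomorphism phi) (k : NPi phi) : NPi phi :=
  SigSub (mem_set (NPi_invariant hphi (set_valP k))).

Lemma NPi_map_continuous phi (hphi : homeomorphism phi) :
  continuous (NPi_map_fun hphi).
Proof.
apply: continuous_comp_initial.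
have -> : set_val \o NPi_map_fun hphi = phi \o incl (NPi phi) by [].
by move=> k; exact: cts_fun.
Qed.

Definition NPi_map phi (hphi : homeomorphism phi) :
  continuousType (NPi phi) (NPi phi) := mkcts (@NPi_map_continuous phi hphi).

Definition S_op {R : realType} (w : Cb R K) phi (hphi : homeomorphism phi)
    (f : Cb R (NPi phi)) : Cb R (NPi phi) :=
  Cb_comp w (incl (NPi phi)) * Cb_comp f (NPi_map hphi).

End periodic.

(* Main.v *)
(* With [a = |w| / |lam|] and [psi = phi^-1] let [W n k] be the product of
   [a (phi^j k)] over [j < n]. A formal eigenvector of [T] for [lam] is divided
   by [W n k] in modulus from [k] to [phi^n k]; call [k] a peak if its modulus
   along the orbit is maximal at [k], i.e. if [W n k >= 1] and
   [W n (psi^n k) <= 1] for all [n]. As the spectrum of [U] lies on the circle,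
   the powers of [U] and of its inverse grow subexponentially, and the
   spectral properties of [T] on the band of an invariant clopen set [D] can be
   read off from [W], whatever the norm of the module:
   - If [D] has no peaks, compactness and a walk along the orbits give
     exponential growth of [1 / W] to the left or to the right of every point,
     which beats the growth of [U]; so [T - lam] is bounded below.
   - At a nonperiodic peak, small clopen sets with disjoint iterates carry
     approximate eigenvectors for every [mu] with [|mu| = |lam|].
   - [T - lam] is onto if [D] splits into invariant clopen sets on which [W]
     decays, respectively grows, exponentially. If [D] has no periodic points
     this is also necessary for invertibility. If the periodic points are dense
     in [D] it follows from the absence of peaks, because exponential growth on
     both sides of a periodic point would produce a peak on its finite orbit.
   - Where [phi^n = id], [W n] is invariant, so [D] is the union of a
     decaying part and of a part that is growing for a nearby [mu], and
     surjectivity passes from [mu] to [lam] once [T - lam] is bounded below.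
   On [NPi] both spectra are thus described by [W] alone, and the description
   applies to [X] as well as to [C(NPi)], a module over [C(K)] by restriction. *)

Require Import Defs.
From HB Require Import structures.
From mathcomp Require Import all_boot all_order all_algebra complex.
From mathcomp Require Import all_classical all_reals all_analysis.
From mathcomp Require Import ring lra zify.

Set Implicit Arguments.
Unset Strict Implicit.
Unset Printing Implicit Defensive.

Import Order.TTheory GRing.Theory Num.Theory.
Import numFieldNormedType.Exports.

Local Open Scope classical_set_scope.
Local Open Scope ring_scope.

(** * Extremally disconnected spaces *)

Section topology_lemmas.
Context {K : topologicalType}.
Implicit Types (A B O E : set K) (f : K -> K).

(** The norm of the module is not a supremum norm: functions act with norm at most their supremum,
    and beyond that pieces with disjoint supports can only be added up. The walk along the orbits is
    therefore arranged so that every point escapes at some time in a window [L < n <= L + N] whose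
    length [N] does not depend on [L]. Then [N] clopen pieces always suffice, while the gain on each
    of them is exponential in [L]. Extremal disconnectedness turns the closures of the open sets
    where [W n] is small or large into clopen sets, whose characteristic functions act as
    projections. The times vary from point to point, but their bounds do not, not even with the
    period of a periodic orbit; this is what makes the estimates pass to closures. The growth of [U]
    is drawn from the invertibility of [1 - z U] on the open unit disc, with roots of unity in place
    of holomorphic functions. A rate [rho' = (1 + rho) / 2] is charged to [U], and [rho' / rho < 1]
    remains as the gain per step. Rotation invariance has its origin in the fact that peaks depend
    on [|lam|] only. *)

Lemma open_disjoint_closure A B :
  open A -> A `&` B = set0 -> A `&` closure B = set0.
Proof.
move=> oA AB0; apply/seteqP; split=> // k [Ak kB].
have [|l [Bl Al]] := kB A; first exact: open_nbhs_nbhs.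
by have : set0 l by rewrite -AB0.
Qed.

Lemma continuous_iter f n : continuous f -> continuous (iter n f).
Proof.
move=> cf; elim: n => [|n IH] k /=; first exact: cvg_id.
by apply: continuous_comp; [exact: IH|exact: cf].
Qed.

Lemma clopen_setC A : clopen A -> clopen (~` A).
Proof. exact: (clopenC set0). Qed.

Lemma clopen_setD A B : clopen A -> clopen B -> clopen (A `\` B).
Proof. by rewrite setDE => ? /clopen_setC; exact: clopenI. Qed.

Lemma iter_cancel (phi psi : K -> K) n :
  cancel phi psi -> cancel (iter n phi) (iter n psi).
Proof. by move=> pK; elim: n => // n IH k; rewrite iterSr [iter n.+1 phi k]iterS pK IH. Qed.
End topology_lemmas.

Section extremally_disconnected_spaces.
Context {K : topologicalType}.
Hypotheses (cK : compact [set: K]) (hK : hausdorff_space K)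
  (edK : extremally_disconnected K).
Implicit Types (A B O E : set K) (f : K -> K).

Lemma closure_clopen O : open O -> clopen (closure O).
Proof. by move=> oO; split; [exact: edK|exact: closed_closure]. Qed.

Lemma disjoint_closures A B : open A -> open B ->
  A `&` B = set0 -> closure A `&` closure B = set0.
Proof.
move=> oA oB AB0; rewrite setIC; apply: open_disjoint_closure.
  exact: (closure_clopen oB).1.
by rewrite setIC; exact: open_disjoint_closure.
Qed.

Lemma clopen_nbhs k O : nbhs k O -> exists E, [/\ clopen E, E k & E `<=` O].
Proof.
move=> Ok; have := compact_regular hK cK (@filterT _ (nbhs k) _) Ok.
move=> [V Vk VO]; exists (closure V°); split.
- exact: closure_clopen (@open_interior _ _).
- by apply: subset_closure; exact: nbhs_singleton (nbhs_interior Vk).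
- by apply: subset_trans VO; exact: closureS (@interior_subset _ _).
Qed.

Variables phi psi : K -> K.
Hypotheses (cphi : continuous phi) (cpsi : continuous psi).
Hypotheses (phiK : cancel phi psi) (psiK : cancel psi phi).

Lemma preimage_closure A : phi @^-1` closure A = closure (phi @^-1` A).
Proof.
apply/seteqP; split=> k /= kA B nB.
  have [|l [Al Bl]] := kA (psi @^-1` B).
    by apply: cpsi; rewrite phiK.
  by exists (psi l); split=> //=; rewrite psiK.
have [|l [Al Bl]] := kA (phi @^-1` B); first exact: cphi.
by exists (phi l).
Qed.

(* Frolik's theorem. A maximal open set [V] disjoint from its preimage is
   clopen, and the non-fixed points are covered by [V], [phi^-1 V], [phi V]. *)
Lemma fixed_points_clopen : clopen [set k | phi k = k].
Proof.
pose P (V : set K) := open V /\ V `&` phi @^-1` V = set0.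
have [|V [[oV V0] Vmax]] := @Zorn_bigcup K P.
  move=> F FP Ftot; split; first by apply: bigcup_open => A /FP[].
  apply/seteqP; split=> // k [[A FA Ak] [B FB Bk]].
  have [AB|BA] := Ftot _ _ FA FB.
    by have [_ <-] := FP _ FB; split=> //; exact: AB.
  by have [_ <-] := FP _ FA; split=> //; exact: BA.
have cV : clopen V.
  suff <- : closure V = V by exact: closure_clopen.
  apply/seteqP; split; last exact: subset_closure.
  (* The closure of [V] is again a candidate, because disjoint open sets have disjoint closures. *)
  apply: contrapT => nVV; apply: (Vmax (closure V)).
    by split=> //; exact: subset_closure.
  split; first exact: (closure_clopen oV).1.
  rewrite preimage_closure; apply: disjoint_closures => //.
  by apply: open_comp => // k _; exact: cphi.
pose D := V `|` phi @^-1` V `|` psi @^-1` V.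
have cD : clopen D.
  by rewrite /D; do ?apply: clopenU => //; exact: preimage_clopen.
suff -> : [set k | phi k = k] = ~` D by exact: clopen_setC.
apply/seteqP; split=> k /= => [kk|nDk].
  have nV : ~ V k.
    by move=> Vk; have : set0 k by rewrite -V0; split=> //=; rewrite kk.
  by move=> [[]|] /=; rewrite ?kk// -{1}kk phiK.
apply: contrapT => kk.
have [W [cW Wk WD]] : exists W, [/\ clopen W, W k & W `<=` ~` D `&` ~` [set phi k]].
  apply: clopen_nbhs; apply: open_nbhs_nbhs; split; last by split=> // /esym.
  apply: openI; first exact: (clopen_setC cD).1.
  by apply: closed_openC; exact: accessible_closed_set1 (hausdorff_accessible hK) _.
(* [phi] moves [E] off itself, and [E] misses [V] and both of its translates; so adding [E] to [V]
   contradicts maximality. *)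
pose E := W `&` phi @^-1` (~` W).
have cE : clopen E.
  by apply: clopenI => //; apply: preimage_clopen => //; exact: clopen_setC.
have Ek : E k by split=> //= /WD [_] /=.
apply: (Vmax (V `|` E)).
  split=> [|VE]; first exact: subsetUl.
  have [nD _] := WD _ Wk; apply: nD; do 2!left.
  by apply: VE; right.
split; first exact: openU oV cE.1.
apply/seteqP; split=> // j [[Vj|[Wj nWj]] [Vj'|[Wj' nWj']]].
- by rewrite -V0.
- have [nD _] := WD _ Wj'; apply: nD; right => /=.
  by rewrite phiK.
- have [nD _] := WD _ Wj; apply: nD; left; right.
  exact: Vj'.
- exact: nWj.
Qed.

(** Each induction step intersects with a clopen [D] that contains [k] but not [phi^(n+1) k], and
    with the preimage of its complement. Vectors carried along the orbit from [E] will then have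
    disjoint supports. *)
Lemma wandering_nbhs k O n : nbhs k O ->
  (forall j, (0 < j <= n)%N -> iter j phi k <> k) ->
  exists E, [/\ clopen E, E k, E `<=` O &
    forall j x, (0 < j <= n)%N -> E x -> ~ E (iter j phi x)].
Proof.
move=> kO; elim: n => [|n IH] nk.
  have [E [cE Ek EO]] := clopen_nbhs kO.
  by exists E; split=> // j x /andP[]; case: j.
have [j jn|E [cE Ek EO Ej]] := IH.
  by apply: nk; case/andP: jn => -> /= /leqW.
have [|D [cD Dk Dn]] := @clopen_nbhs k (~` [set iter n.+1 phi k]).
  apply: open_nbhs_nbhs; split; last by move=> /esym; apply: nk; rewrite ltnSn.
  apply: closed_openC.
  exact: accessible_closed_set1 (hausdorff_accessible hK) _.
exists (E `&` (D `&` iter n.+1 phi @^-1` (~` D))); split.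
- apply: clopenI => //; apply: clopenI => //; apply: preimage_clopen.
    exact: clopen_setC.
  exact: continuous_iter.
- split=> //; split; first exact: Dk.
  by move=> /Dn; apply.
- by move=> x [/EO].
- move=> j x /andP[j0]; rewrite leq_eqVlt ltnS => /orP[/eqP ->|jn].
    by move=> [_ [_ /= nD]] [_ []].
  by move=> [Ex _] [Ejx _]; apply: (Ej j x) => //; rewrite j0.
Qed.
End extremally_disconnected_spaces.

(** * Cocycles along the orbits of a homeomorphism *)

Section cocycles.
Context {R : realType} {K : topologicalType}.
Variables phi psi : K -> K.
Hypotheses (cphi : continuous phi) (cpsi : continuous psi).
Hypotheses (phiK : cancel phi psi) (psiK : cancel psi phi).
Implicit Types (A B E : set K) (beta rho : R).

Definition invariant_set A : Prop := forall k, A (phi k) <-> A k.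

Lemma invariant_iter A n k : invariant_set A -> A (iter n phi k) <-> A k.
Proof. by move=> iA; elim: n => //= n <-; exact: iA. Qed.

Lemma invariant_inv A k : invariant_set A -> A (psi k) <-> A k.
Proof. by move=> iA; rewrite -{2}(psiK k); symmetry; exact: iA. Qed.

Lemma invariant_iter_inv A n k : invariant_set A -> A (iter n psi k) <-> A k.
Proof. by move=> iA; elim: n => //= n <-; exact: invariant_inv. Qed.

Lemma invariant_setD A B :
  invariant_set A -> invariant_set B -> invariant_set (A `\` B).
Proof.
by move=> iA iB k; split=> -[? nB]; (split; first exact/iA) => /iB.
Qed.

Variable a : K -> R.
Hypotheses (ca : continuous a) (a_ge0 : forall k, 0 <= a k).

Definition cocycle (n : nat) (k : K) : R := \prod_(i < n) a (iter i phi k).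

Lemma cocycle0 k : cocycle 0 k = 1. Proof. exact: big_ord0. Qed.

Lemma cocycleS n k : cocycle n.+1 k = a k * cocycle n (phi k).
Proof.
rewrite /cocycle big_ord_recl; congr (_ * _).
by apply: eq_bigr => i _; rewrite -iterSr.
Qed.

Lemma cocycle1 k : cocycle 1 k = a k.
Proof. by rewrite cocycleS cocycle0 mulr1. Qed.

Lemma cocycleD n p k :
  cocycle (n + p) k = cocycle n k * cocycle p (iter n phi k).
Proof.
elim: n k => [|n IH] k; first by rewrite cocycle0 mul1r.
by rewrite addSn !cocycleS IH mulrA iterSr.
Qed.

Lemma cocycle_ge0 n k : 0 <= cocycle n k.
Proof. by apply: prodr_ge0. Qed.

Lemma cocycle_continuous n : continuous (cocycle n).
Proof.
elim: n => [|n IH] k.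
  rewrite (_ : cocycle 0 = cst 1); first exact: cvg_cst.
  by apply/funext => x; rewrite cocycle0.
rewrite (_ : cocycle n.+1 = fun k => a k * cocycle n (phi k)); last first.
  by apply/funext => x; rewrite cocycleS.
apply: cvgM; first exact: ca.
by apply: continuous_comp; [exact: cphi|exact: IH].
Qed.

Lemma cocycle_iter_inv_continuous n :
  continuous (fun k => cocycle n (iter n psi k)).
Proof.
move=> k; apply: continuous_comp; last exact: cocycle_continuous.
exact: continuous_iter.
Qed.

Lemma cocycle_split_inv n p k : (p <= n)%N ->
  cocycle n (iter n psi k) =
  cocycle (n - p) (iter n psi k) * cocycle p (iter p psi k).
Proof.
move=> pn; rewrite -{1}(subnK pn) cocycleD; congr (_ * cocycle _ _).
by rewrite -{2}(subnK pn) iterD iter_cancel.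
Qed.

Lemma cocycle_period m k : iter m phi k = k -> cocycle m (phi k) = cocycle m k.
Proof.
case: m => [|m] km; first by rewrite !cocycle0.
by rewrite -[in LHS]addn1 cocycleD cocycle1 cocycleS -iterSr km mulrC.
Qed.

Lemma cocycle_period_inv m n k : iter m phi k = k ->
  cocycle m (iter n psi k) = cocycle m k.
Proof.
move=> km; have kmi i : iter m phi (iter i psi k) = iter i psi k.
  rewrite -[in RHS]km.
  by elim: i => //= i <-; rewrite -{2}(psiK (iter i psi k)) -iterSr iterS phiK.
by elim: n => //= n <-; rewrite -[RHS](congr1 _ (psiK _)) cocycle_period// -iterS kmi.
Qed.

(* Orbits of this kind carry approximate eigenvectors: an eigenvector of the
   weighted composition operator is multiplied by [(cocycle n k)^-1] when one
   moves from [k] to [phi^n k], hence has its maximal modulus at [k]. *)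
Definition peak (k : K) : Prop :=
  forall n, 1 <= cocycle n k /\ cocycle n (iter n psi k) <= 1.

(** Both alternatives say that a formal eigenvector is more than [beta] times larger at some point
    within [N] steps of [k]. *)
Definition no_peak A (N : nat) beta : Prop := forall k, A k ->
  exists n, (0 < n <= N)%N /\
    (cocycle n k < beta^-1 \/ beta < cocycle n (iter n psi k)).

(** The time [n] may depend on [k], only its bound is uniform. Conditions of this kind are closed in
    [k], and the blocks concatenate to exponential decay at all times. *)
Definition contracting E (M : nat) rho : Prop := forall k, E k ->
  exists n, (0 < n <= M)%N /\ cocycle n k <= rho ^- n.

Definition expanding E (M : nat) rho : Prop := forall k, E k ->
  exists n, (0 < n <= M)%N /\ rho ^+ n <= cocycle n (iter n psi k).

Lemma no_peak_uniform A : compact A -> (forall k, A k -> ~ peak k) ->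
  exists N beta, 1 < beta /\ no_peak A N beta.
Proof.
move=> cA npA.
pose b (N : nat) : R := 1 + N.+1%:R^-1.
pose P (N : nat) (k : K) := exists n, (0 < n <= N)%N /\
  (cocycle n k < (b N)^-1 \/ b N < cocycle n (iter n psi k)).
have b1 N : 1 < b N by rewrite /b ltrDl invr_gt0.
have /compact_near_coveringP/(_ nat \oo P) [k Ak|N _ PN] := cA; last first.
- by exists N, (b N); split=> // k Ak; exact: PN (leqnn N) k Ak.
- have /existsNP[n /not_andP npk] := npA k Ak.
  have n0 : (0 < n)%N.
    by case: n npk => //; rewrite !cocycle0 => -[/negP|/negP]; rewrite lexx.
  case: npk => /negP; rewrite -ltNge => npk.
    (* The midpoint leaves room for moving [k] on one side and for the margin [b N] on the other. *)
    pose c := (1 + cocycle n k) / 2.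
    have c1 : c < 1 by rewrite /c; lra.
    have ck : cocycle n k < c by rewrite /c; lra.
    have c0 : 0 < c by rewrite /c; have := cocycle_ge0 n k; lra.
    have near_k : \forall k' \near k, cocycle n k' < c.
      by have /cvgr_lt := @cocycle_continuous n k; apply.
    have e0 : 0 < 1 - c by rewrite subr_gt0.
    have near_N : \forall N \near \oo, N.+1%:R^-1 < 1 - c :> R.
      exact: (near_infty_natSinv_lt (PosNum e0)).
    exists ([set k' | cocycle n k' < c],
        [set N | (n <= N)%N /\ N.+1%:R^-1 < 1 - c :> R]) => /=.
      by split=> //; apply: filterI => //; exact: nbhs_infty_ge.
    move=> [k' N] [/= k'c [nN Nc]]; exists n; rewrite n0 nN; split=> //; left.
    rewrite (lt_trans k'c)// -[ltRHS]mul1r ltr_pdivlMr ?(lt_trans _ (b1 N))//.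
    rewrite /b mulrDr mulr1 -ltrBrDl; apply: le_lt_trans Nc.
    by rewrite ler_piMl// ltW.
  pose c := (1 + cocycle n (iter n psi k)) / 2.
  have c1 : 1 < c by rewrite /c; lra.
  have ck : c < cocycle n (iter n psi k) by rewrite /c; lra.
  have near_k : \forall k' \near k, c < cocycle n (iter n psi k').
    by have /cvgr_gt := @cocycle_iter_inv_continuous n k; apply.
  have e0 : 0 < c - 1 by rewrite subr_gt0.
  have near_N : \forall N \near \oo, N.+1%:R^-1 < c - 1 :> R.
    exact: (near_infty_natSinv_lt (PosNum e0)).
  exists ([set k' | c < cocycle n (iter n psi k')],
      [set N | (n <= N)%N /\ N.+1%:R^-1 < c - 1 :> R]) => /=.
    by split=> //; apply: filterI => //; exact: nbhs_infty_ge.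
  move=> [k' N] [/= k'c [nN Nc]]; exists n; rewrite n0 nN; split=> //; right.
  by rewrite (lt_trans _ k'c)// /b -ltrBrDl.
Qed.

(* One maximizes [h i / rho ^+ |i - M|] over the window [|i - M| <= L]: a jump
   from the maximum must leave the window. *)
Lemma escape_window (h : nat -> R) (M L N : nat) beta rho :
  1 < rho -> rho ^+ N <= beta -> (L <= M)%N -> h M = 1 ->
  (forall i, (M - L <= i <= M + L)%N -> 0 < h i ->
    exists j, [/\ (j <= i + N)%N, (i <= j + N)%N & beta * h i < h j]) ->
  exists j, (L < (j - M) + (M - j) <= L + N)%N /\
    rho ^+ ((j - M) + (M - j)) < h j.
Proof.
move=> rho1 rhoN LM hM jump.
have rho0 : 0 < rho by exact: lt_trans rho1.
pose d i := ((i - M) + (M - i))%N.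
pose g (i : 'I_(M + M).+1) := h i / rho ^+ d i.
have Mlt : (M < (M + M).+1)%N by lia.
pose i0 := Ordinal Mlt.
have d0 : (d i0 <= L)%N by rewrite /d /=; lia.
have [q dq qmax] := @arg_maxP _ _ _ i0 (fun i => (d i <= L)%N) g d0.
have gq1 : 1 <= g q.
  rewrite -(_ : g i0 = 1); first exact: qmax.
  by rewrite /g /d /= hM subnn expr0 divr1.
have hq : rho ^+ d q <= h q by move: gq1; rewrite /g ler_pdivlMr ?exprn_gt0// mul1r.
have hq0 : 0 < h q by apply: lt_le_trans hq; rewrite exprn_gt0.
have [|j [jq qj hj]] := jump q _ hq0; first by move: dq; rewrite /d; lia.
have djq : (d j <= d q + N)%N by rewrite /d; lia.
have rhoj : rho ^+ d j <= rho ^+ d q * beta.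
  apply: (@le_trans _ _ (rho ^+ (d q + N))).
    by apply: ler_weXn2l => //; exact: ltW.
  by rewrite exprD ler_wpM2l// exprn_ge0// ltW.
have beta0 : 0 < beta by apply: lt_le_trans rhoN; rewrite exprn_gt0.
exists j; case: (leqP (d j) L) => [djL|djL]; last first.
  split; first by move: djq dq; rewrite -/(d j); lia.
  apply: le_lt_trans hj; apply: le_trans rhoj _.
  by rewrite mulrC ler_wpM2l// ltW.
exfalso.
have jlt : (j < (M + M).+1)%N by move: djL; rewrite /d; lia.
have : g (Ordinal jlt) <= g q by exact: qmax.
rewrite {1}/g /= ler_pdivrMr ?exprn_gt0// => hjq.
have : g q * rho ^+ d j <= h q * beta.
  rewrite /g -mulrA ler_wpM2l ?(ltW hq0)//.
  by rewrite mulrC ler_pdivrMr ?exprn_gt0// mulrC.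
by move: hjq hj; lra.
Qed.

(** [N] stays fixed while [L] is arbitrary; later this bounds the number of clopen pieces
    independently of the strength of the growth. *)
Lemma no_peak_escape A N beta : invariant_set A -> 1 < beta ->
  no_peak A N beta -> exists rho, 1 < rho /\ forall L k, A k ->
    exists n, (L < n <= L + N)%N /\
      (cocycle n k < rho ^- n \/ rho ^+ n < cocycle n (iter n psi k)).
Proof.
move=> iA beta1 npA.
have beta0 : 0 < beta by exact: lt_trans beta1.
(* The root of order [N + 1] makes sense before [N > 0] is known, and it still satisfies
   [rho ^ N <= beta]. *)
exists (expR (ln beta / N.+1%:R)); set rho := expR _.
have lb : 0 < ln beta by rewrite ln_gt0.
have rho1 : 1 < rho by rewrite expR_gt1 divr_gt0.
have rho0 : 0 < rho by exact: lt_trans rho1.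
have rhoN : rho ^+ N <= beta.
  apply: (@le_trans _ _ (rho ^+ N.+1)); first by rewrite ler_weXn2l// ltW.
  by rewrite -expRM_natl mulrC divfK// lnK.
split=> // L k Ak.
have N0 : (0 < N)%N by have [n [/andP[n0 nN] _]] := npA k Ak; exact: leq_trans nN.
pose M := (L + N)%N.
(* Once the cocycle vanishes it vanishes at all later times, and the left alternative is trivial;
   otherwise the inverses in [h] below are legitimate. *)
have [[p pM Wp0]|Wn0] := pselect (exists2 p, (p <= M)%N & cocycle p k = 0).
  exists (maxn p L.+1); split; first by rewrite /M in pM; lia.
  left; rewrite -(subnKC (leq_maxl p L.+1)) cocycleD Wp0 mul0r.
  by rewrite invr_gt0 exprn_gt0.
have Wpos p : (p <= M)%N -> 0 < cocycle p k.
  by move=> pM; rewrite lt_neqAle cocycle_ge0 andbT; apply/eqP => W0; apply: Wn0; exists p.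
pose y i := iter i phi (iter M psi k).
have y_psi n i : (n <= i)%N -> iter n psi (y i) = y (i - n)%N.
  by move=> ni; rewrite /y -{1}(subnKC ni) iterD iter_cancel.
have y_phi n i : iter n phi (y i) = y (i + n)%N by rewrite /y addnC iterD.
have y_M i : y (M + i)%N = iter i phi k.
  by rewrite /y addnC iterD iter_cancel.
have yM : y M = k by exact: iter_cancel.
have yA i : A (y i) by apply/invariant_iter => //; exact/invariant_iter_inv.
(* The modulus of a formal eigenvector along the orbit segment [y], normalized to 1 at [y M = k]. *)
pose h i := if (i <= M)%N then cocycle (M - i) (y i) else (cocycle (i - M) k)^-1.
have hrec i n : (i + n <= M + M)%N -> h i = cocycle n (y i) * h (i + n)%N.
  move=> inM; rewrite /h; case: (leqP i M) => iM; last first.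
    rewrite ifN; last by lia.
    rewrite (_ : (i + n - M = (i - M) + n)%N); last by lia.
    rewrite cocycleD -y_M subnKC; last exact: ltnW.
    have := Wpos (i - M + n)%N; rewrite cocycleD -y_M subnKC; last exact: ltnW.
    move=> /(_ ltac:(lia)) W0; rewrite invfM mulrC mulfVK//.
    by apply/negP => /eqP W00; move: W0; rewrite W00 mulr0 ltxx.
  case: ifPn => inM'.
    rewrite (_ : (M - i = n + (M - (i + n)))%N); last by lia.
    by rewrite cocycleD y_phi.
  rewrite (_ : n = (M - i) + (i + n - M))%N; last by lia.
  rewrite cocycleD y_phi subnKC// yM.
  rewrite (_ : (i + (M - i + (i + n - M)) - M = i + n - M)%N); last by lia.
  by rewrite mulfK// gt_eqF// Wpos//; lia.
have LM : (L <= M)%N by rewrite /M; lia.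
have hM : h M = 1 by rewrite /h leqnn subnn cocycle0.
have [i iw hi|j [jw hj]] := @escape_window h M L N beta rho rho1 rhoN LM hM.
  have [n [/andP[n0 nN] [Wn|Wn]]] := npA _ (yA i).
    exists (i + n)%N; split; [by lia|by lia|].
    rewrite (@hrec i n) ?/M in hi *; last by rewrite /M in iw *; lia.
    have hin : 0 < h (i + n)%N.
      rewrite ltNge; apply/negP => hin; move: hi; rewrite ltNge => /negP; apply.
      by rewrite mulr_ge0_le0// cocycle_ge0.
    rewrite mulrA gtr_pMl// mulrC -ltr_pdivlMr// mul1r//.
  have ni : (n <= i)%N by rewrite /M in iw; lia.
  exists (i - n)%N; split; [by lia|by lia|].
  rewrite (@hrec (i - n)%N n); last by rewrite /M in iw *; lia.
  by rewrite subnK// ltr_pM2r// -y_psi.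
exists ((j - M) + (M - j))%N; split=> //.
move: hj; rewrite /h; case: (leqP j M) => jM.
  rewrite (_ : (j - M + (M - j) = M - j)%N); last by lia.
  move=> hj; right.
  rewrite (_ : iter (M - j) psi k = y j)//.
  by rewrite -{1}yM y_psi ?leq_subr// subKn.
rewrite (_ : (j - M + (M - j) = j - M)%N); last by lia.
move=> hj; left; rewrite -[ltLHS]invrK ltf_pV2 ?posrE ?exprn_gt0//.
by rewrite invr_gt0 Wpos//; rewrite /M in jw *; lia.
Qed.
End cocycles.

Lemma exp_unbounded (R : realType) (rho x : R) :
  1 < rho -> exists n, x <= rho ^+ n.
Proof.
move=> rho1; pose e := rho - 1; have e0 : 0 < e by rewrite subr_gt0.
have bernoulli n : 1 + n%:R * e <= rho ^+ n.
  elim: n => [|n IH]; first by rewrite mul0r addr0 expr0.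
  rewrite exprS; apply: (@le_trans _ _ (rho * (1 + n%:R * e))); last first.
    by rewrite ler_wpM2l// ltW// (lt_trans ltr01).
  have ne : 0 <= n%:R * e by rewrite mulr_ge0// ltW.
  have -> : rho = 1 + e by rewrite /e; lra.
  by rewrite -natr1; nra.
exists (Num.bound (x / e)); apply: le_trans (bernoulli _).
have [x0|x0] := leP x 0.
  by apply: le_trans x0 _; rewrite addr_ge0// mulr_ge0// ltW.
have := @archi_boundP _ (x / e) (divr_ge0 (ltW x0) (ltW e0)).
by rewrite ltr_pdivrMr// => /ltW/le_trans; apply; rewrite lerDr.
Qed.

Lemma closed_exists_bounded (K : topologicalType) (M : nat) (P : nat -> set K) :
  (forall n, closed (P n)) ->
  closed [set k | exists n, (0 < n <= M)%N /\ P n k].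
Proof.
move=> cP; elim: M => [|M IH].
  rewrite (_ : [set _ | _] = set0); first exact: closed0.
  by apply/seteqP; split=> // k [[|n] []].
rewrite (_ : [set _ | _] =
    [set k | exists n, (0 < n <= M)%N /\ P n k] `|` P M.+1); first exact: closedU.
apply/seteqP; split=> k /=.
  move=> [n [/andP[n0]]]; rewrite leq_eqVlt ltnS => /orP[/eqP ->|nM] Pn.
    by right.
  by left; exists n; rewrite n0.
move=> [[n [/andP[n0 nM] Pn]]|PM]; last by exists M.+1; rewrite ltnSn.
by exists n; rewrite n0 leqW.
Qed.

(** * Exponential estimates and dichotomies for cocycles *)

Section dichotomies.
Context {R : realType} {K : topologicalType}.
Variables phi psi : K -> K.
Hypotheses (cphi : continuous phi) (cpsi : continuous psi).
Hypotheses (phiK : cancel phi psi) (psiK : cancel psi phi).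
Variables (a : K -> R) (b : R).
Hypotheses (ca : continuous a) (a_ge0 : forall k, 0 <= a k).
Hypotheses (b1 : 1 <= b) (ab : forall k, a k <= b).
Implicit Types (A B E : set K) (beta rho : R).
Local Notation W := (cocycle phi a).

Lemma cocycle_le_exp n k : W n k <= b ^+ n.
Proof.
elim: n k => [|n IH] k; first by rewrite cocycle0 expr0.
by rewrite cocycleS exprS ler_pM// cocycle_ge0.
Qed.

(** Each complete block contributes a factor at most 1 to [W n k * rho ^ n]; the last, incomplete
    block has length at most [M] and costs at most [(b * rho) ^ M]. *)
Lemma contracting_decay E M rho : invariant_set phi E -> 1 < rho ->
  contracting phi a E M rho ->
  exists2 C, 0 < C & forall k n, E k -> W n k * rho ^+ n <= C.
Proof.
move=> iE rho1 cE.
have rho0 : 0 < rho by exact: lt_trans rho1.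
have br1 : 1 <= b * rho by rewrite mulr_ege1// ltW.
have C0 : 0 < (b * rho) ^+ M by rewrite exprn_gt0// (lt_le_trans _ br1).
exists ((b * rho) ^+ M) => // k n; elim/ltn_ind: n k => n IH k Ek.
case: (leqP n M) => nM.
  apply: (@le_trans _ _ ((b * rho) ^+ n)); last by rewrite ler_weXn2l.
  by rewrite exprMn ler_wpM2r ?cocycle_le_exp// exprn_ge0// ltW.
have [p [/andP[p0 pM] Wp]] := cE k Ek.
have pn : (p <= n)%N by exact: leq_trans pM (ltnW nM).
rewrite -(subnKC pn) cocycleD exprD mulrACA.
have Wp1 : W p k * rho ^+ p <= 1.
  by rewrite -ler_pdivlMr ?exprn_gt0// mul1r.
rewrite -[leRHS]mul1r ler_pM//.
- by rewrite mulr_ge0// ?cocycle_ge0// exprn_ge0// ltW.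
- by rewrite mulr_ge0// ?cocycle_ge0// exprn_ge0// ltW.
- apply: IH; last exact/invariant_iter.
  by rewrite ltn_subrL p0 (leq_trans p0).
Qed.

(** Here the incomplete block calls for a lower bound on [a]. A zero of [a] on [E] would make the
    cocycle vanish, against expansion, so compactness gives [c > 0], and the block costs at most
    [(rho / c) ^ M]. *)
Lemma expanding_growth E M rho : invariant_set phi E -> compact E -> 1 < rho ->
  expanding phi psi a E M rho ->
  (exists2 c, 0 < c & forall k, E k -> c <= a k) /\
  exists2 C, 0 < C & forall k n, E k -> rho ^+ n <= C * W n k.
Proof.
move=> iE cE rho1 eE.
have rho0 : 0 < rho by exact: lt_trans rho1.
have a_gt0 k : E k -> 0 < a k.
  (* Backward products at [phi k] have [a k] as their last factor. *)
  move=> Ek; have [n [/andP[n0 nM]]] := eE (phi k) ((iE k).2 Ek).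
  case: n n0 {nM} => // n _.
  have -> : iter n.+1 psi (phi k) = iter n psi k by rewrite iterSr phiK.
  rewrite -[in W _ _]addn1 cocycleD cocycle1 iter_cancel// => Wn; rewrite lt_neqAle a_ge0 andbT.
  apply/eqP => ak; move: Wn; rewrite -ak mulr0 leNgt.
  by rewrite exprn_gt0.
have [c c0 ac] : exists2 c, 0 < c & forall k, E k -> c <= a k.
  have /compact_near_coveringP/(_ nat \oo (fun N k => N.+1%:R^-1 <= a k)) := cE.
  case=> [k Ek|N _ aN]; last first.
    by exists N.+1%:R^-1; [rewrite invr_gt0|exact: aN (leqnn N)].
  have ak : 0 < a k / 2 by rewrite divr_gt0// a_gt0.
  exists ([set k' | a k / 2 < a k'], [set N | N.+1%:R^-1 < a k / 2]) => /=.
    split; last exact: (near_infty_natSinv_lt (PosNum ak)).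
    have /cvgr_gt := @ca k; apply.
    by rewrite ltr_pdivrMr// ltr_pMr ?a_gt0// ltr1n.
  by move=> [k' N] [/= ak' aN]; apply: ltW; apply: lt_trans ak'.
split; first by exists c.
wlog c1 : c c0 ac / c <= 1.
  move=> wl; apply: (wl (Num.min c 1)); first by rewrite lt_min c0 ltr01.
    by move=> k Ek; rewrite ge_min ac.
  by rewrite ge_min lexx orbT.
have Wc n k : E k -> c ^+ n <= W n k.
  elim: n k => [|n IH] k Ek; first by rewrite cocycle0 expr0.
  rewrite cocycleS exprS ler_pM ?ac ?(ltW c0) ?exprn_ge0 ?(ltW c0)//.
  by apply: IH; exact/iE.
have rc1 : 1 <= rho / c.
  by rewrite ler_pdivlMr// mul1r (le_trans c1)// ltW.
have rc0 : 0 < rho / c by exact: lt_le_trans rc1.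
pose C := (rho / c) ^+ M.
have C0 : 0 < C by rewrite exprn_gt0.
have WC n k : E k -> rho ^+ n <= C * W n (iter n psi k).
  elim/ltn_ind: n k => n IH k Ek; case: (leqP n M) => nM.
    rewrite (_ : rho ^+ n = (rho / c) ^+ n * c ^+ n); last first.
      by rewrite -exprMn divfK// gt_eqF.
    rewrite ler_pM ?exprn_ge0 ?(ltW rc0) ?(ltW c0)//.
      by rewrite ler_weXn2l.
    by apply: Wc; exact/(invariant_iter_inv psiK).
  have [p [/andP[p0 pM] Wp]] := eE k Ek.
  have pn : (p <= n)%N by exact: leq_trans pM (ltnW nM).
  rewrite (cocycle_split_inv psiK _ _ pn).
  rewrite -{1}(subnK pn) exprD mulrA ler_pM ?exprn_ge0 ?(ltW rho0)//.
  rewrite -{3}(subnK pn) iterD; apply: IH.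
    by rewrite ltn_subrL p0 (leq_trans p0).
  exact/(invariant_iter_inv psiK).
exists C => // k n Ek; rewrite -[k](iter_cancel n phiK); apply: WC.
exact/invariant_iter.
Qed.

Section periodic_orbits.
Variables (N : nat) (beta : R) (A : set K).
Hypotheses (beta1 : 1 < beta) (iA : invariant_set phi A).
Hypothesis npA : no_peak phi psi a A N beta.

Let beta0 : 0 < beta. Proof. exact: lt_trans beta1. Qed.
Let bN0 n : 0 < b ^+ n. Proof. by rewrite exprn_gt0// (lt_le_trans _ b1). Qed.
Let bN n : (n <= N)%N -> b ^+ n <= b ^+ N.
Proof. by move=> nN; rewrite ler_weXn2l. Qed.

(* On a periodic orbit [n |-> cocycle n (psi^n k)] attains its supremum, and
   a value above [b ^+ N] would be attained at a point that violates [npA]. *)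
Lemma periodic_backward_bound k m q : A k -> (0 < m)%N -> iter m phi k = k ->
  W m k <= 1 -> W q (iter q psi k) <= b ^+ N.
Proof.
move=> Ak m0 km Wm; rewrite leNgt; apply/negP => Wq.
pose F j := W j (iter j psi k).
have F_ge0 j : 0 <= F j by exact: cocycle_ge0.
have Fm i j : F (i * m + j)%N <= F j.
  elim: i => // i IH; apply: le_trans IH; set l := (i * m + j)%N.
  rewrite (_ : (i.+1 * m + j = m + l)%N); last by rewrite /l; lia.
  rewrite /F (cocycle_split_inv psiK _ _ (leq_addl m l)) addnK.
  by rewrite (cocycle_period_inv phiK psiK)// ler_piMl ?cocycle_ge0.
have [j _ jmax] := @arg_maxP _ _ _ (Ordinal m0) xpredT (fun i : 'I_m => F i) isT.
have Fj i : F i <= F j.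
  rewrite (divn_eq i m); apply: le_trans (Fm _ _) _.
  exact: (jmax (Ordinal (ltn_pmod i m0)) isT).
have Fjb : b ^+ N < F j by exact: lt_le_trans (Fj q).
have Fj0 : 0 < F j by exact: lt_trans Fjb.
have jN : (N < j)%N.
  rewrite ltnNge; apply/negP => jN; move: Fjb; rewrite ltNge => /negP; apply.
  exact: le_trans (cocycle_le_exp _ _) (bN jN).
have [|n [/andP[n0 nN] [Wn|Wn]]] := @npA (iter j psi k).
- exact/(invariant_iter_inv psiK).
- have nj : (n <= j)%N by exact: leq_trans nN (ltnW jN).
  have := Fj (j - n)%N; apply/negP; rewrite -ltNge.
  have FjE : F j = W n (iter j psi k) * F (j - n)%N.
    by rewrite /F -{1}(subKn nj) (cocycle_split_inv psiK _ _ (leq_subr n j)) subKn.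
  have Fjn0 : 0 < F (j - n)%N.
    by rewrite lt_neqAle F_ge0 andbT; apply/eqP => F0; move: Fj0; rewrite FjE -F0 mulr0 ltxx.
  rewrite FjE gtr_pMl// (lt_trans Wn)// invf_lt1//.
- have := Fj (n + j)%N; apply/negP; rewrite -ltNge.
  rewrite /F (cocycle_split_inv psiK _ _ (leq_addl n j)) addnK iterD.
  by rewrite ltr_pMl// (lt_trans beta1).
Qed.

(** The mirror image of the backward bound: since [W m k >= 1], the minimum of [j |-> W j k] is
    attained within the first period, and a minimum below [b ^- N] would contradict [npA] at the
    minimizing point. *)
Lemma periodic_forward_bound k m p : A k -> (0 < m)%N -> iter m phi k = k ->
  1 <= W m k -> 1 <= b ^+ N * W p k.
Proof.
move=> Ak m0 km Wm; rewrite leNgt; apply/negP => Wp.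
pose G j := W j k.
have G_ge0 j : 0 <= G j by exact: cocycle_ge0.
have Gm i j : G j <= G (i * m + j)%N.
  elim: i => // i IH; apply: le_trans IH _; set l := (i * m + j)%N.
  rewrite (_ : (i.+1 * m + j = m + l)%N); last by rewrite /l; lia.
  by rewrite /G cocycleD km ler_peMl// cocycle_ge0.
have [j _ jmin] := @arg_minP _ _ _ (Ordinal m0) xpredT (fun i : 'I_m => G i) isT.
have Gj i : G j <= G i.
  rewrite (divn_eq i m); apply: le_trans (Gm _ _).
  exact: (jmin (Ordinal (ltn_pmod i m0)) isT).
have Gjb : b ^+ N * G j < 1 by apply: le_lt_trans Wp; rewrite ler_wpM2l ?(ltW (bN0 N))//; exact: Gj.
have Gj0 : 0 < G j.
  rewrite lt_neqAle G_ge0 andbT; apply/eqP => G0; move: Wm.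
  by rewrite -(subnKC (ltnW (ltn_ord j))) cocycleD -/(G j) -G0 mul0r ler10.
have [|n [/andP[n0 nN] [Wn|Wn]]] := @npA (iter j phi k).
- exact/invariant_iter.
- have := Gj (j + n)%N; apply/negP; rewrite -ltNge.
  by rewrite /G cocycleD gtr_pMr// (lt_trans Wn)// invf_lt1.
- case: (leqP n j) => nj.
    have := Gj (j - n)%N; apply/negP; rewrite -ltNge.
    have GjE : G j = G (j - n)%N * W n (iter (j - n) phi k).
      by rewrite /G -{1}(subnK nj) cocycleD.
    move: Wn; rewrite -{1}(subnKC nj) iterD iter_cancel// => Wn.
    rewrite GjE ltr_pMr ?(lt_trans beta1)//.
    by apply: lt_le_trans Gj0 (Gj _).
  (* Here the backward product starts before [k]. The piece before [k] is at most [b ^ N], so the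
     whole product is below 1, against [beta > 1]. *)
  move: Wn; rewrite -{2}(subnK (ltnW nj)) iterD iter_cancel//.
  rewrite -{1}(subnK (ltnW nj)) cocycleD iter_cancel// -/(G j).
  apply/negP; rewrite -leNgt; apply: le_trans (ltW beta1).
  apply: le_trans (ltW Gjb); rewrite ler_wpM2r//.
  apply: le_trans (cocycle_le_exp _ _) _; apply: bN.
  by rewrite (leq_trans _ nN)// leq_subr.
Qed.
End periodic_orbits.

Lemma closed_contracting M rho :
  closed [set k | exists n, (0 < n <= M)%N /\ W n k <= rho ^- n].
Proof.
apply: closed_exists_bounded => n.
apply: (@closed_comp _ _ _ [set x | x <= rho ^- n]); last exact: closed_le.
by move=> k _; exact: cocycle_continuous.
Qed.

Lemma closed_expanding M rho : closed
  [set k | exists n, (0 < n <= M)%N /\ rho ^+ n <= W n (iter n psi k)].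
Proof.
apply: closed_exists_bounded => n.
apply: (@closed_comp _ _ _ [set x | rho ^+ n <= x]); last exact: closed_ge.
by move=> k _; exact: cocycle_iter_inv_continuous.
Qed.

(** An exponential dichotomy of the cocycle, with stable part [B] and unstable part [A \ B]. *)
Definition dichotomy A : Prop := exists B M rho,
  [/\ clopen B, invariant_set phi B, B `<=` A, 1 < rho &
    contracting phi a B M rho /\ expanding phi psi a (A `\` B) M rho].

Lemma invariant_closure A : invariant_set phi A -> invariant_set phi (closure A).
Proof.
move=> iA k; rewrite -[closure A (phi k)]/((phi @^-1` closure A) k).
rewrite (preimage_closure cphi cpsi)// (_ : phi @^-1` A = A)//.
by apply/seteqP; split=> j /=; rewrite iA.
Qed.

Lemma invariant_preimage_iter A n : invariant_set phi A ->
  invariant_set phi [set k | A k /\ iter n phi k = k].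
Proof.
move=> iA k /=; rewrite iA -iterSr iterS; split=> -[Ak nk]; split=> //.
  by rewrite -[LHS]phiK nk phiK.
by rewrite nk.
Qed.

(** On a periodic orbit the product over a period decides the direction of growth, since the bounds
    on periodic orbits exclude one alternative of [esc]. The times obtained are at most [L + N]
    whatever the period, so the estimates are closed conditions and extend from the periodic points
    to their closure. *)
Lemma dense_periodic_dichotomy A N beta :
  compact [set: K] -> hausdorff_space K -> extremally_disconnected K ->
  clopen A -> invariant_set phi A -> 1 < beta -> no_peak phi psi a A N beta ->
  A `<=` closure [set k | A k /\ exists2 m, (0 < m)%N & iter m phi k = k] ->
  dichotomy A.
Proof.
move=> cK hK edK cA iA beta1 npA perA.
have [rho [rho1 esc]] := no_peak_escape phiK psiK a_ge0 iA beta1 npA.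
(* For [n > L] the growth [rho ^ n] reaches the bound [b ^ N] that holds on periodic orbits. *)
have [L rhoL] := exp_unbounded (b ^+ N) rho1.
have rho0 : 0 < rho by exact: lt_trans rho1.
have bN0 n : 0 < b ^+ n by rewrite exprn_gt0// (lt_le_trans _ b1).
pose P m := [set k | A k /\ iter m phi k = k].
have iP m : invariant_set phi (P m) by exact: invariant_preimage_iter.
pose O := \bigcup_(m in [set m | (0 < m)%N]) [set k | P m k /\ W m k < 1].
(* By Frolik's theorem the fixed points of [phi^m] form an open set. *)
have oO : open O.
  apply: bigcup_open => m _.
  rewrite (_ : [set k | _] =
      (A `&` [set k | iter m phi k = k]) `&` [set k | W m k < 1]); last by [].
  apply: openI; first apply: openI; first exact: cA.1.
    apply: (fixed_points_clopen cK hK edK (psi := iter m psi) _ _ _ _).1.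
    - exact: continuous_iter.
    - exact: continuous_iter.
    - exact: iter_cancel.
    - exact: iter_cancel.
  apply: (@open_comp _ _ (W m) [set x | x < 1]); last exact: open_lt.
  by move=> k _; exact: cocycle_continuous.
have iO : invariant_set phi O.
  move=> k; split=> -[m m0 [Pk Wk]]; exists m => //; split.
  - exact/iP.
  - by move: Wk; rewrite cocycle_period//; case: ((iP m k).1 Pk).
  - exact/iP.
  - by rewrite cocycle_period//; case: Pk.
pose B := closure O.
have cB : clopen B by exact: closure_clopen.
have iB : invariant_set phi B by exact: invariant_closure.
exists B, (L + N)%N, rho; split=> //.
- rewrite (closure_id A).1; last exact: cA.2.
  by apply: closureS => k [m _ [[]]].
split.
- move=> k Bk; pose Z := [set k | exists n, (0 < n <= L + N)%N /\ W n k <= rho ^- n].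
  suff : closure Z k by rewrite -(closure_id Z).1//; exact: closed_contracting.
  apply: closureS Bk => {}k [m m0 [[Ak km] Wm]].
  have [n [/andP[Ln nN] Wn]] := esc L k Ak.
  have n0 : (0 < n)%N by exact: leq_ltn_trans Ln.
  exists n; rewrite n0 nN; split=> //; case: Wn => [/ltW//|Wn].
  have := periodic_backward_bound beta1 iA npA n Ak m0 km (ltW Wm).
  rewrite leNgt => /negP; case; apply: le_lt_trans Wn.
  by apply: le_trans rhoL _; rewrite ler_weXn2l ?(ltW rho1)// ltnW.
- move=> k ABk; pose Z := [set k | exists n, (0 < n <= L + N)%N /\
    rho ^+ n <= W n (iter n psi k)].
  suff : closure Z k by rewrite -(closure_id Z).1//; exact: closed_expanding.
  move=> D kD; have [|j [[Aj [m m0 jm]] [Dj Bj]]] := perA _ ABk.1 (D `&` ~` B).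
    apply: filterI => //; apply: open_nbhs_nbhs; split; last exact: ABk.2.
    exact: (clopen_setC cB).1.
  exists j; split=> //.
  have Wm : 1 <= W m j.
    rewrite leNgt; apply/negP => Wm; apply: Bj; apply: subset_closure.
    by exists m.
  have [n [/andP[Ln nN] Wn]] := esc L j Aj.
  have n0 : (0 < n)%N by exact: leq_ltn_trans Ln.
  exists n; rewrite n0 nN; split=> //; case: Wn => [Wn|/ltW//].
  have := periodic_forward_bound beta1 iA npA n Aj m0 jm Wm.
  rewrite leNgt => /negP; case.
  rewrite mulrC -ltr_pdivlMr// mul1r; apply: (lt_le_trans Wn).
  rewrite lef_pV2 ?posrE ?bN0 ?exprn_gt0//; apply: le_trans rhoL _.
  by rewrite ler_weXn2l ?(ltW rho1)// ltnW.
Qed.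
End dichotomies.

(** * Growth of the powers of an operator *)

Section real_norms.
Context {R : realType}.

(** Norms take values in [R[i]], whose order is partial; the real version is accessible to real
    arithmetic. *)
Definition nrm {V : normedZmodType R[i]} (x : V) : R := complex.Re `|x|.

Section normed_zmodule.
Context {V : normedZmodType R[i]}.
Implicit Types x y : V.

Lemma nrmE x : (nrm x)%:C%C = `|x|.
Proof. by rewrite /nrm complex.RRe_real// ger0_real. Qed.

Lemma nrm_ge0 x : 0 <= nrm x.
Proof. by rewrite -lecR nrmE; exact: normr_ge0. Qed.

Lemma nrm_le x (c : R) : (nrm x <= c) = (`|x| <= c%:C%C).
Proof. by rewrite -nrmE lecR. Qed.

Lemma nrm0 : nrm (0 : V) = 0. Proof. by rewrite /nrm normr0. Qed.

Lemma nrm_eq0 x : nrm x = 0 -> x = 0.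
Proof. by move=> x0; apply: normr0_eq0; rewrite -nrmE x0. Qed.

Lemma nrm_gt0 x : x <> 0 -> 0 < nrm x.
Proof.
by move=> x0; rewrite lt_neqAle nrm_ge0 andbT; apply/eqP => /esym/nrm_eq0.
Qed.

Lemma nrmN x : nrm (- x) = nrm x. Proof. by rewrite /nrm normrN. Qed.

Lemma nrmB x y : nrm (x - y) = nrm (y - x). Proof. by rewrite -nrmN opprB. Qed.

Lemma nrmD_le x y : nrm (x + y) <= nrm x + nrm y.
Proof. by rewrite -lecR rmorphD /= !nrmE; exact: ler_normD. Qed.

Lemma nrmB_le x y : nrm (x - y) <= nrm x + nrm y.
Proof. by rewrite -(nrmN y); exact: nrmD_le. Qed.
End normed_zmodule.

Implicit Types a b : R[i].

Lemma nrm1 : nrm (1 : R[i]) = 1. Proof. by rewrite /nrm normr1. Qed.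

Lemma nrmM a b : nrm (a * b) = nrm a * nrm b.
Proof. by apply: complexI; rewrite rmorphM /= !nrmE normrM. Qed.

Lemma nrmX a n : nrm (a ^+ n) = nrm a ^+ n.
Proof. by elim: n => [|n IH]; rewrite ?expr0 ?nrm1// !exprS nrmM IH. Qed.

Lemma nrmV a : nrm a^-1 = (nrm a)^-1.
Proof. by apply: complexI; rewrite fmorphV /= !nrmE normfV. Qed.

Lemma nrm_real (x : R) : nrm x%:C%C = `|x|.
Proof. by apply: complexI; rewrite nrmE normc_def /= expr0n addr0 sqrtr_sqr. Qed.

Lemma nrmZ {V : normedModType R[i]} a (x : V) : nrm (a *: x) = nrm a * nrm x.
Proof. by apply: complexI; rewrite rmorphM /= !nrmE normrZ. Qed.

Lemma nrm_ReIm (x y : R) : nrm (x%:C + 'i * y%:C)%C <= `|x| + `|y|.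
Proof.
apply: le_trans (nrmD_le _ _) _; rewrite nrmM !nrm_real.
rewrite (_ : nrm 'i%C = 1) ?mul1r//.
by apply: complexI; rewrite nrmE normc_def /= expr0n expr1n add0r sqrtr1.
Qed.

Lemma le_nrm_Re a : `|complex.Re a| <= nrm a.
Proof. by rewrite -lecR nrmE; exact: normc_ge_Re. Qed.

Lemma le_nrm_Im a : `|complex.Im a| <= nrm a.
Proof.
case: a => x y /=; apply: le_trans (le_nrm_Re (y +i* x)%C) _.
by rewrite le_eqVlt; apply/orP; left; rewrite /nrm !normc_def /= addrC.
Qed.
End real_norms.

(** * The spectral radius formula, from invertibility on the open disc *)

Section spectral_radius.
Context {R : realType} {V : normedModType R[i]}.
Variables (A : {linear V -> V}) (alpha : R).
Hypothesis A_le : forall x, nrm (A x) <= alpha * nrm x.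
Hypothesis resolvent : forall z : R[i], nrm z < 1 ->
  (exists2 c, 0 < c & forall x, c * nrm x <= nrm (x - z *: A x)) /\
  forall y, exists x, x - z *: A x = y.

Let A_le' x : nrm (A x) <= `|alpha| * nrm x.
Proof. by apply: le_trans (A_le x) _; rewrite ler_wpM2r ?nrm_ge0 ?ler_norm. Qed.

(** A lower bound at one [z] persists nearby with half the constant, and the disc of radius [r] is
    compact. Compactness is taken from the real square [[-1, 1]^2], with a vacuous claim outside the
    disc. *)
Lemma resolvent_uniform (r : R) : r < 1 -> exists2 c, 0 < c &
  forall (z : R[i]) x, nrm z <= r -> c * nrm x <= nrm (x - z *: A x).
Proof.
move=> r1.
pose z_ (p : R * R) : R[i] := (p.1%:C + 'i * p.2%:C)%C.
pose P (N : nat) (p : R * R) := nrm (z_ p) <= r ->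
  forall x, N.+1%:R^-1 * nrm x <= nrm (x - z_ p *: A x).
have cpt : compact (`[-1, 1]%classic `*` `[-1, 1]%classic : set (R * R)).
  by apply: compact_setX; exact: segment_compact.
have /compact_near_coveringP/(_ nat \oo P) [[x0 y0] _|N _ PN] := cpt; last first.
  exists N.+1%:R^-1; first by rewrite invr_gt0.
  move=> z x zr; have zE : z = z_ (complex.Re z, complex.Im z).
    by rewrite /z_ /= [LHS]complexE.
  rewrite zE; apply: (PN N) => /=; [exact: leqnn| |by rewrite -zE].
  have z1 : nrm z <= 1 by exact: le_trans (ltW r1).
  split; rewrite /= in_itv /= -ler_norml.
    exact: le_trans (le_nrm_Re z) z1.
  exact: le_trans (le_nrm_Im z) z1.
have near_z e : 0 < e -> \forall p \near (x0, y0), nrm (z_ p - z_ (x0, y0)) <= e.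
  move=> e0; have e2 : 0 < e / 2 by rewrite divr_gt0.
  exists ([set x | `|x0 - x| < e / 2], [set y | `|y0 - y| < e / 2]).
    by split; apply/nbhs_ballP; exists (e / 2).
  move=> [x y] [/= xe ye].
  rewrite (_ : z_ _ - z_ _ = z_ (x - x0, y - y0)); last first.
    by rewrite /z_ /= !rmorphB /=; ring.
  apply: le_trans (nrm_ReIm _ _) _; rewrite !(distrC _ x0) !(distrC _ y0).
  by move: xe ye; lra.
have near_prod (Q : nat -> R * R -> Prop) e (N0 : nat -> Prop) : 0 < e ->
    (\forall N \near \oo, N0 N) ->
    (forall N p, N0 N -> nrm (z_ p - z_ (x0, y0)) <= e -> Q N p) ->
    \forall p \near (x0, y0) & N \near \oo, Q N p.
  move=> e0 nN QP; exists ([set p | nrm (z_ p - z_ (x0, y0)) <= e], N0).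
    by split=> //=; exact: near_z.
  by move=> [p N] [/= pe N0N]; exact: QP.
(* At a point of modulus at least 1 nothing is known about the resolvent, but the disc of radius [r]
   does not come near it. *)
have [z1|z1] := ltP (nrm (z_ (x0, y0))) 1; last first.
  apply: (near_prod _ ((1 - r) / 2) (fun=> True)).
  - by rewrite divr_gt0// subr_gt0.
  - exact: filterT.
  move=> N p _ pe pr; exfalso; move: z1; rewrite leNgt => /negP; apply.
  rewrite -[z_ (x0, y0)](subrK (z_ p)); apply: le_lt_trans (nrmD_le _ _) _.
  by rewrite nrmB; lra.
have [[c c0 cz] _] := resolvent z1.
(* Moving [z] by this amount changes [z A] by at most [c / 2] in norm; the added 1 covers
   [alpha = 0]. *)
have e0 : 0 < c / 2 / (`|alpha| + 1) by rewrite !divr_gt0// ltr_wpDl.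
have c2 : 0 < c / 2 by rewrite divr_gt0.
apply: (near_prod _ _ (fun N => N.+1%:R^-1 < c / 2) e0).
  exact: (near_infty_natSinv_lt (PosNum c2)).
move=> N p Nc pe pr x.
have dz : nrm ((z_ p - z_ (x0, y0)) *: A x) <= c / 2 * nrm x.
  rewrite nrmZ; apply: (@le_trans _ _ (c / 2 / (`|alpha| + 1) * (`|alpha| * nrm x))).
    by rewrite ler_pM ?nrm_ge0.
  rewrite -!mulrA ler_wpM2l ?(ltW c0)// ler_wpM2l// mulrA ler_piMl ?nrm_ge0//.
  by rewrite mulrC ler_pdivrMr ?mul1r ?lerDl// ltr_wpDl.
apply: (@le_trans _ _ (c / 2 * nrm x)); first by rewrite ler_wpM2r ?nrm_ge0 ?(ltW Nc).
have := cz x; rewrite (_ : x - z_ (x0, y0) *: A x =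
  (x - z_ p *: A x) + (z_ p - z_ (x0, y0)) *: A x); last first.
  by rewrite scalerBl addrA subrK.
by have := nrmD_le (x - z_ p *: A x) ((z_ p - z_ (x0, y0)) *: A x); lra.
Qed.

(** The partial fraction identity [1 / (1 - Y^2) = (1 / (1 - Y) + 1 / (1 + Y)) / 2]. *)
Lemma half_sum_inverse (Y s t : V -> V) :
  (forall a x y, Y (a *: x + y) = a *: Y x + Y y) ->
  (forall x, s x - Y (s x) = x) -> (forall x, s (x - Y x) = x) ->
  (forall x, t x + Y (t x) = x) -> (forall x, t (x + Y x) = x) ->
  (forall x, 2^-1 *: (s x + t x) - Y (Y (2^-1 *: (s x + t x))) = x) /\
  (forall x, 2^-1 *: (s (x - Y (Y x)) + t (x - Y (Y x))) = x).
Proof.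
move=> linY s1 s2 t1 t2.
have YD x y : Y (x + y) = Y x + Y y by have := linY 1 x y; rewrite !scale1r.
have Y0 : Y 0 = 0 by apply: (addrI (Y 0)); rewrite -YD !addr0.
have YZ a x : Y (a *: x) = a *: Y x by have := linY a x 0; rewrite Y0 !addr0.
have YN x : Y (- x) = - Y x by rewrite -scaleN1r YZ scaleN1r.
have half (x : V) : 2^-1 *: (x + x) = x :> V.
  by rewrite -mulr2n -(scaler_nat 2 x) scalerA mulVf ?scale1r// pnatr_eq0.
have subYY x : x - Y (Y x) = (x - Y x) + Y (x - Y x).
  by rewrite YD YN addrA subrK.
have addYY x : x - Y (Y x) = (x + Y x) - Y (x + Y x).
  by rewrite YD opprD addrA addrK.
split=> x; last by rewrite {1}addYY {1}subYY s2 t2 addrACA subrr addr0 half.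
rewrite !YZ -scalerBr !YD opprD addrACA (subYY (s x)) (addYY (t x)) s1 t1.
by rewrite addrACA subrr addr0 half.
Qed.

Let iterA_lin n a x y : iter n A (a *: x + y) = a *: iter n A x + iter n A y.
Proof. by elim: n => //= n ->; rewrite linearP. Qed.

(** Rotating [z] by [zeta] changes the sign of [z ^ (2 ^ l)], so the inverses of [1 - Y] and of
    [1 + Y] in [half_sum_inverse] come from one family. *)
Lemma root_of_minus_one l : exists zeta : R[i],
  nrm zeta = 1 /\ zeta ^+ (2 ^ l) = -1.
Proof.
elim: l => [|l [z [z1 zl]]]; first by exists (-1); rewrite nrmN nrm1 expn0 expr1.
exists (sqrtC z); have zz : sqrtC z ^+ 2 = z by exact: sqrtCK.
split; last by rewrite expnS exprM zz.
have : nrm (sqrtC z) ^+ 2 = 1 by rewrite -nrmX zz.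
by move/eqP; rewrite sqrp_eq1 ?nrm_ge0// => /eqP.
Qed.

(* Averaging [(1 - zA)^-1] over rotations of [z] inverts [1 - (zA)^(2^l)], and
   averages inherit the Lipschitz constant in [z]. *)
Lemma resolvent_powers (r : R) : 0 <= r < 1 -> exists2 Lam, 0 < Lam &
  forall l, exists S : R[i] -> V -> V,
    (forall z x, nrm z <= r ->
      S z x - z ^+ (2 ^ l) *: iter (2 ^ l) A (S z x) = x /\
      S z (x - z ^+ (2 ^ l) *: iter (2 ^ l) A x) = x) /\
    (forall z z' x, nrm z <= r -> nrm z' <= r ->
      nrm (S z x - S z' x) <= Lam * nrm (z - z') * nrm x).
Proof.
move=> /andP[r0 r1]; have [c c0 cA] := resolvent_uniform r1.
have c20 : 0 < c * c by rewrite mulr_gt0.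
have Lam0 : 0 < (`|alpha| + 1) / (c * c) by rewrite divr_gt0// ltr_wpDl.
(* For [l = 0] the constant comes from the resolvent identity [S z - S z' = (z - z') S z A S z'],
   where each resolvent has norm at most [1 / c]. *)
exists ((`|alpha| + 1) / (c * c)) => //; elim=> [|l [S [invS lipS]]].
  have /choice[S SP] : forall p : R[i] * V, exists y,
      nrm p.1 <= r -> y - p.1 *: A y = p.2.
    move=> [z x]; have [zr|zr] := leP (nrm z) r; last first.
      by exists 0.
    have [_ /(_ x)[y yx]] := resolvent (le_lt_trans zr r1).
    by exists y.
  have SE z x : nrm z <= r -> S (z, x) - z *: A (S (z, x)) = x by exact: (SP (z, x)).
  have EB z p q : (p - q) - z *: A (p - q) = (p - z *: A p) - (q - z *: A q).
    by rewrite linearB scalerBr opprD addrACA -opprD.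
  have S_le z x : nrm z <= r -> c * nrm (S (z, x)) <= nrm x.
    by move=> zr; rewrite -{2}(SE z x zr); exact: cA.
  exists (fun z x => S (z, x)); split=> [z x zr|z z' x zr zr'] /=.
    rewrite expn0 expr1; split; first exact: SE.
    apply/eqP; rewrite -subr_eq0; apply/eqP; apply: nrm_eq0; apply/eqP.
    rewrite eq_le nrm_ge0 andbT -(pmulr_rle0 _ c0).
    by apply: le_trans (cA z _ zr) _; rewrite EB SE// subrr nrm0.
  set d := _ - _; have dE : d - z *: A d = (z - z') *: A (S (z', x)).
    rewrite EB SE// -[X in X - _](SE z' x zr').
    by rewrite opprB addrC addrA subrK scalerBl.
  have := cA z d zr; rewrite dE nrmZ => cd.
  rewrite -(ler_pM2l c20) -(mulrA c c (nrm d)).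
  apply: (@le_trans _ _ (c * (nrm (z - z') * (`|alpha| * nrm (S (z', x)))))).
    rewrite ler_pM2l//; apply: le_trans cd _.
    by rewrite ler_wpM2l ?nrm_ge0.
  have -> : c * c * ((`|alpha| + 1) / (c * c) * nrm (z - z') * nrm x) =
      nrm (z - z') * ((`|alpha| + 1) * nrm x).
    by field; rewrite gt_eqF.
  rewrite mulrCA ler_wpM2l ?nrm_ge0// mulrCA ler_pM ?mulr_ge0 ?nrm_ge0 ?(ltW c0)//.
    by rewrite lerDl.
  exact: S_le.
have [zeta [zeta1 zetal]] := root_of_minus_one l.
have zetar z : nrm z <= r -> nrm (zeta * z) <= r by rewrite nrmM zeta1 mul1r.
exists (fun z x => 2^-1 *: (S z x + S (zeta * z) x)).
have h2 : nrm (2^-1 : R[i]) = 2^-1.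
  by apply: complexI; rewrite nrmE normfV normr_nat fmorphV /= rmorph_nat.
split=> [z x zr|z z' x zr zr'].
  pose Y x := z ^+ (2 ^ l) *: iter (2 ^ l) A x.
  have Ylin a y y' : Y (a *: y + y') = a *: Y y + Y y'.
    by rewrite /Y iterA_lin scalerDr !scalerA mulrC.
  have YY y : z ^+ (2 ^ l.+1) *: iter (2 ^ l.+1) A y = Y (Y y).
    rewrite /Y expnS mul2n -addnn exprD iterD -scalerA; congr (_ *: _).
    have := iterA_lin (2 ^ l) (z ^+ (2 ^ l)) (iter (2 ^ l) A y) 0.
    have A0 : iter (2 ^ l) A 0 = 0.
      by elim: (2 ^ l)%N => //= n ->; rewrite linear0.
    by rewrite A0 !addr0.
  have zY y : (zeta * z) ^+ (2 ^ l) *: iter (2 ^ l) A y = - Y y.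
    by rewrite exprMn zetal mulN1r scaleNr.
  have [] := @half_sum_inverse Y (S z) (S (zeta * z)) Ylin.
  - by move=> y; case: (invS z y zr).
  - by move=> y; case: (invS z y zr).
  - by move=> y; case: (invS _ y (zetar _ zr)); rewrite !zY !opprK.
  - by move=> y; case: (invS _ y (zetar _ zr)); rewrite !zY !opprK.
  by rewrite !YY => H1 H2; split; [exact: H1|exact: H2].
rewrite -scalerBr nrmZ h2 opprD addrACA mulrC ler_pdivrMr//.
apply: le_trans (nrmD_le _ _) _; rewrite mulr_natr mulr2n lerD//.
  exact: lipS.
apply: le_trans (lipS _ _ _ (zetar _ zr) (zetar _ zr')) _.
by rewrite -mulrBr nrmM zeta1 mul1r.
Qed.

(* Rickart's argument: once [(sA)^(2^l)] tends to [0], the inverses of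
   [resolvent_powers] tend to [1] at [s], and by equicontinuity they stay close
   to [1] on a ball around [s] whose radius does not depend on [s]. *)
Lemma scaled_powers_small (r : R) : 0 <= r < 1 ->
  exists l, forall x, r ^+ (2 ^ l) * nrm (iter (2 ^ l) A x) <= 2^-1 * nrm x.
Proof.
move=> r01; have /andP[r0 r1] := r01.
have [Lam Lam0 SLam] := resolvent_powers r01.
pose small (q s : R) := exists l, forall x,
  s ^+ (2 ^ l) * nrm (iter (2 ^ l) A x) <= q * nrm x.
have square q s : 0 <= s -> 0 <= q -> small q s -> small (q * q) s.
  move=> s0 q0 [l sl]; exists l.+1 => x.
  rewrite expnS mul2n -addnn exprD iterD -mulrA.
  apply: (@le_trans _ _ (s ^+ (2 ^ l) * (q * nrm (iter (2 ^ l) A x)))).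
    by rewrite ler_wpM2l ?exprn_ge0.
  by rewrite mulrCA -mulrA ler_wpM2l.
have step s s' : 0 <= s -> s <= s' -> s' <= r -> Lam * (s' - s) <= 4^-1 ->
    small 2^-1 s -> small 2^-1 s'.
  move=> s0 ss' s'r Lss' small_s.
  have h2 : 0 <= 2^-1 :> R by rewrite invr_ge0.
  (* Squaring twice turns 1/2 into 1/16. Then [S] at [s] is within 1/15 of the identity, and at [s']
     within 1/15 + 1/4 <= 1/3; this makes the scaled power at [s'] at most (1/3) / (1 - 1/3) = 1/2
     again. *)
  have [l sl] := square _ _ s0 (mulr_ge0 h2 h2) (square _ _ s0 h2 small_s).
  have [S [invS lipS]] := SLam l.
  have s'0 : 0 <= s' by exact: le_trans ss'.
  have cr (t : R) : 0 <= t -> nrm t%:C%C = t by move=> t0; rewrite nrm_real ger0_norm.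
  have sr : nrm s%:C%C <= r by rewrite cr// (le_trans ss').
  have s'r' : nrm s'%:C%C <= r by rewrite cr.
  have S1 x : nrm (S s%:C%C x - x) <= 15^-1 * nrm x.
    set y := S _ x; have [yE _] := invS _ x sr.
    have : nrm (y - x) <= 16^-1 * nrm y.
      rewrite -[in X in _ - X]yE -/y opprB addrC subrK nrmZ nrmX cr//.
      by apply: le_trans (sl y) _; lra.
    have : nrm y <= nrm (y - x) + nrm x by rewrite -{1}(subrK x y) nrmD_le.
    by lra.
  have S2 x : nrm (S s'%:C%C x - x) <= 3^-1 * nrm x.
    rewrite -(subrK (S s%:C%C x) (S s'%:C%C x)) -addrA.
    apply: le_trans (nrmD_le _ _) _.
    have := lipS _ _ x s'r' sr; rewrite -rmorphB cr ?subr_ge0//= => lip.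
    have := S1 x; have := nrm_ge0 x; nra.
  exists l => x; have [_] := invS _ x s'r'.
  set Yx := _ *: _ => SYx.
  have := S2 (x - Yx); rewrite SYx opprB addrCA subrr addr0 => Y3.
  have := nrmB_le x Yx.
  have <- : nrm Yx = s' ^+ (2 ^ l) * nrm (iter (2 ^ l) A x).
    by rewrite nrmZ nrmX cr.
  by lra.
(* The admissible step length is the same at every [s], so finitely many steps lead from 0 to
   [r]. *)
pose delta := (4 * Lam)^-1.
have delta0 : 0 < delta by rewrite invr_gt0 mulr_gt0.
have small_min j : small 2^-1 (Num.min r (j%:R * delta)).
  elim: j => [|j IH].
    exists 0%N => x; rewrite mul0r min_r// expn0 expr1 mul0r.
    by rewrite mulr_ge0 ?nrm_ge0.
  have jd : 0 <= j%:R * delta by rewrite mulr_ge0// ltW.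
  apply: step IH.
  - by rewrite le_min r0.
  - by rewrite le_min ge_min lexx /= ge_min -natr1 mulrDl mul1r lerDl (ltW delta0) orbT.
  - by rewrite ge_min lexx.
  have -> : 4^-1 = Lam * delta by rewrite /delta; field; rewrite gt_eqF.
  rewrite ler_pM2l// -natr1 mulrDl mul1r lerBlDr addrC.
  by rewrite addr_minr le_min !ge_min lerDr (ltW delta0) /= [delta + _]addrC lexx orbT.
have [j jr] : exists j, r <= j%:R * delta.
  exists (Num.bound (r / delta)); rewrite -ler_pdivrMr//.
  by apply/ltW/archi_boundP; rewrite divr_ge0// ltW.
by have := small_min j; rewrite min_l.
Qed.

(** With [r = 1 / rho] some power [N = 2 ^ l] of [A] has norm at most [rho ^ N]; the remainder of
    [n] modulo [N] is paid for by the constant [b ^ N]. *)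
Lemma power_growth (rho : R) : 1 < rho -> exists2 C, 0 < C &
  forall n x, nrm (iter n A x) <= C * rho ^+ n * nrm x.
Proof.
move=> rho1; have rho0 : 0 < rho by exact: lt_trans rho1.
have [|l Al] := @scaled_powers_small rho^-1.
  by rewrite invr_ge0 (ltW rho0) invf_lt1.
set N := (2 ^ l)%N in Al.
pose b := `|alpha| + 1; have b1 : 1 <= b by rewrite lerDr.
have b0 : 0 < b by exact: lt_le_trans b1.
have Ab n x : nrm (iter n A x) <= b ^+ n * nrm x.
  elim: n => [|n IH]; first by rewrite expr0 mul1r.
  apply: le_trans (A_le' _) _; rewrite exprS -mulrA ler_pM ?nrm_ge0//.
  by rewrite /b lerDl.
have AN x : nrm (iter N A x) <= rho ^+ N * nrm x.
  have := Al x; rewrite exprVn mulrC ler_pdivrMr ?exprn_gt0// => /le_trans; apply.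
  rewrite mulrC ler_wpM2l ?exprn_ge0 ?(ltW rho0)//.
  by rewrite ler_piMl ?nrm_ge0// invf_le1// ler1n.
have N0 : (0 < N)%N by rewrite expn_gt0.
exists (b ^+ N); first by rewrite exprn_gt0.
elim/ltn_ind => n IH x; case: (ltnP n N) => nN.
  apply: le_trans (Ab n x) _; rewrite ler_wpM2r ?nrm_ge0//.
  apply: (@le_trans _ _ (b ^+ N)); first by rewrite ler_weXn2l// ltnW.
  by rewrite ler_peMr ?exprn_ge0 ?(ltW b0)// exprn_ege1// ltW.
rewrite -(subnKC nN) iterD; apply: le_trans (AN _) _.
rewrite exprD [b ^+ N * _]mulrCA -mulrA ler_wpM2l ?exprn_ge0 ?(ltW rho0)//.
by apply: IH; rewrite ltn_subrL N0 (leq_trans N0).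
Qed.
End spectral_radius.

(** * Evaluation, characteristic functions and local inverses in C(K) *)

Section continuous_functions.
Context {R : realType} {K L : topologicalType}.
Implicit Types (f g : Cb R K) (A B E : set K).

Lemma CbDE f g k : (f + g) k = f k + g k. Proof. by []. Qed.
Lemma CbME f g k : (f * g) k = f k * g k. Proof. by []. Qed.
Lemma CbZE (a : R[i]) f k : (a *: f) k = a * f k :> R[i]. Proof. by []. Qed.
Lemma Cb1E k : (1 : Cb R K) k = 1. Proof. by []. Qed.
Lemma Cb_compE f (h : continuousType L K) l : Cb_comp f h l = f (h l).
Proof. by []. Qed.

Lemma nrm_le_supnorm f k : nrm (f k : R[i]) <= supnorm f.
Proof. by rewrite nrm_le; exact: supnorm_ge. Qed.

Lemma supnorm_le_nrm f (c : R) :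
  0 <= c -> (forall k, nrm (f k : R[i]) <= c) -> supnorm f <= c.
Proof. by move=> c0 fc; apply: supnorm_le => // k; rewrite -nrm_le. Qed.

Lemma chi_in A k : clopen A -> A k -> (chi A : Cb R K) k = 1.
Proof.
move=> cA Ak; rewrite /chi; case: pselect => //= ?.
by rewrite indicE mem_set.
Qed.

Lemma chi_notin A k : ~ A k -> (chi A : Cb R K) k = 0.
Proof.
move=> Ak; rewrite /chi; case: pselect => //= ?.
by rewrite indicE memNset.
Qed.

Lemma nrm_chi_le A k : nrm ((chi A : Cb R K) k : R[i]) <= 1.
Proof.
rewrite /chi; case: pselect => ? /=; last by rewrite nrm0.
by rewrite indicE; case: (k \in A); rewrite ?nrm1 ?nrm0.
Qed.

Lemma Cb_inverse_on f E : compact [set: K] -> clopen E ->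
  (forall k, E k -> f k <> 0) ->
  exists g : Cb R K, forall k, g k = if k \in E then (f k)^-1 else 0.
Proof.
move=> cK cE f0; pose g k : R[i]^o := if k \in E then (f k)^-1 else 0.
have cg : continuous g.
  move=> k; have [Ek|nEk] := pselect (E k).
    have gk : {near k, (fun k => (f k : R[i])^-1 : R[i]^o) =1 g}.
      apply: filterS (open_nbhs_nbhs (conj cE.1 Ek)) => j Ej.
      by rewrite /g mem_set.
    have [cf _] := bounded_continuousP _ (Cb_funP f).
    have fk0 : (f k : R[i]) != 0 by exact/eqP/f0.
    have /(cvg_trans (near_eq_cvg gk)) := @continuousV R[i] K f k fk0 (cf k).
    by rewrite /continuous_at {3}/g mem_set.
  apply: (@near_cst_continuous K R[i]^o (0 : R[i]^o)).
  apply: filterS (open_nbhs_nbhs (conj (clopen_setC cE).1 nEk)) => j Ej.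
  by rewrite /g memNset.
by exists (MkCb (continuous_bounded cK cg)).
Qed.
End continuous_functions.

(** * Bounded below and surjective operators *)

Section contractions.
Context {R : realType} {V : normedModType R[i]}.

(** A formulation that serves both for the complete space [X] and for [Cb], which carries only the
    structure of a normed module. *)
Definition sequentially_complete : Prop := forall u : nat -> V,
  (forall e : R, 0 < e -> exists N, forall i j, (N <= i)%N -> (N <= j)%N ->
     nrm (u i - u j) <= e) ->
  exists l, forall e : R, 0 < e -> exists N, forall i, (N <= i)%N ->
    nrm (u i - l) <= e.

Hypothesis complV : sequentially_complete.

Lemma neumann (G : V -> V) : {morph G : x y / x - y} ->
  (forall x, nrm (G x) <= 2^-1 * nrm x) -> forall y, exists x, x - G x = y.
Proof.
move=> GB Gle y; pose u := fun n => iter n (fun x => y + G x) 0.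
have du n : nrm (u n.+1 - u n) <= 2^-1 ^+ n * nrm y.
  elim: n => [|n IH].
    rewrite /u /= subr0 expr0 mul1r.
    have -> : G 0 = 0 by have := GB 0 0; rewrite !subrr.
    by rewrite addr0.
  rewrite (_ : u n.+2 - u n.+1 = G (u n.+1 - u n)); last first.
    by rewrite GB /u /= opprD addrACA subrr add0r.
  by apply: le_trans (Gle _) _; rewrite exprS -mulrA ler_wpM2l.
have dun n p : nrm (u (n + p)%N - u n) <= 2 * (2^-1 ^+ n - 2^-1 ^+ (n + p)) * nrm y.
  elim: p => [|p IH]; first by rewrite addn0 !subrr nrm0 mulr0 mul0r.
  rewrite -(subrK (u (n + p)%N) (u (n + p.+1)%N)) -addrA.
  apply: le_trans (nrmD_le _ _) _.
  rewrite addnS; have := du (n + p)%N.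
  rewrite [2^-1 ^+ (n + p).+1]exprS.
  by move: IH; set z := 2^-1 ^+ (n + p); set t := 2^-1 ^+ n; nra.
have [|l ul] := complV (u := u).
  move=> e e0; have [N Ne] := exp_unbounded (4 * nrm y / e) (ltr1n R 2 : 1 < 2).
  have uN i : (N <= i)%N -> nrm (u i - u N) <= e / 2.
    move=> Ni; rewrite -(subnKC Ni); apply: le_trans (dun _ _) _.
    have : 2^-1 ^+ N * (4 * nrm y) <= e.
      rewrite exprVn mulrC ler_pdivrMr ?exprn_gt0//.
      by move: Ne; rewrite ler_pdivrMr// [e * _]mulrC.
    have : 0 <= 2^-1 ^+ (N + (i - N)) * nrm y :> R.
      by rewrite mulr_ge0 ?nrm_ge0.
    by nra.
  exists N => i j Ni Nj; rewrite -(subrK (u N) (u i)) -addrA.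
  apply: le_trans (nrmD_le _ _) _; rewrite (nrmB (u N)).
  by have := uN i Ni; have := uN j Nj; lra.
exists l; apply/eqP; rewrite -subr_eq0; apply/eqP/nrm_eq0.
apply/eqP; rewrite eq_le nrm_ge0 andbT; apply/ler_addgt0Pr => e e0.
rewrite add0r; have e2 : 0 < e / 2 by rewrite divr_gt0.
have [N uN] := ul _ e2.
have -> : l - G l - y = (l - u N.+1) + G (u N - l).
  by rewrite GB /u /= opprD !addrA subrK addrAC.
apply: le_trans (nrmD_le _ _) _; rewrite (nrmB l).
have := uN N.+1 (leqnSn N); have := uN N (leqnn N); have := Gle (u N - l).
by lra.
Qed.

(** If [z - G^n z = y], then [z + G z + ... + G^(n-1) z] is a solution, by telescoping. *)
Lemma neumann_iter (G : V -> V) n : (0 < n)%N -> {morph G : x y / x - y} ->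
  (forall x, nrm (iter n G x) <= 2^-1 * nrm x) -> forall y, exists x, x - G x = y.
Proof.
move=> n0 GB Gle y.
have GnB k : {morph iter k G : x y / x - y}.
  by move=> u v; elim: k => //= k ->; exact: GB.
have [z zy] := neumann (GnB n) Gle y.
have [x xz] : exists x, x - G x = z - iter n G z.
  elim: n {n0 Gle GnB zy} => [|n [x xz]].
    exists 0; rewrite subrr; have := GB 0 0.
    by rewrite !subrr => ->; rewrite subr0.
  exists (x + iter n G z).
  have GD u v : G (u + v) = G u + G v.
    have GN t : G (- t) = - G t.
      have G0 : G 0 = 0 by have := GB 0 0; rewrite !subrr.
      by rewrite -[- t]sub0r GB G0 sub0r.
    by rewrite -{1}[v]opprK GB GN opprK.
  by rewrite GD opprD addrACA xz iterS addrA subrK.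
by exists x; rewrite xz.
Qed.
End contractions.
Arguments sequentially_complete {R} V.

Section spectral_conditions.
Context {R : realType} {V : normedModType R[i]}.
Variables (Y : set V) (T : V -> V).

Definition bounded_below (lam : R[i]) : Prop := exists2 c : R, 0 < c &
  forall x, Y x -> c * nrm x <= nrm (T x - lam *: x).

Definition solvable (lam : R[i]) : Prop :=
  forall y, Y y -> exists2 x, Y x & T x - lam *: x = y.

Hypothesis Ylin : forall (a : R[i]) x y, Y x -> Y y -> Y (a *: x + y).
Hypothesis Tlin : forall (a : R[i]) x y, T (a *: x + y) = a *: T x + T y.
Hypothesis TY : forall x, Y x -> Y (T x).

Let Y0 x : Y x -> Y 0.
Proof. by move=> Yx; have := Ylin (-1) Yx Yx; rewrite scaleN1r addNr. Qed.

Let YZ a x : Y x -> Y (a *: x).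
Proof. by move=> Yx; rewrite -[_ *: _]addr0; apply: Ylin => //; exact: Y0 Yx. Qed.

Let T0 : T 0 = 0.
Proof.
by have := Tlin 1 0 0; rewrite !scale1r addr0 => /esym/eqP; rewrite -subr_eq0 addrK => /eqP.
Qed.

Let TZ a x : T (a *: x) = a *: T x.
Proof. by have := Tlin a x 0; rewrite T0 !addr0. Qed.

Lemma notin_spectrum_onP (lam : R[i]) :
  ~ spectrum_on Y T lam <-> bounded_below lam /\ solvable lam.
Proof.
split=> [/contrapT[B [[BY Blin [M BM]] BK]]|[[c c0 cT] sol]].
  split; last first.
    by move=> y Yy; exists (B y); [exact: BY|case: (BK y Yy)].
  have M0 : 0 < `|M| + 1 by rewrite ltr_wpDl.
  exists (`|M| + 1)^-1; first by rewrite invr_gt0.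
  move=> x Yx; have [BTx _] := BK x Yx.
  rewrite mulrC ler_pdivrMr// -{1}BTx.
  have YTx : Y (T x - lam *: x).
    by rewrite addrC -scaleNr; apply: Ylin => //; exact: TY.
  have := BM _ YTx; rewrite -[X in _ * X]nrmE -rmorphM -nrm_le /= => /le_trans; apply.
  by rewrite mulrC ler_wpM2l ?nrm_ge0// (le_trans (ler_norm M))// lerDl.
apply; have inj x x' : Y x -> Y x' -> T x - lam *: x = T x' - lam *: x' -> x = x'.
  move=> Yx Yx' e; apply/eqP; rewrite -subr_eq0; apply/eqP/nrm_eq0/eqP.
  have Yd : Y (x - x') by rewrite -scaleN1r addrC; exact: Ylin.
  have Td : T (x - x') - lam *: (x - x') = 0.
    have -> : T (x - x') = T x - T x'.
      by rewrite -scaleN1r addrC Tlin scaleN1r addrC.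
    rewrite scalerBr opprB [lam *: x' - _]addrC addrACA e.
    by rewrite [- T x' + _]addrC -[X in _ + X]opprB subrr.
  rewrite eq_le nrm_ge0 andbT -(pmulr_rle0 _ c0).
  by apply: le_trans (cT _ Yd) _; rewrite Td nrm0.
have /choice[B BP] : forall y, exists x, Y y -> Y x /\ T x - lam *: x = y.
  move=> y; have [Yy|nYy] := pselect (Y y); last by exists 0.
  by have [x Yx xy] := sol y Yy; exists x.
exists B; split; last first.
  move=> u Yu; split; last by case: (BP u Yu).
  have Yv : Y (T u - lam *: u).
    by rewrite addrC -scaleNr; apply: Ylin => //; exact: TY.
  by have [YB BE] := BP _ Yv; exact: inj.
split=> [u /BP[]//|a u v Yu Yv|].
  have [YBu Bu] := BP u Yu; have [YBv Bv] := BP v Yv.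
  have [YBuv Buv] := BP _ (Ylin a Yu Yv).
  apply: inj => //; first exact: Ylin.
  rewrite Buv Tlin -{1}Bu -{1}Bv scalerBr scalerDr opprD !scalerA [lam * a]mulrC.
  by rewrite addrACA.
exists c^-1 => u Yu; have [YBu Bu] := BP u Yu.
rewrite -[`|u|]nrmE -rmorphM -nrm_le /= -{2}Bu mulrC ler_pdivlMr// mulrC.
exact: cT.
Qed.

Lemma notin_ap_spectrum_onP (lam : R[i]) :
  ~ ap_spectrum_on Y T lam <-> bounded_below lam.
Proof.
split; last first.
  move=> [c c0 cT] [x [Yx /cvgrPdist_lt/(_ c%:C%C)]].
  rewrite ltcR => /(_ c0)[N _ /(_ N (leqnn N))].
  rewrite /= sub0r normrN -nrmE ltcR; apply/negP; rewrite -leNgt.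
  have [YxN xN] := Yx N; apply: le_trans (cT _ YxN).
  by rewrite (_ : nrm (x N) = 1) ?mulr1// /nrm xN.
apply: contra_notP => nbb.
have xP n : exists x, (Y x /\ `|x| = 1) /\ nrm (T x - lam *: x) <= n.+1%:R^-1.
  apply: contrapT => nx; apply: nbb; exists n.+1%:R^-1 => // x Yx.
  have [->|/eqP x0] := eqVneq x 0; first by rewrite nrm0 mulr0 nrm_ge0.
  have xp := nrm_gt0 x0.
  pose b : R[i] := ((nrm x)^-1)%:C%C.
  have nb : nrm b = (nrm x)^-1 by rewrite nrm_real ger0_norm// invr_ge0 ltW.
  rewrite -ler_pdivlMr//; apply: ltW; rewrite ltNge; apply/negP => xle; apply: nx.
  exists (b *: x); split.
    by split; [exact: YZ|rewrite -nrmE nrmZ nb mulVf// gt_eqF].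
  by rewrite TZ scalerA [lam * b]mulrC -scalerA -scalerBr nrmZ nb mulrC.
have /choice[x xE] := xP; exists x; split; first by move=> n; case: (xE n).
apply/cvgrPdist_lt => e e0; near=> n.
rewrite sub0r normrN -nrmE.
have eE : e = (nrm e)%:C%C by rewrite nrmE gtr0_norm.
rewrite eE ltcR; apply: le_lt_trans (xE n).2 _.
near: n.
have e'0 : 0 < nrm e by apply: nrm_gt0 => e00; rewrite e00 ltxx in e0.
exact: (near_infty_natSinv_lt (PosNum e'0)).
Unshelve. all: by end_near.
Qed.
End spectral_conditions.

(** * Weighted composition operators on modules *)

Lemma le_of_eq (R : numDomainType) (x y : R) : x = y -> x <= y.
Proof. by move->. Qed.

Section weighted_operators.
Context {R : realType} {K : topologicalType} {V : normedModType R[i]}.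
Hypotheses (cK : compact [set: K]) (hK : hausdorff_space K)
  (edK : extremally_disconnected K).
Variable m : Cb R K -> {linear V -> V}.
Hypotheses (mD : forall f g x, m (f + g) x = m f x + m g x)
  (mZ : forall (a : R[i]) f x, m (a *: f) x = a *: m f x)
  (mM : forall f g x, m (f * g) x = m f (m g x))
  (m1 : forall x, m 1 x = x)
  (m_le : forall f x, nrm (m f x) <= supnorm f * nrm x).
Variables phi psi : continuousType K K.
Hypotheses (phiK : cancel phi psi) (psiK : cancel psi phi).
Variables U Ui : {linear V -> V}.
Hypotheses (UK : cancel U Ui) (UiK : cancel Ui U).
Hypotheses (Um : forall f x, U (m f x) = m (Cb_comp f phi) (U x))
  (Uim : forall f x, Ui (m f x) = m (Cb_comp f psi) (Ui x)).
Hypotheses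
  (U_growth : forall rho, 1 < rho -> exists2 C : R, 0 < C &
    forall n x, nrm (iter n U x) <= C * rho ^+ n * nrm x)
  (Ui_growth : forall rho, 1 < rho -> exists2 C : R, 0 < C &
    forall n x, nrm (iter n Ui x) <= C * rho ^+ n * nrm x).
Hypothesis complV : sequentially_complete V.
Variable w : Cb R K.

Implicit Types (f g : Cb R K) (x y : V) (A B D E F : set K) (lam mu : R[i]).

Definition weighted x : V := m w (U x).
Local Notation T := weighted.

Definition supported E x : Prop := m (chi E) x = x.

Let cphi : continuous phi. Proof. exact: cts_fun. Qed.
Let cpsi : continuous psi. Proof. exact: cts_fun. Qed.

Lemma chiM E F : clopen E -> clopen F -> chi E * chi F = chi (E `&` F) :> Cb R K.
Proof.
move=> cE cF; apply: CbP => k; rewrite CbME.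
have [Ek|nE] := pselect (E k); last first.
  by rewrite !(chi_notin nE) mul0r chi_notin// => -[].
have [Fk|nF] := pselect (F k); last first.
  by rewrite (chi_notin nF) mulr0 chi_notin// => -[].
by rewrite !chi_in ?mul1r//; exact: clopenI.
Qed.

Lemma chi_comp E (h : continuousType K K) : clopen E ->
  Cb_comp (chi E) h = chi (h @^-1` E) :> Cb R K.
Proof.
move=> cE; apply: CbP => k; rewrite Cb_compE.
have [Ek|nE] := pselect (E (h k)); last by rewrite !chi_notin.
rewrite !chi_in//; apply: preimage_clopen => //; exact: cts_fun.
Qed.

Lemma mC f g x : m f (m g x) = m g (m f x).
Proof. by rewrite -!mM mulrC. Qed.

Lemma m0 x : m 0 x = 0.
Proof. by apply: (addrI (m 0 x)); rewrite -mD !addr0. Qed.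

Lemma m_chi_le E x : nrm (m (chi E) x) <= nrm x.
Proof.
apply: le_trans (m_le _ _) _; rewrite ler_piMl ?nrm_ge0//.
by apply: supnorm_le_nrm => // k; exact: nrm_chi_le.
Qed.

Lemma m_chiI E F x : clopen E -> clopen F ->
  m (chi E) (m (chi F) x) = m (chi (E `&` F)) x.
Proof. by move=> cE cF; rewrite -mM chiM. Qed.

Lemma m_chi0 E x : E = set0 -> m (chi E) x = 0.
Proof.
move=> E0; rewrite (_ : chi E = 0) ?m0//.
by apply: CbP => k; rewrite chi_notin// E0.
Qed.

Lemma supported_chi E x : clopen E -> supported E (m (chi E) x).
Proof. by move=> cE; rewrite /supported m_chiI// setIid. Qed.

Lemma supported0 E : supported E 0. Proof. exact: linear0. Qed.

Lemma supportedP E a x y : supported E x -> supported E y ->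
  supported E (a *: x + y).
Proof. by move=> Ex Ey; rewrite /supported linearP Ex Ey. Qed.

Lemma supportedD E x y : supported E x -> supported E y -> supported E (x + y).
Proof. by move=> Ex Ey; rewrite /supported linearD Ex Ey. Qed.

Lemma supportedZ E a x : supported E x -> supported E (a *: x).
Proof. by move=> Ex; rewrite /supported linearZ /= Ex. Qed.

Lemma supported_m E f x : supported E x -> supported E (m f x).
Proof. by move=> Ex; rewrite /supported mC Ex. Qed.

Lemma supported_sub E F x : clopen E -> clopen F -> E `<=` F ->
  supported E x -> supported F x.
Proof.
by move=> cE cF /setIidr EF Ex; rewrite /supported -{1}Ex m_chiI// EF.
Qed.

Lemma chi_setU E F x : clopen E -> clopen F -> E `&` F = set0 ->
  m (chi (E `|` F)) x = m (chi E) x + m (chi F) x.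
Proof.
move=> cE cF EF0; rewrite -mD; congr (m _ x); apply: CbP => k; rewrite CbDE.
have cEF := clopenU cE cF.
have [Ek|nE] := pselect (E k).
  have nF : ~ F k by move=> Fk; have : set0 k by rewrite -EF0.
  by rewrite (chi_in cE Ek) (chi_notin nF) addr0 chi_in//; left.
have [Fk|nF] := pselect (F k).
  by rewrite (chi_in cF Fk) (chi_notin nE) add0r chi_in//; right.
by rewrite !chi_notin ?addr0// => -[].
Qed.

Lemma m_le_on E f x (c : R) : clopen E -> supported E x -> 0 <= c ->
  (forall k, E k -> nrm (f k : R[i]) <= c) -> nrm (m f x) <= c * nrm x.
Proof.
move=> cE Ex c0 fc; rewrite -Ex -mM; apply: le_trans (m_le _ _) _.
rewrite Ex ler_wpM2r ?nrm_ge0//; apply: supnorm_le_nrm => // k.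
rewrite CbME nrmM; have [Ek|nE] := pselect (E k).
  by rewrite chi_in// nrm1 mulr1 fc.
by rewrite chi_notin// nrm0 mulr0.
Qed.

(** The lower bound is an upper bound for the inverse: [1 / f] on [E], extended by 0, is continuous
    with modulus at most [1 / c]. *)
Lemma m_ge_on E f x (c : R) : clopen E -> supported E x -> 0 < c ->
  (forall k, E k -> c <= nrm (f k : R[i])) -> c * nrm x <= nrm (m f x).
Proof.
move=> cE Ex c0 fc.
have f0 k : E k -> f k <> 0.
  by move=> /fc cf fk0; move: cf; rewrite fk0 nrm0 leNgt c0.
have [g gE] := Cb_inverse_on cK cE f0.
have gfx : m g (m f x) = x.
  rewrite -mM -[RHS]Ex -{1}Ex -mM; congr (m _ x); apply: CbP => k; rewrite !CbME gE.
  have [Ek|nE] := pselect (E k); last by rewrite (chi_notin nE) mulr0.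
  by rewrite mem_set// mulVf ?mul1r//; exact/eqP/f0.
rewrite -{1}gfx mulrC -ler_pdivlMr// mulrC.
apply: (m_le_on cE); [exact: supported_m|by rewrite invr_ge0 ltW|move=> k Ek].
rewrite gE mem_set// nrmV lef_pV2 ?posrE ?fc//.
exact: lt_le_trans (fc _ Ek).
Qed.

Lemma m_chi_setU_le E F x : clopen E -> clopen F ->
  nrm (m (chi (E `|` F)) x) <= nrm (m (chi E) x) + nrm (m (chi F) x).
Proof.
move=> cE cF; rewrite (_ : E `|` F = E `|` (F `\` E)); last first.
  apply/seteqP; split=> k /= [Ek|]; try by left.
    by move=> Fk; have [Ek|nE] := pselect (E k); [left|right].
  by move=> []; right.
have cFE : clopen (F `\` E) by exact: clopen_setD.
rewrite chi_setU//; last by apply/seteqP; split=> k // [Ek []].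
apply: le_trans (nrmD_le _ _) _; rewrite lerD2l.
rewrite (_ : F `\` E = (~` E) `&` F); last by rewrite setDE setIC.
by rewrite -m_chiI ?m_chi_le//; exact: clopen_setC.
Qed.

Lemma nrm_cover (I : Type) (s : seq I) (F : I -> set K) D x :
  (forall i, clopen (F i)) -> clopen D -> supported D x ->
  D `<=` \big[setU/set0]_(i <- s) F i ->
  nrm x <= \sum_(i <- s) nrm (m (chi (F i)) x).
Proof.
move=> cF cD Dx Ds.
suff [cU Ux] : clopen (\big[setU/set0]_(i <- s) F i) /\
    nrm (m (chi (\big[setU/set0]_(i <- s) F i)) x) <=
    \sum_(i <- s) nrm (m (chi (F i)) x).
  by have Sx := supported_sub cD cU Ds Dx; rewrite Sx in Ux.
elim: s {Ds} => [|i s [cU Ux]]; rewrite ?big_nil ?big_cons.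
  by split; [split; [exact: open0|exact: closed0]|rewrite m_chi0// nrm0].
split; first exact: clopenU.
by apply: le_trans (m_chi_setU_le _ _ _) _ => //; rewrite lerD2l.
Qed.

Lemma weighted_lin a x y : T (a *: x + y) = a *: T x + T y.
Proof. by rewrite /weighted !linearP. Qed.

Lemma weightedD x y : T (x + y) = T x + T y.
Proof. by rewrite /weighted !linearD. Qed.

Lemma weightedB x y : T (x - y) = T x - T y.
Proof. by rewrite /weighted !linearB. Qed.

Lemma weightedZ a x : T (a *: x) = a *: T x.
Proof. by rewrite /weighted !linearZ. Qed.

Lemma Ui_lin n a x y : iter n Ui (a *: x + y) = a *: iter n Ui x + iter n Ui y.
Proof. by elim: n => //= n ->; rewrite linearP. Qed.

Lemma supported_U E n x : clopen E -> supported E x ->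
  supported (iter n phi @^-1` E) (iter n U x).
Proof.
move=> cE Ex; elim: n => //= n IH; rewrite /supported.
have cEn : clopen (iter n phi @^-1` E).
  by apply: preimage_clopen => //; exact: continuous_iter.
rewrite -[in RHS]IH Um chi_comp//; congr (m (chi _) _).
by apply/funext => k /=; rewrite -iterS iterSr.
Qed.

Lemma supported_Ui E n x : clopen E -> supported E x ->
  supported (iter n psi @^-1` E) (iter n Ui x).
Proof.
move=> cE Ex; elim: n => //= n IH; rewrite /supported.
have cEn : clopen (iter n psi @^-1` E).
  by apply: preimage_clopen => //; exact: continuous_iter.
rewrite -[in RHS]IH Uim chi_comp//; congr (m (chi _) _).
by apply/funext => k /=; rewrite -iterS iterSr.
Qed.

Fixpoint weight (n : nat) : Cb R K :=
  if n is n'.+1 then w * Cb_comp (weight n') phi else 1.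

Lemma weighted_iter n x : iter n T x = m (weight n) (iter n U x).
Proof.
by elim: n => [|n IH] /=; rewrite ?m1// IH /weighted Um -mM.
Qed.

Lemma supported_weighted_iter E n x : clopen E -> supported E x ->
  supported (iter n phi @^-1` E) (iter n T x).
Proof.
by move=> cE Ex; rewrite weighted_iter; apply: supported_m; exact: supported_U.
Qed.

Lemma supported_weighted E x : clopen E -> invariant_set phi E ->
  supported E x -> supported E (T x).
Proof.
move=> cE iE Ex; have := supported_weighted_iter 1 cE Ex.
by rewrite (_ : iter 1 phi @^-1` E = E)//; apply/seteqP; split=> k /=; rewrite iE.
Qed.

Lemma weighted_bounded : exists2 tau : R, 0 < tau &
  forall x, nrm (T x) <= tau * nrm x.
Proof.
have [C C0 UC] := U_growth (ltr1n R 2 : 1 < 2).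
have s0 : 0 <= supnorm w by exact: supnorm_ge0.
exists ((supnorm w + 1) * (C * 2)); first by rewrite mulr_gt0 ?mulr_gt0// ltr_wpDl.
move=> x; apply: le_trans (m_le _ _) _; rewrite -mulrA ler_pM ?nrm_ge0//.
  by rewrite lerDl.
by have := UC 1%N x; rewrite expr1.
Qed.

(** [T^n - lam^n] factors through [T - lam] with a bounded cofactor, so approximate eigenvectors of
    [T] are approximate eigenvectors of its powers. *)
Lemma weighted_iter_defect lam n : exists2 A : R, 0 <= A & forall x,
  nrm (iter n T x - lam ^+ n *: x) <= A * nrm (T x - lam *: x).
Proof.
have [tau tau0 Tle] := weighted_bounded.
elim: n => [|n [A A0 IH]].
  by exists 0 => // x; rewrite expr0 scale1r subrr nrm0 mul0r.
exists (tau * A + nrm lam ^+ n).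
  by rewrite addr_ge0 ?mulr_ge0 ?exprn_ge0 ?nrm_ge0 ?(ltW tau0).
move=> x.
have -> : iter n.+1 T x - lam ^+ n.+1 *: x =
    T (iter n T x - lam ^+ n *: x) + lam ^+ n *: (T x - lam *: x).
  by rewrite weightedB weightedZ scalerBr scalerA -exprSr addrA subrK.
apply: le_trans (nrmD_le _ _) _; rewrite mulrDl lerD// ?nrmZ ?nrmX//.
by apply: le_trans (Tle _) _; rewrite -mulrA ler_wpM2l// ltW.
Qed.

Definition rel_weight lam (k : K) : R := nrm (w k : R[i]) / nrm lam.

Lemma rel_weight_ge0 lam k : 0 <= rel_weight lam k.
Proof. by rewrite divr_ge0 ?nrm_ge0. Qed.

Lemma nrm_w_continuous : continuous (fun k => nrm (w k : R[i])).
Proof.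
have [cw _] := bounded_continuousP _ (Cb_funP w).
move=> k; apply/cvgrPdist_lt => e e0.
have /cvgrPdist_lt/(_ e%:C%C) := cw k; rewrite ltcR => /(_ e0).
apply: filterS => j; rewrite -nrmE ltcR; apply: le_lt_trans.
have tri (x y : R[i]) : nrm x - nrm y <= nrm (x - y).
  by rewrite lerBlDr; apply: le_trans (nrmD_le _ _); rewrite subrK.
rewrite ler_norml lerNl opprB; apply/andP; split; last exact: tri.
by apply: le_trans (tri _ _) _; rewrite nrmB.
Qed.

Lemma rel_weight_continuous lam : continuous (rel_weight lam).
Proof. by move=> k; apply: cvgMl; exact: nrm_w_continuous. Qed.

Lemma nrm_weight lam n k : lam != 0 ->
  nrm (weight n k : R[i]) = nrm lam ^+ n * cocycle phi (rel_weight lam) n k.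
Proof.
move=> lam0; have l0 : nrm lam != 0 by apply: contra_neq lam0; exact: nrm_eq0.
elim: n k => [|n IH] k; first by rewrite Cb1E nrm1 expr0 mul1r cocycle0.
rewrite -[weight n.+1]/(w * Cb_comp (weight n) phi) CbME nrmM Cb_compE IH.
by rewrite cocycleS exprS /rel_weight; field; exact: l0.
Qed.

Lemma rel_weight_le lam : exists2 b : R, 1 <= b & forall k, rel_weight lam k <= b.
Proof.
exists (Num.max 1 (supnorm w / nrm lam)); first by rewrite le_max lexx.
move=> k; rewrite le_max ler_wpM2r ?orbT ?invr_ge0 ?nrm_ge0//.
exact: nrm_le_supnorm.
Qed.

(** Multiplication by [back f n] is the conjugate [U^-n f U^n]. *)
Fixpoint back (f : Cb R K) n : Cb R K :=
  if n is n'.+1 then Cb_comp (back f n') psi else f.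

Lemma backE f n k : back f n k = f (iter n psi k).
Proof. by elim: n k => //= n IH k; rewrite IH -iterSr. Qed.

Lemma Ui_iter_m f n x : iter n Ui (m f x) = m (back f n) (iter n Ui x).
Proof. by elim: n => //= n ->; rewrite Uim. Qed.

Lemma Ui_weighted_iter n x : iter n Ui (iter n T x) = m (back (weight n) n) x.
Proof. by rewrite weighted_iter Ui_iter_m iter_cancel. Qed.

Lemma compact_clopen D : clopen D -> compact D.
Proof. by move=> cD; apply: (subclosed_compact cD.2 cK). Qed.

(** An [x] with [T x] close to [lam x] has a small part on each set where the cocycle has decayed
    forwards or grown backwards in [n] steps. The [N] times after [L] give sets that cover [D], so
    all of [x] is small relative to itself unless the defect is large. *)
Lemma no_peak_bounded_below D lam : clopen D -> invariant_set phi D ->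
  lam != 0 -> (forall k, D k -> ~ peak phi psi (rel_weight lam) k) ->
  bounded_below (supported D) T lam.
Proof.
move=> cD iD lam0 npD; set a := rel_weight lam in npD.
have ca : continuous a by exact: rel_weight_continuous.
have a0 k : 0 <= a k by exact: rel_weight_ge0.
have l0 : 0 < nrm lam by apply: nrm_gt0; exact/eqP.
have [N [beta [beta1 npN]]] := no_peak_uniform cphi cpsi ca a0 (compact_clopen cD) npD.
have [rho [rho1 esc]] := no_peak_escape phiK psiK a0 iD beta1 npN.
have rho0 : 0 < rho by exact: lt_trans rho1.
(* Strictly between 1 and [rho]: [U] may grow at this rate and a gain [q = rho' / rho] per step
   remains. *)
pose rho' := (1 + rho) / 2.
have rho'1 : 1 < rho' by rewrite /rho'; lra.
have rho'0 : 0 < rho' by exact: lt_trans rho'1.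
have [C1 C10 UC] := U_growth rho'1; have [C2 C20 UiC] := Ui_growth rho'1.
pose C := C1 + C2; have C0 : 0 < C by rewrite addr_gt0.
pose q := rho' / rho.
have q0 : 0 < q by rewrite divr_gt0.
have q1 : q <= 1 by rewrite ler_pdivrMr// mul1r /rho'; lra.
pose W := cocycle phi a.
have cW n : continuous (W n) by exact: cocycle_continuous.
have cWb n : continuous (fun k => W n (iter n psi k)).
  exact: cocycle_iter_inv_continuous.
(* The closures are clopen, and on them the strict inequalities survive in weak form. *)
pose Ep n := closure [set k | W n k < rho ^- n].
pose Em n := closure [set k | rho ^+ n < W n (iter n psi k)].
have cEp n : clopen (Ep n).
  apply: closure_clopen => //; apply: (@open_comp _ _ (W n) [set x | x < rho ^- n]).
    by move=> k _; exact: cW.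
  exact: open_lt.
have cEm n : clopen (Em n).
  apply: closure_clopen => //.
  apply: (@open_comp _ _ (fun k => W n (iter n psi k)) [set x | rho ^+ n < x]).
    by move=> k _; exact: cWb.
  exact: open_gt.
have WEp n k : Ep n k -> W n k <= rho ^- n.
  move=> Ek; have : closure [set k | W n k <= rho ^- n] k.
    by apply: closureS Ek => j /= /ltW.
  rewrite -(closure_id _).1//; apply: (@closed_comp _ _ (W n) [set x | x <= rho ^- n]).
    by move=> j _; exact: cW.
  exact: closed_le.
have WEm n k : Em n k -> rho ^+ n <= W n (iter n psi k).
  move=> Ek; have : closure [set k | rho ^+ n <= W n (iter n psi k)] k.
    by apply: closureS Ek => j /= /ltW.
  rewrite -(closure_id _).1//.
  apply: (@closed_comp _ _ (fun k => W n (iter n psi k)) [set x | rho ^+ n <= x]).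
    by move=> j _; exact: cWb.
  exact: closed_ge.
have wE n k : nrm (weight n k : R[i]) = nrm lam ^+ n * W n k.
  exact: nrm_weight.
have /choice[A AP] : forall n, exists A : R, 0 <= A /\ forall x,
    nrm (m (chi (Ep n `|` Em n)) x) <=
    2 * C * q ^+ n * nrm x + A * nrm (T x - lam *: x).
  move=> n; have [A A0 defA] := weighted_iter_defect lam n.
  have ln0 : 0 < nrm lam ^+ n by rewrite exprn_gt0.
  have rn0 : 0 < rho ^+ n by rewrite exprn_gt0.
  have r'n0 : 0 < rho' ^+ n by rewrite exprn_gt0.
  have qnE : q ^+ n = rho' ^+ n / rho ^+ n by rewrite /q expr_div_n.
  exists (A / nrm lam ^+ n + C * rho' ^+ n * A / (nrm lam ^+ n * rho ^+ n)); split.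
    by rewrite addr_ge0// ?divr_ge0 ?mulr_ge0 ?(ltW C0) ?(ltW ln0) ?(ltW rn0) ?(ltW r'n0).
  move=> x; set e := nrm (T x - _).
  have e0 : 0 <= e by exact: nrm_ge0.
  (* Up to the defect, [lam^n x] is [T^n x], which is [U^n x] multiplied by a function of modulus at
     most [|lam|^n rho^-n] on [Ep n]. *)
  have plus : nrm (m (chi (Ep n)) x) <= C * q ^+ n * nrm x + A / nrm lam ^+ n * e.
    rewrite -(ler_pM2l ln0) -[X in X * nrm (m _ _)]nrmX -nrmZ -linearZ /=.
    rewrite -(subrK (iter n T x) (lam ^+ n *: x)) linearD.
    apply: le_trans (nrmD_le _ _) _; rewrite addrC mulrDr lerD//; last first.
      apply: le_trans (m_chi_le _ _) _; rewrite nrmB.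
      apply: le_trans (defA x) _; rewrite -/e; apply: le_of_eq.
      by field; rewrite gt_eqF.
    rewrite weighted_iter mC.
    apply: (@le_trans _ _ (nrm lam ^+ n * rho ^- n * (C * rho' ^+ n * nrm x))).
      apply: le_trans (@m_le_on (Ep n) _ _ (nrm lam ^+ n * rho ^- n) (cEp n) _ _ _) _.
      - exact: supported_chi.
      - by rewrite mulr_ge0 ?(ltW ln0)// invr_ge0 ltW.
      - by move=> k Ek; rewrite wE ler_wpM2l ?(ltW ln0)// WEp.
      rewrite ler_wpM2l ?mulr_ge0 ?invr_ge0 ?(ltW ln0) ?(ltW rn0)//.
      apply: le_trans (m_chi_le _ _) _; apply: le_trans (UC _ _) _.
      by rewrite !ler_wpM2r ?nrm_ge0 ?(ltW r'n0)// /C lerDl ltW.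
    by rewrite qnE; apply: le_of_eq; field; rewrite gt_eqF.
  (* [U^-n T^n] is multiplication by [back (weight n) n], of modulus at least [|lam|^n rho^n] on
     [Em n], whereas [U^-n T^n x] is close to [lam^n U^-n x]. *)
  have minus : nrm (m (chi (Em n)) x) <= C * q ^+ n * nrm x +
      C * rho' ^+ n * A / (nrm lam ^+ n * rho ^+ n) * e.
    have lr0 : 0 < nrm lam ^+ n * rho ^+ n by rewrite mulr_gt0.
    rewrite -(ler_pM2l lr0).
    apply: (@le_trans _ _ (nrm (m (back (weight n) n) x))).
      apply: (@le_trans _ _ (nrm (m (back (weight n) n) (m (chi (Em n)) x)))).
        apply: (@m_ge_on (Em n)) => //; first exact: supported_chi.
        by move=> k Ek; rewrite backE wE ler_wpM2l ?(ltW ln0)// WEm.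
      by rewrite mC; exact: m_chi_le.
    rewrite -Ui_weighted_iter -(subrK (lam ^+ n *: x) (iter n T x)).
    have -> : iter n Ui (iter n T x - lam ^+ n *: x + lam ^+ n *: x) =
        lam ^+ n *: iter n Ui x + iter n Ui (iter n T x - lam ^+ n *: x).
      by rewrite addrC Ui_lin.
    apply: le_trans (nrmD_le _ _) _; rewrite mulrDr lerD// ?nrmZ ?nrmX.
      have : nrm (iter n Ui x) <= C * rho' ^+ n * nrm x.
        apply: le_trans (UiC _ _) _.
        by rewrite !ler_wpM2r ?nrm_ge0 ?(ltW r'n0)// /C lerDr ltW.
      move=> /(ler_wpM2l (ltW ln0)) /le_trans; apply.
      rewrite qnE; apply: le_of_eq.
      by field; rewrite gt_eqF.
    apply: le_trans (UiC _ _) _.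
    apply: (@le_trans _ _ (C * rho' ^+ n * (A * e))).
      rewrite ler_pM ?nrm_ge0 ?mulr_ge0 ?(ltW C20) ?(ltW r'n0)//.
      by rewrite ler_wpM2r ?(ltW r'n0)// /C lerDr ltW.
    apply: le_of_eq.
    by field; rewrite !gt_eqF.
  apply: le_trans (m_chi_setU_le _ (cEp n) (cEm n)) _.
  by move: plus minus; lra.
have r'r1 : 1 < rho / rho' by rewrite ltr_pdivlMr// mul1r /rho'; lra.
(* [L] is chosen after [N], so that the [N] pieces together account for at most half of the norm of
   [x]. *)
have [L rL] := exp_unbounded (4 * N%:R * C) r'r1.
have NqL : N%:R * (2 * C * q ^+ L) <= 2^-1.
  have -> : q ^+ L = ((rho / rho') ^+ L)^-1.
    by rewrite /q -exprVn invf_div.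
  have p0 : 0 < (rho / rho') ^+ L by rewrite exprn_gt0// divr_gt0.
  by rewrite mulrA ler_pdivrMr//; lra.
pose s := iota L.+1 N; pose S := \sum_(n <- s) A n.
have S0 : 0 <= S by apply: sumr_ge0 => n _; case: (AP n).
have S1 : 0 < 2 * S + 1 by rewrite ltr_wpDl// mulr_ge0.
exists (2 * S + 1)^-1; first by rewrite invr_gt0.
move=> x Dx; set e := nrm (T x - _).
have e0 : 0 <= e by exact: nrm_ge0.
have : nrm x <= N%:R * (2 * C * q ^+ L) * nrm x + S * e.
  apply: le_trans (@nrm_cover _ s (fun n => Ep n `|` Em n) D x _ cD Dx _) _.
  - by move=> n; exact: clopenU.
  - move=> k Dk; have [n [Ln kn]] := esc L k Dk.
    rewrite -bigcup_seq; exists n; first by rewrite /= mem_iota addSn ltnS.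
    by case: kn => kn; [left|right]; exact: subset_closure.
  have -> : N%:R * (2 * C * q ^+ L) * nrm x + S * e =
      \sum_(n <- s) (2 * C * q ^+ L * nrm x + A n * e).
    rewrite big_split /= /S mulr_suml; congr (_ + _).
    by rewrite big_const_seq count_predT size_iota iter_addr_0 -[RHS]mulr_natl -[LHS]mulrA.
  rewrite big_seq [leRHS]big_seq; apply: ler_sum => n.
  rewrite mem_iota => /andP[Ln _]; apply: le_trans ((AP n).2 x) _.
  rewrite lerD2r ler_wpM2r ?nrm_ge0// ler_wpM2l ?mulr_ge0 ?(ltW C0)//.
  by rewrite ler_wiXn2l ?(ltW q0)// ltnW.
move=> le_x; rewrite mulrC ler_pdivrMr//; move: le_x.
have : N%:R * (2 * C * q ^+ L) * nrm x <= 2^-1 * nrm x.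
  by rewrite ler_wpM2r ?nrm_ge0.
by move: e0 S0; nra.
Qed.

Lemma U_iter_back f n x : iter n U (m (back f n) x) = m f (iter n U x).
Proof.
by rewrite -[RHS](iter_cancel n UiK) Ui_iter_m iter_cancel.
Qed.

Lemma m_sum (I : Type) (s : seq I) (P : pred I) (f : I -> Cb R K) x :
  m (\sum_(i <- s | P i) f i) x = \sum_(i <- s | P i) m (f i) x.
Proof. by elim/big_rec2: _ => [|i u g _ <-]; rewrite ?m0 ?mD. Qed.

Lemma Cb_sumE (I : Type) (s : seq I) (P : pred I) (f : I -> Cb R K) k :
  (\sum_(i <- s | P i) f i) k = \sum_(i <- s | P i) f i k.
Proof. by elim/big_rec2: _ => [//|i u g _ <-]. Qed.

Section disjoint_sums.
Variables (n : nat) (G : 'I_n -> set K) (c : 'I_n -> V).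
Hypotheses (cG : forall i, clopen (G i)) (Gc : forall i, supported (G i) (c i)).
Hypothesis disjG : forall i j, i != j -> G i `&` G j = set0.

Lemma chi_disjoint_sum (a : 'I_n -> R[i]) i :
  m (chi (G i)) (\sum_j a j *: c j) = a i *: c i.
Proof.
rewrite linear_sum (bigD1 i)//= big1 ?addr0 => [|j ji].
  by rewrite linearZ /= Gc.
by rewrite linearZ /= -(Gc j) m_chiI// m_chi0 ?scaler0// disjG// eq_sym.
Qed.

(** The first sum is obtained from the second by multiplication with the function equal to
    [b i / a i] on [G i], whose supremum is at most [kappa]. *)
Lemma disjoint_sum_domination (a b : 'I_n -> R) (kappa : R) : 0 <= kappa ->
  (forall i, 0 < a i) -> (forall i, `|b i| <= kappa * a i) ->
  nrm (\sum_i (b i)%:C%C *: c i) <= kappa * nrm (\sum_i (a i)%:C%C *: c i).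
Proof.
move=> kappa0 a0 ba; pose d i : R[i] := (b i / a i)%:C%C.
have dle i : nrm (d i) <= kappa.
  rewrite nrm_real normrM normfV (gtr0_norm (a0 i)) ler_pdivrMr//.
pose f : Cb R K := \sum_i d i *: chi (G i).
have -> : \sum_i (b i)%:C%C *: c i = m f (\sum_i (a i)%:C%C *: c i).
  rewrite m_sum; apply: eq_bigr => i _.
  rewrite mZ chi_disjoint_sum scalerA /d -rmorphM divfK//.
  by rewrite gt_eqF.
apply: le_trans (m_le _ _) _; rewrite ler_wpM2r ?nrm_ge0//.
apply: supnorm_le_nrm => // k; rewrite Cb_sumE.
have [[i Gik]|nG] := pselect (exists i, G i k); last first.
  rewrite big1 ?nrm0// => i _; rewrite [LHS](CbZE (d i)) chi_notin ?mulr0// => Gik.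
  by apply: nG; exists i.
rewrite (bigD1 i)//= big1 ?addr0 => [|j ji]; last first.
  rewrite [LHS](CbZE (d j)) chi_notin ?mulr0// => Gjk.
  by have : set0 k by rewrite -(disjG ji).
rewrite -[X in nrm X]/(d i * (chi (G i) : Cb R K) k : R[i]).
by rewrite chi_in// mulr1.

Qed.
End disjoint_sums.

Definition faithful_on D : Prop := forall E, clopen E -> E `<=` D ->
  E !=set0 -> exists2 x, x <> 0 & supported E x.

Lemma distance_away n i : (n <= i)%N ->
  ((i.+1 - n) + (n - i.+1) = ((i - n) + (n - i)).+1)%N.
Proof. by lia. Qed.

Lemma distance_closer n i : (i < n)%N ->
  ((i - n) + (n - i) = ((i.+1 - n) + (n - i.+1)).+1)%N.
Proof. by lia. Qed.

(* The test vector is [\sum_i theta^|i - n| lam^(n - i) T^i v], where [v] is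
   supported near [phi^n k]. Its terms have disjoint supports, so the defect
   coming from the variation of the coefficients is small relative to the
   vector itself, whatever the norm of [V]; the weights [theta^n] absorb the
   subexponential growth of [U] in the two boundary terms. *)
Lemma peak_not_bounded_below D lam k : clopen D -> invariant_set phi D ->
  faithful_on D -> lam != 0 -> D k -> peak phi psi (rel_weight lam) k ->
  (forall j, (0 < j)%N -> iter j phi k <> k) ->
  ~ bounded_below (supported D) T lam.
Proof.
move=> cD iD fD lam0 Dk pk npk [c c0 cT]; set a := rel_weight lam in pk.
have ca : continuous a by exact: rel_weight_continuous.
have l0 : 0 < nrm lam by apply: nrm_gt0; exact/eqP.
(* [eta] is the inverse of [theta]. The choice gives [|lam| (eta - 1) = c / 4], so the variation of
   the coefficients costs a quarter of the lower bound; [n] below is chosen so that the boundary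
   terms cost another quarter. *)
pose eta := 1 + c / (4 * nrm lam).
have c4l : 0 < c / (4 * nrm lam) by rewrite divr_gt0// mulr_gt0.
have eta1 : 1 < eta by rewrite ltrDl.
have eta0 : 0 < eta by exact: lt_trans eta1.
pose rho := (1 + eta) / 2.
have rho1 : 1 < rho by rewrite /rho; lra.
have rho0 : 0 < rho by exact: lt_trans rho1.
have [C1 C10 UC] := U_growth rho1; have [C2 C20 UiC] := Ui_growth rho1.
have er1 : 1 < eta / rho by rewrite ltr_pdivlMr// mul1r /rho; lra.
have [n etan] := exp_unbounded
  (4 * nrm lam / c * (2 * C2 + 2 * C1 * rho)) er1.
pose W := cocycle phi a.
have cW i : continuous (W i) by exact: cocycle_continuous.
have cWb i : continuous (fun k => W i (iter i psi k)).
  exact: cocycle_iter_inv_continuous.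
have wE i z : nrm (weight i z : R[i]) = nrm lam ^+ i * W i z.
  exact: nrm_weight.
(* An open condition that holds at a peak. The operator moves supports by [psi]: [v] starts near
   [phi^n k], [T^n v] lives near [k], and the last boundary term, at time [2 n + 1], lives near
   [psi^(n+1) k]; hence the backward product over [n + 1] steps. *)
pose P z := D z /\ 2^-1 < W n z /\ W n.+1 (iter n.+1 psi z) < 2.
have nearP : \forall z \near iter n phi k, P (iter n psi z).
  have cn : {for iter n phi k, continuous (iter n psi)}.
    by apply: continuous_iter.
  apply: cn; rewrite iter_cancel//; have [Wn1 _] := pk n.
  have [_ Wn2] := pk n.+1.
  apply: filterI; first exact: open_nbhs_nbhs (conj cD.1 Dk).
  apply: filterI.
    have /cvgr_gt := @cW n k; apply; apply: lt_le_trans Wn1.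
    by rewrite invf_lt1// ltr1n.
  have /cvgr_lt := @cWb n.+1 k; apply; apply: le_lt_trans Wn2 _.
  by rewrite ltr1n.
have [|G [cG Gk GP Gdisj]] := @wandering_nbhs K cK hK edK phi cphi (iter n phi k)
    [set z | P (iter n psi z)] (n + n)%N nearP.
  move=> j /andP[j0 _] kj; apply: (npk j j0).
  by rewrite -[LHS](iter_cancel n phiK) -iterD addnC iterD kj iter_cancel.
have GD : G `<=` D by move=> z /GP [Dz _]; move: Dz => /(invariant_iter_inv psiK n z iD).
have [|v v0 Gv] := fD G cG GD; first by exists (iter n phi k).
pose g i := lam ^+ n / lam ^+ i *: iter i T v.
pose Gi i := iter i phi @^-1` G.
have cGi i : clopen (Gi i) by apply: preimage_clopen => //; exact: continuous_iter.
have Ggi i : supported (Gi i) (g i).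
  by apply: supportedZ; exact: supported_weighted_iter.
have gS i : T (g i) = lam *: g i.+1.
  rewrite /g weightedZ scalerA; congr (_ *: _); rewrite exprS.
  by field; rewrite ?expf_neq0 ?lam0.
have gn : g n = iter n T v by rewrite /g divff ?scale1r// expf_neq0.
have v_le : nrm (g 0%N) <= 2 * C2 * rho ^+ n * nrm (g n).
  rewrite {1}/g expr0 divr1 /= nrmZ nrmX gn weighted_iter.
  have UG : supported (Gi n) (iter n U v) by exact: supported_U.
  have : nrm lam ^+ n / 2 * nrm (iter n U v) <= nrm (m (weight n) (iter n U v)).
    apply: (m_ge_on (cGi n)) => //; first by rewrite divr_gt0// exprn_gt0.
    move=> z /GP[_]; rewrite iter_cancel// => -[/ltW Wz _].
    by rewrite wE ler_wpM2l ?exprn_ge0 ?nrm_ge0.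
  have := UiC n (iter n U v); rewrite iter_cancel//.
  move=> /(ler_wpM2l (exprn_ge0 n (ltW l0))) v_le g_le; apply: le_trans v_le _.
  have := @ler_wpM2l _ (2 * C2 * rho ^+ n) _ _ _ g_le.
  rewrite !mulr_ge0 ?exprn_ge0 ?(ltW C20) ?(ltW rho0)// => /(_ isT).
  by apply: le_trans; apply: le_of_eq; field.
have g_last : nrm (g (n + n).+1) <= 2 * C1 * rho ^+ n.+1 * nrm (g n).
  have -> : g (n + n).+1 = (lam ^+ n.+1)^-1 *: iter n.+1 T (g n).
    rewrite gn /g -iterD addSn; congr (_ *: _).
    rewrite -addnS exprD.
    by field; rewrite ?expf_neq0 ?lam0.
  rewrite nrmZ nrmV nrmX mulrC ler_pdivrMr ?exprn_gt0//.
  rewrite weighted_iter -U_iter_back; apply: le_trans (UC _ _) _.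
  have : nrm (m (back (weight n.+1) n.+1) (g n)) <= 2 * nrm lam ^+ n.+1 * nrm (g n).
    apply: (m_le_on (cGi n)) => //; first by rewrite mulr_ge0 ?exprn_ge0 ?nrm_ge0.
    move=> z /GP[_]; rewrite iter_cancel// => -[_ /ltW Wz].
    by rewrite backE wE mulrC ler_wpM2r ?exprn_ge0 ?nrm_ge0.
  move=> /(@ler_wpM2l _ (C1 * rho ^+ n.+1)).
  rewrite mulr_ge0 ?exprn_ge0 ?(ltW C10) ?(ltW rho0)// => /(_ isT) /le_trans; apply.
  by apply: le_of_eq; ring.
pose N := (n + n).+1.
pose dist i := ((i - n) + (n - i))%N.
pose aa i : R := (eta ^+ dist i)^-1.
have aa0 i : 0 < aa i by rewrite invr_gt0 exprn_gt0.
pose x := \sum_(i < N) (aa i)%:C%C *: g i.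
have disj (i j : 'I_N) : i != j -> Gi i `&` Gi j = set0.
  wlog ij : i j / (i < j)%N.
    move=> wl; rewrite neq_ltn => /orP[ij|ji]; first by apply: wl => //; rewrite neq_ltn ij.
    by rewrite setIC; apply: wl => //; rewrite neq_ltn ji.
  move=> _; apply/seteqP; split=> // z [zi zj].
  apply: (Gdisj (j - i)%N (iter i phi z)) => //.
    by rewrite subn_gt0 ij (leq_trans (leq_subr _ _))// -ltnS.
  by rewrite -iterD subnK// ltnW.
have Dg i : supported D (g i).
  apply: supported_sub (Ggi i) => // z /GD /=.
  by move=> /(invariant_iter i z iD).
have Dx : supported D x.
  rewrite /x; elim/big_ind: _ => //; first exact: supported0.
    exact: supportedD.
  by move=> i _; exact: supportedZ.
have nN : (n < N)%N by rewrite ltnS leq_addr.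
have gx : nrm (g n) <= nrm x.
  have := @chi_disjoint_sum N Gi g cGi Ggi disj (fun i => (aa i)%:C%C) (Ordinal nN).
  rewrite /aa /dist /= !subnn expr0 invr1 scale1r => <-.
  exact: m_chi_le.
have gn0 : 0 < nrm (g n).
  rewrite lt_neqAle nrm_ge0 andbT; apply/eqP => g0.
  have : nrm (g 0%N) <= 0 by move: v_le; rewrite -g0 mulr0.
  rewrite {1}/g expr0 divr1 /= nrmZ nrmX pmulr_rle0 ?exprn_gt0//.
  by apply/negP; rewrite -ltNge; exact: nrm_gt0.
(* Summation by parts: these are the coefficients of [T x - lam x] up to the factor [lam]. The term
   at [g 0] is counted among the boundary terms, so [bb 0 = 0]. *)
pose bb i : R := if i is i'.+1 then aa i' - aa i else 0.
have bb_le i : `|bb i| <= (eta - 1) * aa i.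
  case: i => [|i]; first by rewrite /= normr0 mulr_ge0 ?subr_ge0 ?(ltW eta1) ?(ltW (aa0 0%N)).
  rewrite /bb /aa; have [ni|ni] := leqP n i.
    have -> : dist i.+1 = (dist i).+1 by exact: distance_away.
    have p0 : 0 < eta ^+ dist i by rewrite exprn_gt0.
    rewrite exprS (_ : _ - _ = (eta - 1) / (eta * eta ^+ dist i)).
      by rewrite ger0_norm// divr_ge0 ?mulr_ge0 ?(ltW p0) ?(ltW eta0)// subr_ge0 ltW.
    by field; rewrite !gt_eqF.
  have -> : dist i = (dist i.+1).+1 by exact: distance_closer.
  have p0 : 0 < eta ^+ dist i.+1 by rewrite exprn_gt0.
  rewrite exprS (_ : _ - _ = - ((eta - 1) / (eta * eta ^+ dist i.+1))).
    rewrite normrN ger0_norm; last first.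
      by rewrite divr_ge0 ?mulr_ge0 ?(ltW p0) ?(ltW eta0)// subr_ge0 ltW.
    rewrite ler_wpM2l ?subr_ge0 ?(ltW eta1)// lef_pV2 ?posrE ?mulr_gt0//.
    by rewrite ler_peMl ?(ltW p0) ?(ltW eta1).
  by field; rewrite !gt_eqF.
pose y := \sum_(i < N) (bb i)%:C%C *: g i.
have y_le : nrm y <= (eta - 1) * nrm x.
  apply: (@disjoint_sum_domination N Gi g cGi Ggi disj aa bb) => //.
  by rewrite subr_ge0 ltW.
have TxE : T x - lam *: x = lam *: (y + ((aa (n + n)%N)%:C%C *: g N - (aa 0%N)%:C%C *: g 0%N)).
  have -> : T x = lam *: \sum_(i < N) (aa i)%:C%C *: g i.+1.
    rewrite /x /N; elim: (n + n).+1 => [|p IH].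
      by rewrite !big_ord0 scaler0 /weighted !linear0.
    rewrite !big_ord_recr /= weightedD IH scalerDr; congr (_ + _).
    by rewrite weightedZ gS scalerA mulrC -scalerA.
  rewrite -scalerBr; congr (_ *: _); rewrite /x /y /N; elim: (n + n)%N => [|p IH].
    by rewrite !big_ord_recr !big_ord0 /= !add0r scale0r add0r.
  rewrite big_ord_recr [X in _ - X]big_ord_recr [X in _ = X + _]big_ord_recr /=.
  rewrite opprD addrACA IH -!addrA; congr (_ + _).
  rewrite rmorphB scalerBl -!addrA; congr (_ + _).
  by rewrite addrCA [RHS]addrCA; congr (_ + _); exact: addrC.
have aan : aa (n + n)%N = (eta ^+ n)^-1.
  by rewrite /aa /dist addnK subnDA subnn sub0n addn0.
have aaz : aa 0%N = (eta ^+ n)^-1 by rewrite /aa /dist sub0n subn0.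
have en0 : 0 < eta ^+ n by rewrite exprn_gt0.
have rn0 : 0 < rho ^+ n by rewrite exprn_gt0.
have boundary : nrm lam * ((eta ^+ n)^-1 * (nrm (g N) + nrm (g 0%N))) <= c / 4 * nrm (g n).
  have : nrm (g N) + nrm (g 0%N) <= (2 * C2 + 2 * C1 * rho) * rho ^+ n * nrm (g n).
    apply: le_trans (lerD g_last v_le) _.
    by apply: le_of_eq; rewrite exprS; ring.
  have : 4 * nrm lam / c * (2 * C2 + 2 * C1 * rho) * rho ^+ n <= eta ^+ n.
    by rewrite -ler_pdivlMr// -expr_div_n.
  move=> H1 H2; rewrite mulrCA mulrC ler_pdivrMr//.
  apply: le_trans (ler_wpM2l (ltW l0) H2) _.
  have := ler_wpM2r (mulr_ge0 (ltW c0) (nrm_ge0 (g n))) H1.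
  rewrite (_ : 4 * nrm lam / c * _ * _ * _ =
    4 * (nrm lam * ((2 * C2 + 2 * C1 * rho) * rho ^+ n * nrm (g n)))).
    by lra.
  by field; rewrite gt_eqF.
have := cT x Dx; rewrite TxE nrmZ.
have : nrm (y + ((aa (n + n)%N)%:C%C *: g N - (aa 0%N)%:C%C *: g 0%N)) <=
    (eta - 1) * nrm x + (eta ^+ n)^-1 * (nrm (g N) + nrm (g 0%N)).
  apply: le_trans (nrmD_le _ _) _; apply: lerD => //.
  apply: le_trans (nrmB_le _ _) _.
  by rewrite aan aaz !nrmZ !nrm_real ger0_norm ?mulrDr// invr_ge0 ltW.
move=> /(ler_wpM2l (ltW l0)) H1 H2.
have : nrm lam * ((eta - 1) * nrm x) = c / 4 * nrm x.
  by rewrite /eta; field; rewrite gt_eqF.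
have : 0 < nrm x by exact: lt_le_trans gx.
by move: H1 H2 boundary gx; rewrite mulrDr; nra.
Qed.

Lemma weighted_chi E x : clopen E -> invariant_set phi E ->
  T (m (chi E) x) = m (chi E) (T x).
Proof.
move=> cE iE; rewrite /weighted Um chi_comp// mC; congr (m (chi _) _).
by apply/seteqP; split=> k /=; rewrite iE.
Qed.

Lemma preimage_invariant E n : invariant_set phi E -> iter n phi @^-1` E = E.
Proof.
by move=> iE; apply/seteqP; split=> k /=; have := invariant_iter n k iE; tauto.
Qed.

Lemma preimage_invariant_inv E n : invariant_set phi E -> iter n psi @^-1` E = E.
Proof.
by move=> iE; apply/seteqP; split=> k /=; have := invariant_iter_inv psiK n k iE; tauto.
Qed.

(** Decay of the cocycle at the rate [rho] beats the growth of [U] at the rate [rho'], so some power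
    of [T / lam] on [B] has norm at most 1/2 and the Neumann series applies. *)
Lemma contracting_solvable B lam M rho : clopen B -> invariant_set phi B ->
  lam != 0 -> 1 < rho -> contracting phi (rel_weight lam) B M rho ->
  solvable (supported B) T lam.
Proof.
move=> cB iB lam0 rho1 ctr.
have l0 : 0 < nrm lam by apply: nrm_gt0; exact/eqP.
have [b b1 ab] := rel_weight_le lam.
have [C0 C00 Wle] := contracting_decay (rel_weight_ge0 lam) b1 ab iB rho1 ctr.
have rho0 : 0 < rho by exact: lt_trans rho1.
pose rho' := (1 + rho) / 2.
have rho'1 : 1 < rho' by rewrite /rho'; lra.
have rho'0 : 0 < rho' by exact: lt_trans rho'1.
have [C C0' UC] := U_growth rho'1.
have r'r1 : 1 < rho / rho' by rewrite ltr_pdivlMr// mul1r /rho'; lra.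
have [n0 rn0] := exp_unbounded (2 * C0 * C) r'r1.
pose n := n0.+1.
have rn : 2 * C0 * C <= (rho / rho') ^+ n.
  by apply: le_trans rn0 _; rewrite ler_weXn2l// ltW.
(* The cut-off by [chi B] makes [G] an operator on all of [V], where completeness is available. *)
pose G x := lam^-1 *: T (m (chi B) x).
have GB : {morph G : x y / x - y}.
  by move=> x y; rewrite /G linearB weightedB scalerBr.
have supG x : supported B (G x).
  by apply: supportedZ; apply: supported_weighted => //; exact: supported_chi.
have GE i x : iter i.+1 G x = (lam ^+ i.+1)^-1 *: iter i.+1 T (m (chi B) x).
  elim: i => [|i IH]; first by rewrite expr1.
  rewrite iterS {1}/G (_ : m (chi B) _ = iter i.+1 G x); last exact: supG.
  by rewrite IH weightedZ scalerA -invfM -exprS.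
have Gn x : nrm (iter n G x) <= 2^-1 * nrm x.
  rewrite GE nrmZ nrmV nrmX weighted_iter mulrC ler_pdivrMr ?exprn_gt0//.
  have sB : supported B (iter n U (m (chi B) x)).
    have := supported_U n cB (supported_chi x cB).
    by rewrite preimage_invariant.
  apply: le_trans (@m_le_on B _ _ (nrm lam ^+ n * (C0 / rho ^+ n)) cB sB _ _) _.
  - by rewrite mulr_ge0 ?exprn_ge0 ?nrm_ge0// divr_ge0 ?exprn_ge0 ?ltW.
  - move=> k Bk; rewrite (nrm_weight _ _ lam0) ler_wpM2l ?exprn_ge0 ?nrm_ge0//.
    by rewrite ler_pdivlMr ?exprn_gt0//; exact: Wle.
  have H : nrm (iter n U (m (chi B) x)) <= C * rho' ^+ n * nrm x.
    apply: le_trans (UC _ _) _.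
    by rewrite ler_wpM2l ?m_chi_le// mulr_ge0 ?exprn_ge0 ?ltW.
  have c0 : 0 <= nrm lam ^+ n * (C0 / rho ^+ n).
    by rewrite mulr_ge0 ?exprn_ge0 ?nrm_ge0// divr_ge0 ?exprn_ge0 ?ltW.
  apply: le_trans (ler_wpM2l c0 H) _.
  have rp : 0 < rho ^+ n by rewrite exprn_gt0.
  have rp' : 0 < rho' ^+ n by rewrite exprn_gt0.
  have : C0 * C * rho' ^+ n / rho ^+ n <= 2^-1.
    move: rn; rewrite expr_div_n ler_pdivlMr// ler_pdivrMr//.
    by lra.
  move=> /(ler_wpM2l (mulr_ge0 (exprn_ge0 n (ltW l0)) (nrm_ge0 x))) H2.
  apply: le_trans (le_trans H2 _); apply: le_of_eq; first by ring.
  by ring.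
move=> y By; have [x xy] := neumann_iter complV (ltn0Sn _) GB Gn (- lam^-1 *: y).
have Bx : supported B x.
  rewrite -(subrK (G x) x) xy; apply: supportedD => //; exact: supportedZ.
exists x => //; move: xy; rewrite /G Bx => /(congr1 (fun v => - lam *: v)).
by rewrite scalerBr !scalerA mulrNN divff// scale1r mulNr divff// !scaleNr scale1r opprK addrC.
Qed.

Lemma weighted_inverse B : clopen B -> invariant_set phi B ->
  (forall k, B k -> w k <> 0) -> exists S : {linear V -> V},
  [/\ forall x, supported B (S x), forall x, T (S x) = m (chi B) x,
    forall x, supported B x -> S (T x) = x &
    exists2 s : R, 0 < s & forall x, nrm (S x) <= s * nrm x].
Proof.
move=> cB iB w0; have [g gE] := Cb_inverse_on cK cB w0.
have gw : g * w = chi B.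
  apply: CbP => k; rewrite CbME gE; case: ifPn => [/set_mem Bk|/negP nBk].
    by rewrite chi_in// mulVf//; exact/eqP/w0.
  by rewrite mul0r chi_notin// => Bk; apply: nBk; exact/mem_set.
exists (Ui \o m g)%FUN; split=> [x|x|x Bx|].
- have Bg : supported B (m g x).
    rewrite /supported -mM; congr (m _ x); apply: CbP => k; rewrite CbME gE.
    case: ifPn => [/set_mem Bk|_]; last by rewrite mulr0.
    by rewrite chi_in// mul1r.
  by have := supported_Ui 1 cB Bg; rewrite preimage_invariant_inv.
- by rewrite /weighted /= UiK -mM mulrC gw.
- have := supported_U 1 cB Bx; rewrite preimage_invariant//= => BUx.
  by rewrite /weighted /= -mM gw BUx UK.
have [C C0 UiC] := Ui_growth (ltr1n R 2 : 1 < 2).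
exists (C * 2 * (supnorm g + 1)).
  by rewrite !mulr_gt0// ltr_wpDl// supnorm_ge0.
move=> x; apply: le_trans (UiC 1%N _) _; rewrite expr1 -[leRHS]mulrA.
rewrite ler_wpM2l ?mulr_ge0 ?(ltW C0)//; apply: le_trans (m_le _ _) _.
by rewrite ler_wpM2r ?nrm_ge0// lerDl.
Qed.

(** Expansion keeps [w] away from 0 on [B], so [T] has an inverse [S] there. The equation becomes
    [x - lam S x = S y], and it is now a power of [lam S] that has norm at most 1/2. *)
Lemma expanding_solvable B lam M rho : clopen B -> invariant_set phi B ->
  lam != 0 -> 1 < rho -> expanding phi psi (rel_weight lam) B M rho ->
  solvable (supported B) T lam.
Proof.
move=> cB iB lam0 rho1 ex.
have l0 : 0 < nrm lam by apply: nrm_gt0; exact/eqP.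
have [[c c0 ac] [C0 C00 Wge]] := expanding_growth phiK psiK
  (@rel_weight_continuous lam) (rel_weight_ge0 lam) iB (compact_clopen cB) rho1 ex.
have rho0 : 0 < rho by exact: lt_trans rho1.
pose rho' := (1 + rho) / 2.
have rho'1 : 1 < rho' by rewrite /rho'; lra.
have rho'0 : 0 < rho' by exact: lt_trans rho'1.
have [C C0' UiC] := Ui_growth rho'1.
have r'r1 : 1 < rho / rho' by rewrite ltr_pdivlMr// mul1r /rho'; lra.
have [n0 rn0] := exp_unbounded (2 * C0 * C) r'r1.
pose n := n0.+1.
have rn : 2 * C0 * C <= (rho / rho') ^+ n.
  by apply: le_trans rn0 _; rewrite ler_weXn2l// ltW.
have w0 k : B k -> w k <> 0.
  move=> /ac; rewrite /rel_weight => ck wk; move: ck.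
  by rewrite wk nrm0 mul0r leNgt c0.
have [S [supS TS _ _]] := weighted_inverse cB iB w0.
pose H x := lam *: S x.
have HB : {morph H : x y / x - y} by move=> x y; rewrite /H linearB scalerBr.
have supH x : supported B (H x) by exact: supportedZ.
have TH i x : iter i.+1 T (iter i.+1 H x) = lam ^+ i.+1 *: m (chi B) x.
  elim: i => [|i IH]; first by rewrite /= weightedZ TS expr1.
  rewrite iterSr [iter i.+2 H x]iterS {1}/H weightedZ TS (_ : m _ _ = iter i.+1 H x).
    have iterZ j a v : iter j T (a *: v) = a *: iter j T v.
      by elim: j => //= j ->; rewrite weightedZ.
    by rewrite iterZ IH scalerA -exprS.
  exact: supH.
have Hn x : nrm (iter n H x) <= 2^-1 * nrm x.
  have sB : supported B (iter n U (iter n H x)).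
    by have := supported_U n cB (supH (iter n0 H x)); rewrite preimage_invariant.
  have rp : 0 < rho ^+ n by rewrite exprn_gt0.
  have rp' : 0 < rho' ^+ n by rewrite exprn_gt0.
  have lp : 0 < nrm lam ^+ n by rewrite exprn_gt0.
  have H1 : nrm lam ^+ n * (rho ^+ n / C0) * nrm (iter n U (iter n H x)) <=
      nrm lam ^+ n * nrm x.
    apply: (@le_trans _ _ (nrm (m (weight n) (iter n U (iter n H x))))).
      apply: (@m_ge_on B) => //; first by rewrite mulr_gt0// divr_gt0.
      move=> k Bk; rewrite (nrm_weight _ _ lam0) ler_wpM2l ?(ltW lp)//.
      by rewrite ler_pdivrMr// mulrC; exact: Wge.
    rewrite -weighted_iter TH nrmZ nrmX ler_wpM2l ?(ltW lp)//.
    exact: m_chi_le.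
  have H2 : nrm (iter n H x) <= C * rho' ^+ n * nrm (iter n U (iter n H x)).
    by have := UiC n (iter n U (iter n H x)); rewrite iter_cancel.
  have H3 : nrm (iter n U (iter n H x)) <= C0 / rho ^+ n * nrm x.
    move: H1; rewrite -mulrA ler_pM2l// => H1.
    rewrite -(ler_pM2l (divr_gt0 rp C00)); apply: le_trans H1 _.
    by apply: le_of_eq; field; rewrite !gt_eqF.
  apply: le_trans H2 _.
  apply: le_trans (ler_wpM2l (mulr_ge0 (ltW C0') (ltW rp')) H3) _.
  rewrite mulrA ler_wpM2r ?nrm_ge0//.
  move: rn; rewrite expr_div_n ler_pdivlMr// => rn.
  by rewrite mulrA ler_pdivrMr//; lra.
move=> y By; have [x xy] := neumann_iter complV (ltn0Sn _) HB Hn (S y).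
have Bx : supported B x by rewrite -(subrK (H x) x) xy; apply: supportedD.
exists x => //; have := congr1 T xy.
by rewrite weightedB /H weightedZ !TS By Bx.
Qed.

Lemma bounded_below_sub D E lam : clopen D -> clopen E -> E `<=` D ->
  bounded_below (supported D) T lam -> bounded_below (supported E) T lam.
Proof.
move=> cD cE ED [c c0 cT]; exists c => // x Ex; apply: cT.
exact: supported_sub ED Ex.
Qed.

Lemma weighted_sub_chi E lam x : clopen E -> invariant_set phi E ->
  T (m (chi E) x) - lam *: m (chi E) x = m (chi E) (T x - lam *: x).
Proof. by move=> cE iE; rewrite weighted_chi// [RHS]linearB [in RHS]linearZ. Qed.

Lemma bounded_below_setU D E lam : clopen D -> clopen E ->
  invariant_set phi D -> invariant_set phi E -> D `&` E = set0 ->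
  bounded_below (supported D) T lam -> bounded_below (supported E) T lam ->
  bounded_below (supported (D `|` E)) T lam.
Proof.
move=> cD cE iD iE DE0 [c c0 cT] [d d0 dT].
exists (c^-1 + d^-1)^-1; first by rewrite invr_gt0 addr_gt0 ?invr_gt0.
move=> x Sx; rewrite mulrC ler_pdivrMr ?addr_gt0 ?invr_gt0// mulrDr.
rewrite -{1}Sx chi_setU//; apply: le_trans (nrmD_le _ _) _; apply: lerD.
  rewrite ler_pdivlMr// mulrC; apply: le_trans (cT _ (supported_chi x cD)) _.
  by rewrite weighted_sub_chi// m_chi_le.
rewrite ler_pdivlMr// mulrC; apply: le_trans (dT _ (supported_chi x cE)) _.
by rewrite weighted_sub_chi// m_chi_le.
Qed.

Lemma solvable_setU D E lam : clopen D -> clopen E -> D `&` E = set0 ->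
  solvable (supported D) T lam -> solvable (supported E) T lam ->
  solvable (supported (D `|` E)) T lam.
Proof.
move=> cD cE DE0 sD sE y Sy; have cDE := clopenU cD cE.
have [x1 Dx1 x1y] := sD _ (supported_chi y cD).
have [x2 Ex2 x2y] := sE _ (supported_chi y cE).
exists (x1 + x2).
  apply: supportedD.
    by apply: supported_sub Dx1 => //; exact: subsetUl.
  by apply: supported_sub Ex2 => //; exact: subsetUr.
by rewrite weightedD scalerDr opprD addrACA x1y x2y -chi_setU.
Qed.

Lemma dichotomy_solvable D lam : clopen D -> invariant_set phi D -> lam != 0 ->
  dichotomy phi psi (rel_weight lam) D -> solvable (supported D) T lam.
Proof.
move=> cD iD lam0 [B [M [rho [cB iB BD rho1 [ctr ex]]]]].
have -> : D = B `|` (D `\` B) by rewrite setDUK.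
apply: solvable_setU => //; first exact: clopen_setD.
- by rewrite setDIK.
- exact: contracting_solvable ctr.
apply: expanding_solvable ex => //; first exact: clopen_setD.
exact: invariant_setD.
Qed.

Lemma dichotomy_no_peak D lam k : dichotomy phi psi (rel_weight lam) D ->
  D k -> ~ peak phi psi (rel_weight lam) k.
Proof.
move=> [B [M [rho [_ _ _ rho1 [ctr ex]]]]] Dk pk.
have rho0 : 0 < rho by exact: lt_trans rho1.
have [Bk|nBk] := pselect (B k).
  have [n [/andP[n0 _]]] := ctr k Bk; have [Wn _] := pk n.
  rewrite leNgt => /negP; apply; apply: lt_le_trans Wn.
  by rewrite invf_lt1 ?exprn_gt0// exprn_egt1// -lt0n.
have [n [/andP[n0 _]]] := ex k (conj Dk nBk); have [_ Wn] := pk n.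
rewrite leNgt => /negP; apply; apply: le_lt_trans Wn _.
by rewrite exprn_egt1// -lt0n.
Qed.

Lemma zero_solvable D : clopen D -> invariant_set phi D ->
  (forall k, D k -> w k <> 0) ->
  bounded_below (supported D) T 0 /\ solvable (supported D) T 0.
Proof.
move=> cD iD w0; have [S [supS TS ST [s s0 Sle]]] := weighted_inverse cD iD w0.
split; last by move=> y Dy; exists (S y) => //; rewrite scale0r subr0 TS.
exists s^-1; first by rewrite invr_gt0.
move=> x Dx; rewrite scale0r subr0 mulrC ler_pdivrMr// mulrC.
by rewrite -{1}(ST x Dx).
Qed.

(** Near a zero of [w] there is a nonzero [u] supported where [|w| < e], and [T] sends [U^-1 u] to
    the small vector [w u]. The value of [e] makes up for the bound [2 C] of [U]. *)
Lemma bounded_below_zero D : clopen D -> invariant_set phi D -> faithful_on D ->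
  bounded_below (supported D) T 0 -> forall k, D k -> w k <> 0.
Proof.
move=> cD iD fD [c c0 cT] k Dk wk.
have [C C0 UC] := U_growth (ltr1n R 2 : 1 < 2).
pose e := c / (C * 2 * 2); have e0 : 0 < e by rewrite divr_gt0 ?mulr_gt0.
have [|E [cE Ek EO]] := @clopen_nbhs K cK hK edK k [set z | nrm (w z : R[i]) < e /\ D z].
  apply: filterI; last exact: open_nbhs_nbhs (conj cD.1 Dk).
  have /cvgr_lt := @nrm_w_continuous k; apply.
  by rewrite wk nrm0.
have [|u u0 Eu] := fD E cE _ (ex_intro _ k Ek); first by move=> z /EO[].
have Du : supported D u by apply: supported_sub Eu => // z /EO[].
have DUu : supported D (Ui u).
  by have := supported_Ui 1 cD Du; rewrite preimage_invariant_inv.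
have := cT _ DUu; rewrite scale0r subr0 /weighted UiK.
have := UC 1%N (Ui u); rewrite /= UiK expr1.
have : nrm (m w u) <= e * nrm u.
  by apply: (m_le_on cE) => // [|z /EO[/ltW//]]; exact: ltW.
have up := nrm_gt0 u0; move=> H1 H2 H3.
have : c * nrm (Ui u) <= c / 2 * nrm (Ui u).
  apply: le_trans H3 _; apply: le_trans H1 _.
  apply: le_trans (ler_wpM2l (ltW e0) H2) _.
  by apply: le_of_eq; rewrite /e; field; rewrite gt_eqF.
have Uu0 : 0 < nrm (Ui u).
  by apply: nrm_gt0 => Uu; apply: u0; rewrite -[u]UiK Uu linear0.
by have := mulr_gt0 c0 Uu0; lra.
Qed.

Lemma bounded_below_open D lam : bounded_below (supported D) T lam ->
  exists2 e : R, 0 < e & forall mu, nrm (mu - lam) <= e ->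
    bounded_below (supported D) T mu.
Proof.
move=> [c c0 cT]; exists (c / 2); first by rewrite divr_gt0.
move=> mu mul; exists (c / 2); first by rewrite divr_gt0.
move=> x Dx; have := cT x Dx.
have -> : T x - lam *: x = (T x - mu *: x) + (mu - lam) *: x.
  by rewrite scalerBl addrA subrK.
move=> /le_trans /(_ (nrmD_le _ _)); rewrite nrmZ.
by have := ler_wpM2r (nrm_ge0 x) mul; lra.
Qed.

(** The lower bound at [mu] is still [3 c / 4], so the solution operator [S] at [mu] satisfies
    [|(lam - mu) S| <= 1/3], and a Neumann series solves [z - (lam - mu) S z = y]; then
    [x = S z]. *)
Lemma solvable_perturbation D lam mu c : clopen D -> invariant_set phi D ->
  0 < c -> (forall x, supported D x -> c * nrm x <= nrm (T x - lam *: x)) ->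
  nrm (lam - mu) <= c / 4 -> solvable (supported D) T mu ->
  solvable (supported D) T lam.
Proof.
move=> cD iD c0 cT lm sD.
have cmu x : supported D x -> 3 * c / 4 * nrm x <= nrm (T x - mu *: x).
  move=> Dx; have := cT x Dx.
  have -> : T x - lam *: x = (T x - mu *: x) - (lam - mu) *: x.
    by rewrite scalerBl opprB addrA subrK.
  move=> /le_trans /(_ (nrmB_le _ _)); rewrite nrmZ.
  by have := ler_wpM2r (nrm_ge0 x) lm; lra.
have /choice[S SP] : forall y, exists x, supported D x /\ T x - mu *: x = m (chi D) y.
  by move=> y; have [x Dx xy] := sD _ (supported_chi y cD); exists x.
have Sle y : 3 * c / 4 * nrm (S y) <= nrm y.
  by have [DS SE] := SP y; apply: le_trans (cmu _ DS) _; rewrite SE m_chi_le.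
have supB x y : supported D x -> supported D y -> supported D (x - y).
  by move=> Dx Dy; apply: supportedD => //; rewrite -scaleN1r; exact: supportedZ.
have SB : {morph S : x y / x - y}.
  move=> x y; have [Dx xE] := SP x; have [Dy yE] := SP y.
  have [Dxy xyE] := SP (x - y).
  apply/eqP; rewrite -subr_eq0; apply/eqP/nrm_eq0/eqP.
  rewrite eq_le nrm_ge0 andbT.
  have Dd := supB _ _ Dxy (supB _ _ Dx Dy).
  have c340 : 0 < 3 * c / 4 by rewrite divr_gt0// mulr_gt0.
  rewrite -(pmulr_rle0 _ c340); apply: le_trans (cmu _ Dd) _.
  have Tmu u v : T (u - v) - mu *: (u - v) = (T u - mu *: u) - (T v - mu *: v).
    by rewrite weightedB scalerBr opprD addrACA -opprD.
  by rewrite !Tmu xE yE xyE linearB subrr nrm0.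
pose G y := (lam - mu) *: S y.
have GB : {morph G : x y / x - y} by move=> x y; rewrite /G SB scalerBr.
have Gle y : nrm (G y) <= 2^-1 * nrm y.
  rewrite /G nrmZ; have := Sle y; have := nrm_ge0 (S y) => S0 H.
  apply: le_trans (ler_wpM2r S0 lm) _; have := nrm_ge0 y; lra.
move=> y Dy; have [z zy] := neumann complV GB Gle y.
have [DS SE] := SP z.
have Dz : supported D z.
  by rewrite -(subrK (G z) z) zy; apply: supportedD => //; exact: supportedZ.
exists (S z) => //.
have -> : T (S z) - lam *: S z = (T (S z) - mu *: S z) - (lam - mu) *: S z.
  by rewrite scalerBl opprB addrA subrK.
by rewrite SE Dz.
Qed.

(* On a clopen invariant set with [phi^n = id] the function [cocycle n] is
   invariant, so it splits the set into a contracting part and a part that is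
   expanding for a slightly smaller [mu]. *)
Lemma periodic_solvable D lam n : clopen D -> invariant_set phi D ->
  faithful_on D -> (0 < n)%N -> (forall k, D k -> iter n phi k = k) ->
  bounded_below (supported D) T lam -> solvable (supported D) T lam.
Proof.
move=> cD iD fD n0 nD bD; have [lam0|lam0] := eqVneq lam 0.
  rewrite lam0 in bD *; apply: (zero_solvable cD iD _).2.
  exact: bounded_below_zero.
have [c c0 cT] := bD.
have l0 : 0 < nrm lam by apply: nrm_gt0; exact/eqP.
(* For [mu = r^2 lam] this gives [|lam - mu| = (1 - r) (1 + r) |lam| <= c / 4], as
   [solvable_perturbation] requires; the cap 1/2 keeps [r] positive. *)
pose r := 1 - Num.min 2^-1 (c / (8 * nrm lam)).
have min0 : 0 < Num.min 2^-1 (c / (8 * nrm lam)).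
  by rewrite lt_min invr_gt0 ltr0n divr_gt0// mulr_gt0.
have r1 : r < 1 by rewrite /r; lra.
have r0 : 0 < r.
  have : Num.min 2^-1 (c / (8 * nrm lam)) <= 2^-1 by rewrite ge_min lexx.
  by rewrite /r; lra.
have rc : (1 - r) * nrm lam <= c / 8.
  have : Num.min 2^-1 (c / (8 * nrm lam)) <= c / (8 * nrm lam).
    by rewrite ge_min lexx orbT.
  rewrite /r opprB addrC subrK => /(ler_wpM2r (ltW l0)) /le_trans; apply.
  by apply: le_of_eq; field; rewrite gt_eqF.
pose a := rel_weight lam; pose W := cocycle phi a.
have ca : continuous a by exact: rel_weight_continuous.
pose O := [set k | D k /\ r ^+ n < W n k].
pose E := closure O.
have oO : open O.
  apply: openI; first exact: cD.1.
  apply: (@open_comp _ _ (W n) [set x | r ^+ n < x]); last exact: open_gt.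
  by move=> k _; exact: cocycle_continuous.
have cE : clopen E by exact: closure_clopen.
have iE : invariant_set phi E.
  apply: (invariant_closure cphi cpsi phiK psiK) => k; rewrite /O /=.
  have := iD k; split=> -[Dk Wk]; have Dk' : D k by tauto.
    by split=> //; move: Wk; rewrite /W cocycle_period// nD.
  by split; [tauto|rewrite /W cocycle_period// nD].
have ED : E `<=` D.
  by rewrite (closure_id D).1; [apply: closureS => k []|exact: cD.2].
have WE k : E k -> r ^+ n <= W n k.
  move=> Ek; have : closure [set k | r ^+ n <= W n k] k.
    by apply: closureS Ek => j [_ /ltW].
  rewrite -(closure_id _).1//; apply: (@closed_comp _ _ (W n) [set x | r ^+ n <= x]).
    by move=> j _; exact: cocycle_continuous.
  exact: closed_ge.
have rV1 : 1 < r^-1 by rewrite invf_gt1.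
have -> : D = E `|` (D `\` E) by rewrite setDUK.
have cDE : clopen (D `\` E) by exact: clopen_setD.
apply: solvable_setU => //; first by rewrite setDIK.
- pose mu := (r ^+ 2)%:C%C * lam.
  have nmu : nrm mu = r ^+ 2 * nrm lam.
    by rewrite nrmM nrm_real ger0_norm// exprn_ge0// ltW.
  have mu0 : mu != 0.
    apply/eqP => mu0; move: nmu; rewrite mu0 nrm0 => /esym/eqP.
    by rewrite gt_eqF// mulr_gt0// exprn_gt0.
  apply: (@solvable_perturbation E lam mu c) => //.
  + by move=> x Ex; apply: cT; exact: supported_sub ED Ex.
  + have -> : lam - mu = (1 - r ^+ 2)%:C%C * lam by rewrite rmorphB mulrBl mul1r.
    rewrite nrmM nrm_real ger0_norm; last by rewrite subr_ge0 exprn_ile1// ltW.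
    have -> : 1 - r ^+ 2 = (1 - r) * (1 + r) by ring.
    have : (1 - r) * nrm lam * (1 + r) <= c / 8 * 2.
      by rewrite ler_pM// ?mulr_ge0 ?subr_ge0 ?nrm_ge0//; lra.
    by lra.
  apply: (@expanding_solvable E mu n r^-1) => // k Ek.
  exists n; rewrite n0 leqnn; split=> //.
  have nk : iter n psi k = k.
    by rewrite -[k in LHS](nD k (ED _ Ek)) iter_cancel.
  rewrite nk; set Wmu := cocycle _ _ _ _.
  have ln : nrm lam ^+ n != 0 by rewrite expf_neq0// gt_eqF.
  (* Passing from [lam] to [mu] divides the cocycle by [r ^ (2 n)], which turns the lower bound
     [r ^ n] into [r ^- n > 1]. *)
  have WW : W n k = r ^+ n * (r ^+ n * Wmu).
    apply: (mulfI ln); rewrite -(nrm_weight n k lam0) (nrm_weight n k mu0) nmu.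
    by rewrite exprMn -/Wmu -exprM mul2n -addnn exprD; ring.
  have rn0 : 0 < r ^+ n by rewrite exprn_gt0.
  have := WE k Ek; rewrite WW ler_pMr// exprVn => H.
  by rewrite -ler_pdivrMl// in H; rewrite mulr1 in H.
apply: (@contracting_solvable _ lam n r^-1) => //; first exact: invariant_setD.
move=> k [Dk nEk]; exists n; rewrite n0 leqnn; split=> //.
rewrite exprVn invrK leNgt; apply/negP => Wk; apply: nEk.
by apply: subset_closure.
Qed.

(** * The equation [T y - lam y = u] with [u] supported in a wandering set *)

Section wandering_sets.
Variables (E : set K) (N : nat) (lam : R[i]) (u y : V).
Hypotheses (cE : clopen E) (Eu : supported E u).
Hypothesis Ewand : forall j z, (0 < j <= N)%N -> E z -> ~ E (iter j phi z).
Hypothesis Ty : T y - lam *: y = u.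

Let cEn n : clopen (iter n phi @^-1` E).
Proof. by apply: preimage_clopen => //; exact: continuous_iter. Qed.

Let step p : iter p.+1 T y - lam ^+ p.+1 *: y =
  iter p T u + lam *: (iter p T y - lam ^+ p *: y).
Proof.
have iterB q x x' : iter q T (x - x') = iter q T x - iter q T x'.
  by elim: q => //= q ->; rewrite weightedB.
have iterZ q x : iter q T (lam *: x) = lam *: iter q T x.
  by elim: q => //= q ->; rewrite weightedZ.
by rewrite -Ty iterB iterZ -iterSr scalerBr scalerA -exprS addrA subrK.
Qed.

Let disjoint_iter i j : (i < j <= i + N)%N ->
  m (chi (iter j phi @^-1` E)) (iter i T u) = 0.
Proof.
move=> /andP[ij jN]; rewrite -(supported_weighted_iter i cE Eu) m_chiI//.
apply: m_chi0; apply/seteqP; split=> // z [zj zi].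
apply: (Ewand (j := j - i) (z := iter i phi z)) => //.
  by rewrite subn_gt0 ij leq_subLR.
by rewrite -iterD subnK// ltnW.
Qed.

Let disjoint_iter0 i : (0 < i <= N)%N -> m (chi E) (iter i T u) = 0.
Proof.
move=> iN; rewrite -(supported_weighted_iter i cE Eu) (m_chiI _ cE (cEn i)).
by apply: m_chi0; apply/seteqP; split=> // z [zE zi]; exact: (Ewand iN zE).
Qed.

(** [T^(p+1) y - lam^(p+1) y] is the sum of [lam^(p-i) T^i u] over [i <= p], and only the term
    [i = 0] meets [E]. *)
Lemma wandering_forward p : (p <= N)%N ->
  m (chi E) (iter p.+1 T y) = lam ^+ p *: (u + lam *: m (chi E) y).
Proof.
move=> pN; suff : m (chi E) (iter p.+1 T y - lam ^+ p.+1 *: y) = lam ^+ p *: u.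
  move=> H; rewrite -[iter _ _ _](subrK (lam ^+ p.+1 *: y)) linearD H.
  by rewrite linearZ /= scalerDr scalerA -exprSr.
elim: p pN => [|p IH] pN.
  by rewrite step /= expr0 !scale1r subrr scaler0 addr0 Eu.
rewrite step linearD (@disjoint_iter0 p.+1 pN) add0r linearZ_LR (IH (ltnW pN)).
by rewrite [LHS]scalerA -exprS.
Qed.

(** In the same expansion, now up to time [p], only [T^i u] with [i < p] occur, and none of them
    meets the preimage of [E] under [phi^p]. *)
Lemma wandering_backward p : (p <= N)%N ->
  m (chi (iter p phi @^-1` E)) (iter p T y) =
  lam ^+ p *: m (chi (iter p phi @^-1` E)) y.
Proof.
move=> pN; suff H q : (q <= p)%N ->
    m (chi (iter p phi @^-1` E)) (iter q T y - lam ^+ q *: y) = 0.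
  have := H p (leqnn p); rewrite linearB linearZ /= => /eqP.
  by rewrite subr_eq0 => /eqP.
elim: q => [|q IH] qp; first by rewrite expr0 scale1r subrr linear0.
rewrite step linearD linearZ_LR (IH (ltnW qp)) scaler0 addr0.
by apply: disjoint_iter; rewrite qp (leq_trans pN)// leq_addl.
Qed.
End wandering_sets.

(* Along an orbit decaying on both sides of [k] the equation [T y - lam y = u],
   with [u] supported near [k], would force [y] to be small near [k] and close
   to [- u / lam] there. *)
Lemma no_two_sided_decay D lam M rho : clopen D -> invariant_set phi D ->
  faithful_on D -> (forall k j, D k -> (0 < j)%N -> iter j phi k <> k) ->
  lam != 0 -> bounded_below (supported D) T lam -> solvable (supported D) T lam ->
  1 < rho -> 0 < M -> exists L, forall k n n', D k -> (L <= n)%N -> (L <= n')%N ->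
    cocycle phi (rel_weight lam) n k * rho ^+ n <= M ->
    rho ^+ n' <= M * cocycle phi (rel_weight lam) n' (iter n' psi k) -> False.
Proof.
move=> cD iD fD apD lam0 [c c0 cT] sD rho1 M0.
have l0 : 0 < nrm lam by apply: nrm_gt0; exact/eqP.
have rho0 : 0 < rho by exact: lt_trans rho1.
pose rho' := (1 + rho) / 2.
have rho'1 : 1 < rho' by rewrite /rho'; lra.
have rho'0 : 0 < rho' by exact: lt_trans rho'1.
have [C1 C10 UC] := U_growth rho'1; have [C2 C20 UiC] := Ui_growth rho'1.
pose C := C1 + C2; have C0 : 0 < C by rewrite addr_gt0.
have UC' n x : nrm (iter n U x) <= C * rho' ^+ n * nrm x.
  apply: le_trans (UC _ _) _; rewrite !ler_wpM2r ?nrm_ge0 ?exprn_ge0 ?(ltW rho'0)//.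
  by rewrite lerDl ltW.
have UiC' n x : nrm (iter n Ui x) <= C * rho' ^+ n * nrm x.
  apply: le_trans (UiC _ _) _; rewrite !ler_wpM2r ?nrm_ge0 ?exprn_ge0 ?(ltW rho'0)//.
  by rewrite lerDr ltW.
have r'r1 : 1 < rho / rho' by rewrite ltr_pdivlMr// mul1r /rho'; lra.
have [L0 L0P] := exp_unbounded (8 * nrm lam * M * C / c) r'r1.
pose W := cocycle phi (rel_weight lam).
have cW i : continuous (W i).
  by apply: cocycle_continuous => //; exact: rel_weight_continuous.
have cWb i : continuous (fun k => W i (iter i psi k)).
  by apply: cocycle_iter_inv_continuous => //; exact: rel_weight_continuous.
have wE i z : nrm (weight i z : R[i]) = nrm lam ^+ i * W i z by exact: nrm_weight.
pose q := rho' / rho.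
have q0 : 0 < q by rewrite divr_gt0.
have q1 : q <= 1 by rewrite ler_pdivrMr// mul1r /rho'; lra.
have qL n : (L0 <= n)%N -> nrm lam * (2 * M * C) * q ^+ n <= c / 4.
  move=> Ln; apply: (@le_trans _ _ (nrm lam * (2 * M * C) * q ^+ L0)).
    by rewrite ler_wpM2l ?ler_wiXn2l ?(ltW q0)// !mulr_ge0 ?nrm_ge0 ?(ltW M0) ?(ltW C0).
  have -> : q ^+ L0 = ((rho / rho') ^+ L0)^-1 by rewrite /q -exprVn invf_div.
  have p0 : 0 < (rho / rho') ^+ L0 by rewrite exprn_gt0// divr_gt0.
  rewrite ler_pdivrMr//; move: L0P; rewrite ler_pdivrMr//; lra.
have qE n : q ^+ n = rho' ^+ n / rho ^+ n by rewrite expr_div_n.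
(* The successor makes [n] positive: the forward relation is used in the form [n = p + 1]. *)
exists L0.+1 => k n n' Dk Ln Ln' Wn Wn'.
have M2 : M < 2 * M by lra.
(* The factor 2 lets the inequalities hold on a neighbourhood of [k], and [n + n'] disjoint iterates
   serve the forward and the backward relation at once. *)
have [|E [cE Ek EO Ewand]] := @wandering_nbhs K cK hK edK phi cphi k
    [set z | D z /\ W n z * rho ^+ n < 2 * M /\ rho ^+ n' < 2 * M * W n' (iter n' psi z)]
    (n + n')%N _ (fun j jn => apD k j Dk (andP jn).1).
  apply: filterI; first exact: open_nbhs_nbhs (conj cD.1 Dk).
  apply: filterI.
    have rn : 0 < rho ^+ n by rewrite exprn_gt0.
    have : \forall z \near k, W n z < 2 * M / rho ^+ n.
      have /cvgr_lt := @cW n k; apply.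
      by rewrite ltr_pdivlMr// (le_lt_trans Wn).
    by apply: filterS => z; rewrite ltr_pdivlMr.
  have M20 : 0 < 2 * M by rewrite mulr_gt0.
  have : \forall z \near k, rho ^+ n' / (2 * M) < W n' (iter n' psi z).
    have /cvgr_gt := @cWb n' k; apply.
    rewrite ltr_pdivrMr// mulrC; apply: (le_lt_trans Wn').
    rewrite ltr_pM2r// lt_neqAle cocycle_ge0 ?andbT; last exact: rel_weight_ge0.
    apply/eqP => W0; move: Wn'; rewrite -W0 mulr0 leNgt.
    by rewrite exprn_gt0.
  by apply: filterS => z; rewrite ltr_pdivrMr// mulrC.
have ED : E `<=` D by move=> z /EO[].
have [u u0 Eu] := fD E cE ED (ex_intro _ k Ek).
have Du : supported D u by apply: supported_sub Eu.
have [y Dy Ty] := sD u Du.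
have y_le : nrm y <= nrm u / c.
  by rewrite ler_pdivlMr// mulrC -Ty; exact: cT.
case: n Ln Wn EO Ewand => // p Ln Wn EO Ewand.
have pN : (p <= p.+1 + n')%N by rewrite addSn ltnW// ltnS leq_addr.
have fwd : nrm (u + lam *: m (chi E) y) <= nrm lam * (2 * M * C) * q ^+ p.+1 * nrm y.
  have := wandering_forward cE Eu Ewand Ty pN => fwd.
  have lp : 0 < nrm lam ^+ p by rewrite exprn_gt0.
  rewrite -(ler_pM2l lp) -[X in X * nrm (u + _)]nrmX -nrmZ -fwd weighted_iter mC.
  have c'0 : 0 <= nrm lam ^+ p.+1 * (2 * M / rho ^+ p.+1).
    by rewrite mulr_ge0 ?exprn_ge0 ?nrm_ge0// divr_ge0 ?exprn_ge0 ?mulr_ge0 ?(ltW M0) ?(ltW rho0).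
  apply: le_trans (@m_le_on E _ _ _ cE (supported_chi _ cE) c'0 _) _.
    move=> z /EO[_ [Wz _]]; rewrite wE ler_wpM2l ?exprn_ge0 ?nrm_ge0//.
    by rewrite ler_pdivlMr ?exprn_gt0// ltW.
  apply: le_trans (ler_wpM2l c'0 (le_trans (m_chi_le _ _) (UC' _ _))) _.
  by apply: le_of_eq; rewrite qE [nrm lam ^+ p.+1]exprS; ring.
have bwd : nrm (m (chi E) y) <= 2 * M * C * q ^+ n' * nrm y.
  have nN : (n' <= p.+1 + n')%N by rewrite leq_addl.
  have cEn : clopen (iter n' phi @^-1` E).
    by apply: preimage_clopen => //; exact: continuous_iter.
  have supE := supported_U n' cE (supported_chi y cE).
  have UE : m (chi (iter n' phi @^-1` E)) (iter n' U y) = iter n' U (m (chi E) y).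
    rewrite -U_iter_back; congr (iter n' U (m _ y)); apply: CbP => z; rewrite backE.
    have [Ez|nEz] := pselect (E z); last first.
      by rewrite !chi_notin//= iter_cancel.
    by rewrite !chi_in//= iter_cancel.
  have := wandering_backward cE Eu Ewand Ty nN => bwd.
  have H1 : nrm (iter n' U (m (chi E) y)) <= 2 * M / rho ^+ n' * nrm y.
    have ln : 0 < nrm lam ^+ n' by rewrite exprn_gt0.
    have rn : 0 < rho ^+ n' by rewrite exprn_gt0.
    have M20 : 0 < 2 * M by rewrite mulr_gt0.
    have d0 : 0 < nrm lam ^+ n' * (rho ^+ n' / (2 * M)) by rewrite mulr_gt0// divr_gt0.
    rewrite -(ler_pM2l d0).
    apply: (@le_trans _ _ (nrm (m (weight n') (iter n' U (m (chi E) y))))).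
      apply: (m_ge_on cEn) => // z /EO[_ [_]]; rewrite iter_cancel// => Wz.
      by rewrite wE ler_wpM2l ?(ltW ln)// ler_pdivrMr// mulrC ltW.
    rewrite -UE mC -weighted_iter bwd nrmZ nrmX.
    apply: le_trans (ler_wpM2l (ltW ln) (m_chi_le _ _)) _.
    by apply: le_of_eq; field; rewrite !gt_eqF.
  have := UiC' n' (iter n' U (m (chi E) y)); rewrite iter_cancel// => H2.
  apply: le_trans H2 _.
  have Cr : 0 <= C * rho' ^+ n' by rewrite mulr_ge0 ?exprn_ge0 ?(ltW C0) ?(ltW rho'0).
  apply: le_trans (ler_wpM2l Cr H1) _.
  by apply: le_of_eq; rewrite qE; ring.
(* By the choice of [L0] both [|u + lam y|] and [|lam y|], cut off to [E], are at most [c |y| / 4],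
   while [c |y| <= |u|]. So [|u| <= |u| / 2], which is absurd. *)
have up := nrm_gt0 u0.
have y0 := nrm_ge0 y.
have : nrm u <= nrm (u + lam *: m (chi E) y) + nrm lam * nrm (m (chi E) y).
  by rewrite -nrmZ -{1}(addrK (lam *: m (chi E) y) u) nrmB_le.
have H1 := ler_wpM2r y0 (qL p.+1 (ltnW Ln)).
have H2 := ler_wpM2r y0 (qL n' (ltnW Ln')).
have H3 := ler_wpM2l (ltW l0) bwd.
have : c * nrm y <= nrm u by move: y_le; rewrite ler_pdivlMr// mulrC.
by move: fwd H1 H2 H3; rewrite !mulrA; lra.
Qed.

(** Without peaks every point of [D] escapes forwards or backwards, and [no_two_sided_decay] forbids
    both. So [D] is split by two disjoint closed sets, which are therefore clopen in it. *)
Lemma aperiodic_dichotomy D lam : clopen D -> invariant_set phi D ->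
  faithful_on D -> (forall k j, D k -> (0 < j)%N -> iter j phi k <> k) ->
  lam != 0 -> bounded_below (supported D) T lam -> solvable (supported D) T lam ->
  dichotomy phi psi (rel_weight lam) D.
Proof.
move=> cD iD fD apD lam0 bD sD; pose a := rel_weight lam.
have ca : continuous a by exact: rel_weight_continuous.
have a0 k : 0 <= a k by exact: rel_weight_ge0.
have [b b1 ab] := rel_weight_le lam.
have npD k : D k -> ~ peak phi psi a k.
  move=> Dk pk; apply: (peak_not_bounded_below cD iD fD lam0 Dk pk _ bD).
  by move=> j; exact: apD.
have [N [beta [beta1 npN]]] := no_peak_uniform cphi cpsi ca a0 (compact_clopen cD) npD.
have [rho [rho1 esc]] := no_peak_escape phiK psiK a0 iD beta1 npN.
have rho0 : 0 < rho by exact: lt_trans rho1.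
have b0 : 0 < b by exact: lt_le_trans b1.
(* One step along the orbit changes the estimates by a factor at most [b * rho]; with this [M] the
   exclusion also applies to [k] and [phi k] together, which gives invariance. *)
have M0 : 0 < b * rho by rewrite mulr_gt0.
have M1 : 1 <= b * rho by rewrite mulr_ege1// ltW.
have bM : b <= b * rho by rewrite ler_peMr// ltW.
have [L LP] := no_two_sided_decay cD iD fD apD lam0 bD sD rho1 M0.
pose W := cocycle phi a.
have W0 n k : 0 <= W n k by exact: cocycle_ge0.
(* Times beyond [L + 1], not just [L]: the comparison of [k] with [phi k] below uses up one step. *)
pose Bp := [set k | exists n, (0 < n <= L.+1 + N)%N /\ ((L.+1 < n)%N /\ W n k <= rho ^- n)].
pose Bm := [set k | exists n, (0 < n <= L.+1 + N)%N /\
  ((L.+1 < n)%N /\ rho ^+ n <= W n (iter n psi k))].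
have closed_and (b' : bool) (P : set K) : closed P -> closed [set k | b' /\ P k].
  move=> cP; case: b'; first by rewrite (_ : [set k | _] = P)//; apply/seteqP; split=> k //= [].
  by rewrite (_ : [set k | _] = set0); [exact: closed0|apply/seteqP; split=> k //= []].
have clBp : closed Bp.
  apply: closed_exists_bounded => n; apply: closed_and.
  apply: (@closed_comp _ _ (W n) [set x | x <= rho ^- n]); last exact: closed_le.
  by move=> k _; exact: cocycle_continuous.
have clBm : closed Bm.
  apply: closed_exists_bounded => n; apply: closed_and.
  apply: (@closed_comp _ _ (fun k => W n (iter n psi k)) [set x | rho ^+ n <= x]).
    by move=> k _; exact: cocycle_iter_inv_continuous.
  exact: closed_ge.
have cover k : D k -> Bp k \/ Bm k.
  move=> Dk; have [n [/andP[Ln nN] Wn]] := esc L.+1 k Dk.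
  have n0 : (0 < n)%N by exact: leq_ltn_trans Ln.
  by case: Wn => [/ltW Wn|/ltW Wn]; [left|right]; exists n; rewrite n0 nN Ln.
have down n k : W n k <= rho ^- n -> W n k * rho ^+ n <= 1.
  by move=> H; rewrite -ler_pdivlMr ?exprn_gt0// mul1r.
have excl k : D k -> Bp k -> Bm k -> False.
  move=> Dk [n [_ [Ln /down Wn]]] [n' [_ [Ln' Wn']]].
  apply: (LP k n n' Dk) => //; [by rewrite ltnW// ltnW|by rewrite ltnW// ltnW| |].
    exact: le_trans Wn M1.
  by apply: le_trans Wn' _; rewrite ler_peMl.
pose B := D `&` Bp.
have cB : clopen B.
  split; last by apply: closedI => //; exact: cD.2.
  rewrite (_ : B = D `&` ~` Bm); last first.
    apply/seteqP; split=> k [Dk Hk]; split=> //; first by move=> Bmk; exact: excl Hk Bmk.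
    by case: (cover k Dk).
  by apply: openI; [exact: cD.1|exact: closed_openC].
have iB : invariant_set phi B.
  move=> k; have iDk := iD k; split=> -[Dk Bk]; split; try tauto.
    have Dk' : D k by tauto.
    case: (cover k Dk') => // -[n' [_ [Ln' Wn']]]; exfalso.
    have [n [_ [Ln /down Wn]]] := Bk.
    apply: (LP k n.+1 n' Dk'); [by rewrite ltnW// ltnW// ltnW|by rewrite ltnW// ltnW| |].
      rewrite cocycleS exprS mulrACA -[leRHS]mulr1.
      apply: ler_pM => //; first exact: mulr_ge0 (a0 k) (ltW rho0).
        by apply: mulr_ge0; [exact: W0|rewrite exprn_ge0// ltW].
      exact: ler_wpM2r (ltW rho0) _ _ (ab k).
    by apply: le_trans Wn' _; rewrite ler_peMl.
  case: (cover (phi k) _) => //; first by tauto.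
  move=> [n' [_ [Ln' Wn']]]; exfalso.
  have [n [_ [Ln /down Wn]]] := Bk; case: n' Ln' Wn' => // n' Ln' Wn'.
  apply: (LP k n n' Dk); [by rewrite ltnW// ltnW|by rewrite ltnW| |].
    exact: le_trans Wn M1.
  have : iter n'.+1 psi (phi k) = iter n' psi k by rewrite iterSr phiK.
  move: Wn' => /[swap] ->; rewrite /W -addn1 cocycleD cocycle1 iter_cancel// => Wn'.
  apply: (@le_trans _ _ (rho ^+ (n' + 1))); first by rewrite ler_weXn2l ?(ltW rho1)// leq_addr.
  apply: le_trans Wn' _; rewrite mulrC ler_wpM2r//.
  exact: le_trans bM.
exists B, (L.+1 + N)%N, rho; split=> //; first by move=> k [].
split.
  by move=> k [_ [n [nN [_ Wn]]]]; exists n.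
move=> k [Dk nBk]; case: (cover k Dk) => [Bk|]; first by exfalso; apply: nBk.
by move=> [n [nN [_ Wn]]]; exists n.
Qed.

Lemma aperiodic_bounded_belowP D lam : clopen D -> invariant_set phi D ->
  faithful_on D -> (forall k j, D k -> (0 < j)%N -> iter j phi k <> k) ->
  bounded_below (supported D) T lam <->
  (forall k, D k -> if lam == 0 then w k <> 0 else ~ peak phi psi (rel_weight lam) k).
Proof.
move=> cD iD fD apD; have [->|lam0] := eqVneq lam 0.
  split; first exact: bounded_below_zero.
  by move=> w0; case: (zero_solvable cD iD w0).
split=> [bD k Dk pk|]; last exact: no_peak_bounded_below.
apply: (peak_not_bounded_below cD iD fD lam0 Dk pk _ bD) => j.
exact: apD.
Qed.

Lemma aperiodic_invertibleP D lam : clopen D -> invariant_set phi D ->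
  faithful_on D -> (forall k j, D k -> (0 < j)%N -> iter j phi k <> k) ->
  bounded_below (supported D) T lam /\ solvable (supported D) T lam <->
  (if lam == 0 then forall k, D k -> w k <> 0
   else dichotomy phi psi (rel_weight lam) D).
Proof.
move=> cD iD fD apD; have [->|lam0] := eqVneq lam 0.
  split; first by case=> bD _; exact: bounded_below_zero.
  by move=> w0; exact: zero_solvable.
split; first by case; exact: aperiodic_dichotomy.
move=> dD; split; last exact: dichotomy_solvable.
apply: no_peak_bounded_below => // k; exact: dichotomy_no_peak.
Qed.

(** * Periodic points, layered by their period *)

Lemma fixed_iter_clopen n : clopen [set k | iter n phi k = k].
Proof.
apply: (fixed_points_clopen cK hK edK (psi := iter n psi)).
- exact: continuous_iter.
- exact: continuous_iter.
- exact: iter_cancel.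
- exact: iter_cancel.
Qed.

Lemma Pi_clopen n : clopen (Pi_ phi n).
Proof.
pose P n := [set k | forall j, (0 < j < n)%N -> iter j phi k <> k].
have cP : clopen (P n).
  elim: n => [|n IH].
    rewrite (_ : P 0%N = setT); last first.
      by apply/seteqP; split=> // k _ j; rewrite ltn0 andbF.
    by split; [exact: openT|exact: closedT].
  have [->|n0] := posnP n.
    rewrite (_ : P 1%N = setT); last first.
      by apply/seteqP; split=> // k _ j; rewrite ltnS leqn0; case: j.
    by split; [exact: openT|exact: closedT].
  rewrite (_ : P n.+1 = P n `&` ~` [set k | iter n phi k = k]).
    by apply: clopenI => //; apply: clopen_setC; exact: fixed_iter_clopen.
  apply/seteqP; split=> k => [Pk|[Pk nk] j].
    split; last by apply: Pk; rewrite n0 ltnSn.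
    by move=> j /andP[j0 jn]; apply: Pk; rewrite j0 ltnW.
  move=> /andP[j0]; rewrite ltnS leq_eqVlt => /orP[/eqP ->//|jn].
  by apply: Pk; rewrite j0.
have [->|n0] := posnP n.
  rewrite (_ : Pi_ phi 0 = set0); first by split; [exact: open0|exact: closed0].
  by apply/seteqP; split=> // k [].
rewrite (_ : Pi_ phi n = [set k | iter n phi k = k] `&` P n).
  by apply: clopenI => //; exact: fixed_iter_clopen.
by apply/seteqP; split=> k []//.
Qed.

Lemma Pi_invariant n : invariant_set phi (Pi_ phi n).
Proof.
have fixS j k : iter j phi (phi k) = phi k <-> iter j phi k = k.
  rewrite -iterSr iterS; split=> [e|->//].
  by rewrite -[LHS]phiK e phiK.
by move=> k; split=> -[n0 nk jk]; split=> //;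
  (try exact/fixS); move=> j /jk; apply: contra_not => /fixS.
Qed.

Lemma Pi_disjoint n p k : Pi_ phi n k -> Pi_ phi p k -> n = p.
Proof.
move=> [n0 nk nmin] [p0 pk pmin]; case: (ltngtP n p) => // lt.
  by have := pmin n; rewrite n0 lt => /(_ isT).
by have := nmin p; rewrite p0 lt => /(_ isT).
Qed.

Lemma period_exists j k : (0 < j)%N -> iter j phi k = k ->
  exists n, (0 < n <= j)%N /\ Pi_ phi n k.
Proof.
move=> j0 jk; pose P n := (0 < n)%N && `[< iter n phi k = k >].
have exP : exists n, P n by exists j; rewrite /P j0; exact/asboolP.
case: (ex_minnP exP) => n /andP[n0 /asboolP nk] nmin; exists n.
split; first by rewrite n0 nmin// /P j0; exact/asboolP.
split=> // i /andP[i0 ni] ik; move: ni; rewrite ltnNge => /negP; apply.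
by apply: nmin; rewrite /P i0; exact/asboolP.
Qed.

Definition short_period D M : set K :=
  [set k | exists n, (0 < n <= M)%N /\ (D `&` Pi_ phi n) k].

Section layers.
Variable D : set K.
Hypotheses (cD : clopen D) (iD : invariant_set phi D).

Let clayer n : clopen (D `&` Pi_ phi n).
Proof. by apply: clopenI => //; exact: Pi_clopen. Qed.

Let ilayer n : invariant_set phi (D `&` Pi_ phi n).
Proof. by move=> k; have := iD k; have := @Pi_invariant n k; rewrite /setI /=; tauto. Qed.

Lemma short_period_clopen M : clopen (short_period D M).
Proof.
split; last by apply: closed_exists_bounded => n; exact: (clayer n).2.
rewrite (_ : short_period D M =
  \bigcup_(n in [set n | (0 < n <= M)%N]) (D `&` Pi_ phi n)).
  by apply: bigcup_open => n _; exact: (clayer n).1.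
by apply/seteqP; split=> k [n]; [case=> nM nk|move=> nM nk]; exists n.
Qed.

Lemma short_period_invariant M : invariant_set phi (short_period D M).
Proof. by move=> k; split=> -[n [nM nk]]; exists n; split=> //; exact/ilayer. Qed.

Lemma short_period_sub M : short_period D M `<=` D.
Proof. by move=> k [n [_ []]]. Qed.

Lemma short_periodS M :
  short_period D M.+1 = short_period D M `|` (D `&` Pi_ phi M.+1).
Proof.
apply/seteqP; split=> k.
  move=> [n [/andP[n0]]]; rewrite leq_eqVlt ltnS => /orP[/eqP -> nk|nM nk].
    by right.
  by left; exists n; rewrite n0.
move=> [[n [/andP[n0 nM] nk]]|nk]; first by exists n; rewrite n0 leqW.
by exists M.+1; rewrite leqnn.
Qed.

Lemma short_period_disjoint M : short_period D M `&` (D `&` Pi_ phi M.+1) = set0.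
Proof.
apply/seteqP; split=> // k [[n [/andP[_ nM] [_ nk]]] [_ Mk]].
by move: nM; rewrite (Pi_disjoint nk Mk) ltnn.
Qed.

Lemma short_period0 : short_period D 0 = set0.
Proof. by apply/seteqP; split=> // k [[|n] []]. Qed.

Lemma bounded_below_short lam M :
  (forall n, (0 < n)%N -> bounded_below (supported (D `&` Pi_ phi n)) T lam) ->
  bounded_below (supported (short_period D M)) T lam.
Proof.
move=> bl; elim: M => [|M IH].
  exists 1 => // x; rewrite /supported short_period0 m_chi0// => <-.
  by rewrite nrm0 mulr0 nrm_ge0.
rewrite short_periodS; apply: bounded_below_setU => //.
- exact: short_period_clopen.
- exact: short_period_invariant.
- exact: short_period_disjoint.
- exact: bl.
Qed.

Lemma solvable_short lam M :
  (forall n, (0 < n)%N -> solvable (supported (D `&` Pi_ phi n)) T lam) ->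
  solvable (supported (short_period D M)) T lam.
Proof.
move=> bl; elim: M => [|M IH].
  move=> y; rewrite /supported short_period0 m_chi0// => <-.
  by exists 0; [rewrite m_chi0|rewrite /weighted !linear0 ?subr0 ?oppr0 ?addr0].
rewrite short_periodS; apply: solvable_setU => //.
- exact: short_period_clopen.
- exact: short_period_disjoint.
- exact: bl.
Qed.

(** The points that are not peaks form an open set, and so does each layer [Pi_ phi n]. If all peaks
    in [D] are periodic, these sets cover the compact [D], and finitely many layers suffice. *)
Lemma peaks_short_period lam :
  (forall k, D k -> peak phi psi (rel_weight lam) k ->
     exists2 j, (0 < j)%N & iter j phi k = k) ->
  exists M, forall k, (D `\` short_period D M) k ->
    ~ peak phi psi (rel_weight lam) k.
Proof.
move=> pD; pose a := rel_weight lam.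
pose P M k := D k -> short_period D M k \/ ~ peak phi psi a k.
have /compact_near_coveringP/(_ nat \oo P) := compact_clopen cD.
case=> [k Dk|M _ PM]; last first.
  exists M => k [Dk nk]; have [|//] := PM M (leqnn M) k Dk Dk.
  by [].
have [pk|npk] := pselect (peak phi psi a k).
  have [j j0 jk] := pD k Dk pk; have [n [/andP[n0 nj] nk]] := period_exists j0 jk.
  exists (Pi_ phi n, [set M | (n <= M)%N]) => /=.
    split; first exact: open_nbhs_nbhs (conj (Pi_clopen n).1 nk).
    exact: nbhs_infty_ge.
  by move=> [k' M] [/= nk' nM] Dk'; left; exists n; rewrite n0 nM.
have ca : continuous a by exact: rel_weight_continuous.
suff npn : \forall k' \near k, ~ peak phi psi a k'.
  exists ([set k' | ~ peak phi psi a k'], setT) => /=.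
    by split=> //; exact: filterT.
  by move=> [k' M] [/= npk' _] _; right.
move: npk => /existsNP[n /not_andP[/negP|/negP]]; rewrite -ltNge => Wn.
  have : \forall k' \near k, cocycle phi a n k' < 1.
    by have /cvgr_lt := @cocycle_continuous _ _ _ cphi _ ca n k; apply.
  by apply: filterS => k' Wk' /(_ n)[]; rewrite leNgt Wk'.
have : \forall k' \near k, 1 < cocycle phi a n (iter n psi k').
  by have /cvgr_gt := @cocycle_iter_inv_continuous _ _ _ _ cphi cpsi _ ca n k; apply.
by apply: filterS => k' Wk' /(_ n)[_]; rewrite leNgt Wk'.
Qed.

Let cD' M : clopen (D `\` short_period D M).
Proof. by apply: clopen_setD => //; exact: short_period_clopen. Qed.

Let iD' M : invariant_set phi (D `\` short_period D M).
Proof. by apply: invariant_setD => //; exact: short_period_invariant. Qed.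

Let split_period M : D = short_period D M `|` (D `\` short_period D M).
Proof. by rewrite setDUK//; exact: short_period_sub. Qed.

Lemma bounded_below_layers lam : lam != 0 ->
  (forall k, D k -> peak phi psi (rel_weight lam) k ->
     exists2 j, (0 < j)%N & iter j phi k = k) ->
  (forall n, (0 < n)%N -> bounded_below (supported (D `&` Pi_ phi n)) T lam) ->
  bounded_below (supported D) T lam.
Proof.
move=> lam0 pD bl; have [M npM] := peaks_short_period pD.
rewrite (split_period M); apply: bounded_below_setU => //.
- exact: short_period_clopen.
- exact: short_period_invariant.
- by rewrite setDIK.
- exact: bounded_below_short.
- exact: no_peak_bounded_below.
Qed.

Hypothesis fD : faithful_on D.

Lemma faithful_sub E : E `<=` D -> faithful_on E.
Proof. by move=> ED F cF FE; apply: fD => //; exact: subset_trans ED. Qed.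

Lemma bounded_below_peaks_periodic lam : lam != 0 ->
  bounded_below (supported D) T lam -> forall k, D k ->
  peak phi psi (rel_weight lam) k -> exists2 j, (0 < j)%N & iter j phi k = k.
Proof.
move=> lam0 bD k Dk pk; apply: contrapT => nj.
apply: (peak_not_bounded_below cD iD fD lam0 Dk pk _ bD) => j j0 jk.
by apply: nj; exists j.
Qed.

Lemma layer_solvable lam n : (0 < n)%N ->
  bounded_below (supported (D `&` Pi_ phi n)) T lam ->
  solvable (supported (D `&` Pi_ phi n)) T lam.
Proof.
move=> n0; apply: (@periodic_solvable _ lam n) => //.
- by apply: faithful_sub => k [].
- by move=> k [_ []].
Qed.

(** A lower bound leaves only periodic peaks, so all of them lie in finitely many layers, each
    covered by [periodic_solvable]. What remains has no peaks and dense periodic points, hence a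
    dichotomy. *)
Lemma dense_periodic_solvable lam :
  D `<=` closure (\bigcup_(n in [set n | (0 < n)%N]) Pi_ phi n) ->
  bounded_below (supported D) T lam -> solvable (supported D) T lam.
Proof.
move=> perD bD; have [lam0|lam0] := eqVneq lam 0.
  rewrite lam0 in bD *; apply: (zero_solvable cD iD _).2.
  exact: bounded_below_zero.
have [M npM] := peaks_short_period (bounded_below_peaks_periodic lam0 bD).
rewrite (split_period M); apply: solvable_setU => //.
- exact: short_period_clopen.
- by rewrite setDIK.
- apply: solvable_short => n n0; apply: layer_solvable => //.
  by apply: bounded_below_sub bD => // k [].
have ca : continuous (rel_weight lam) by exact: rel_weight_continuous.
have a0 k : 0 <= rel_weight lam k by exact: rel_weight_ge0.
have [b b1 ab] := rel_weight_le lam.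
have [N [beta [beta1 npN]]] :=
  no_peak_uniform cphi cpsi ca a0 (compact_clopen (cD' M)) npM.
apply: dichotomy_solvable => //.
apply: (dense_periodic_dichotomy cphi cpsi phiK psiK ca a0 b1 ab cK hK edK _ _ beta1 npN) => //.
move=> k D'k O Ok.
have [|j [[n n0 nj] [Oj D'j]]] := perD k D'k.1 (O `&` (D `\` short_period D M)).
  by apply: filterI => //; exact: open_nbhs_nbhs (conj (cD' M).1 D'k).
exists j; split=> //; split=> //; exists n => //.
by case: nj.
Qed.

(** Peaks for [lam] and [mu] are the same, and the lower bound at [mu] makes them periodic. Points
    of one circle are thus told apart only by the layers. *)
Lemma bounded_below_rotation lam mu : nrm lam = nrm mu ->
  bounded_below (supported D) T mu ->
  (forall n, (0 < n)%N -> bounded_below (supported (D `&` Pi_ phi n)) T lam) ->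
  bounded_below (supported D) T lam.
Proof.
move=> lm bD bl; have [lam0|lam0] := eqVneq lam 0.
  by rewrite lam0 in lm *; rewrite nrm0 in lm; rewrite -(nrm_eq0 (esym lm)).
have mu0 : mu != 0.
  by apply/eqP => mu0; move/eqP: lam0; apply; apply: nrm_eq0; rewrite lm mu0 nrm0.
apply: bounded_below_layers => // k Dk pk.
apply: (bounded_below_peaks_periodic mu0 bD) => //.
by rewrite /rel_weight -lm.
Qed.
End layers.

(** * Spectra on invariant clopen sets *)

Local Notation Y E := (range (m (chi E))).

Lemma range_chiE E : clopen E -> Y E = supported E.
Proof.
move=> cE; apply/seteqP; split=> [_ [x _ <-]|x Ex]; first exact: supported_chi.
by exists x.
Qed.

Lemma notin_spectrumP E lam : clopen E -> invariant_set phi E ->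
  ~ spectrum_on (Y E) T lam <->
  bounded_below (supported E) T lam /\ solvable (supported E) T lam.
Proof.
move=> cE iE; rewrite range_chiE//; apply: notin_spectrum_onP.
- exact: supportedP.
- exact: weighted_lin.
- by move=> x; exact: supported_weighted.
Qed.

Lemma notin_ap_spectrumP E lam : clopen E ->
  ~ ap_spectrum_on (Y E) T lam <-> bounded_below (supported E) T lam.
Proof.
move=> cE; rewrite range_chiE//; apply: notin_ap_spectrum_onP.
  exact: supportedP.
exact: weighted_lin.
Qed.

Lemma eq_set_notin (I : Type) (A B : set I) :
  (forall i, ~ A i <-> ~ B i) -> A = B.
Proof.
move=> AB; apply/seteqP; split=> i Ai; apply: contrapT => nB.
  exact: ((AB i).2 nB Ai).
exact: ((AB i).1 nB Ai).
Qed.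

Section aperiodic_spectra.
Variable D : set K.
Hypotheses (cD : clopen D) (iD : invariant_set phi D) (fD : faithful_on D).
Hypothesis apD : forall k j, D k -> (0 < j)%N -> iter j phi k <> k.

Lemma aperiodic_spectrumE : spectrum_on (Y D) T =
  [set lam | ~ if lam == 0 then forall k, D k -> w k <> 0
               else dichotomy phi psi (rel_weight lam) D].
Proof.
apply: eq_set_notin => lam; rewrite notin_spectrumP// aperiodic_invertibleP//=.
by split=> [?|/contrapT]; first by apply.
Qed.

Lemma aperiodic_ap_spectrumE : ap_spectrum_on (Y D) T =
  [set lam | ~ forall k, D k ->
     if lam == 0 then w k <> 0 else ~ peak phi psi (rel_weight lam) k].
Proof.
apply: eq_set_notin => lam; rewrite notin_ap_spectrumP// aperiodic_bounded_belowP//=.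
by split=> [?|/contrapT]; first by apply.
Qed.
End aperiodic_spectra.

Section periodic_spectra.
Hypothesis faithful : faithful_on setT.

Let faithfulS E : faithful_on E.
Proof. exact: faithful_sub faithful _ _. Qed.

Let cPi n : clopen (Pi_ phi n). Proof. exact: Pi_clopen. Qed.
Let iPi n : invariant_set phi (Pi_ phi n). Proof. exact: Pi_invariant. Qed.

Lemma bounded_below_solvable_spectrum E : clopen E -> invariant_set phi E ->
  (forall lam, bounded_below (supported E) T lam -> solvable (supported E) T lam) ->
  ap_spectrum_on (Y E) T = spectrum_on (Y E) T.
Proof.
move=> cE iE bs; apply: eq_set_notin => lam.
rewrite notin_spectrumP// notin_ap_spectrumP//.
by split=> [b|[]//]; split=> //; exact: bs.
Qed.

Lemma Pi_n_spectrum n : (0 < n)%N ->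
  ap_spectrum_on (Y (Pi_ phi n)) T = spectrum_on (Y (Pi_ phi n)) T.
Proof.
move=> n0; apply: bounded_below_solvable_spectrum => // lam.
by apply: (@periodic_solvable _ lam n) => // k [].
Qed.

Let cPi_all : clopen (Pi phi).
Proof. by apply: closure_clopen => //; apply: bigcup_open => n _; exact: (cPi n).1. Qed.

Let iPi_all : invariant_set phi (Pi phi).
Proof.
apply: (invariant_closure cphi cpsi phiK psiK) => k.
by split=> -[n n0 nk]; exists n => //; exact/iPi.
Qed.

Let Pi_sub n : (0 < n)%N -> Pi_ phi n `<=` Pi phi.
Proof. by move=> n0; apply: subset_trans (@subset_closure _ _) => k nk; exists n. Qed.

Lemma Pi_spectrum : spectrum_on (Y (Pi phi)) T = ap_spectrum_on (Y (Pi phi)) T.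
Proof.
rewrite bounded_below_solvable_spectrum// => lam.
exact: dense_periodic_solvable.
Qed.

Lemma Pi_ap_spectrum_rotation : exists sigma : set R[i]^o,
  rotation_invariant sigma /\
  ap_spectrum_on (Y (Pi phi)) T =
    closure (\bigcup_(n in [set n | (0 < n)%N]) spectrum_on (Y (Pi_ phi n)) T)
    `|` sigma.
Proof.
set S := ap_spectrum_on _ _.
(* The union of all full circles contained in the spectrum. By [bounded_below_rotation] a spectral
   point outside the spectra of the layers drags its whole circle along. *)
pose sigma : set R[i]^o := [set lam | forall mu : R[i], nrm mu = nrm lam -> S mu].
have rot_sub (alpha : R[i]^o) : unit_circle alpha ->
    [set alpha * z | z in sigma] `<=` sigma.
  move=> a1 _ [z sz <-] mu; rewrite nrmM (_ : nrm alpha = 1) ?mul1r; last first.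
    by rewrite /nrm a1.
  exact: sz.
exists sigma; split.
  move=> alpha a1; apply/seteqP; split; first exact: rot_sub.
  have alpha0 : alpha != 0.
    by apply/eqP => a0; move: a1; rewrite /unit_circle /= a0 normr0 => /esym/eqP; rewrite oner_eq0.
  move=> z sz; exists (alpha^-1 * z); last by rewrite mulrA mulfV// mul1r.
  apply: (rot_sub alpha^-1); last by exists z.
  by rewrite /unit_circle /= normfV a1 invr1.
have SP lam : ~ S lam <-> bounded_below (supported (Pi phi)) T lam.
  exact: notin_ap_spectrumP.
apply/seteqP; split=> [lam Slam|lam [clam|]]; last by apply.
  have [Ulam|nU] := pselect ((\bigcup_(n in [set n | (0 < n)%N])
      spectrum_on (Y (Pi_ phi n)) T) lam); first by left; exact: subset_closure.
  right => mu mulam; apply: contrapT => /SP bmu; apply: ((SP lam).2 _ Slam).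
  apply: (@bounded_below_rotation (Pi phi) _ _ _ lam mu) => //.
  move=> n n0; rewrite setIC (setIidl (Pi_sub n0)).
  apply: ((notin_spectrumP lam (cPi n) (@iPi n)).1 _).1 => nlam.
  by apply: nU; exists n.
(* A lower bound at [lam] persists nearby and restricts to each layer, where it amounts to lying
   outside the spectrum; so [lam] is no limit of points in the spectra of the layers. *)
apply: contrapT => /SP blam; have [e e0 eb] := bounded_below_open blam.
have [|mu [[n n0 mun] mulam]] := clam [set mu : R[i]^o | nrm (mu - lam : R[i]) <= e].
  apply/nbhs_ballP; exists e%:C%C => /=; first by rewrite ltcR.
  move=> mu; rewrite -ball_normE /= -nrmE ltcR nrmB => /ltW; exact.
apply: ((notin_ap_spectrumP mu (cPi n)).2 _).
  by apply: bounded_below_sub (eb mu mulam) => //; exact: Pi_sub.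
by rewrite Pi_n_spectrum.
Qed.
End periodic_spectra.
End weighted_operators.

(** * The modules X and C(NPi) *)

Section completeness.
Context {R : realType}.

Lemma complete_sequentially_complete (V : completeNormedModType R[i]) :
  sequentially_complete V.
Proof.
move=> u uC; have /cauchy_cvg cu : cauchy (u @ \oo).
  apply: cauchy_exP => e e0.
  have e20 : 0 < nrm e / 2.
    by rewrite divr_gt0//; apply: nrm_gt0 => e00; rewrite e00 ltxx in e0.
  have [N Ne] := uC _ e20; exists (u N); exists N => // i Ni.
  rewrite -ball_normE /= -nrmE; have -> : e = (nrm e)%:C%C by rewrite nrmE gtr0_norm.
  rewrite ltcR; apply: le_lt_trans (Ne N i _ Ni) _ => //.
  by rewrite ltr_pdivrMr// ltr_pMr ?ltr1n//; move: e20; rewrite pmulr_lgt0.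
exists (lim (u @ \oo)) => e e0.
have /cvgrPdist_lt/(_ e%:C%C) := cu; rewrite ltcR => /(_ e0)[N _ uN].
exists N => i /uN /=; rewrite -nrmE ltcR nrmB; exact: ltW.
Qed.

Lemma real_cauchy_cvg (u : nat -> R) :
  (forall e : R, 0 < e -> exists N, forall i j, (N <= i)%N -> (N <= j)%N ->
     `|u i - u j| <= e) ->
  exists l : R, u @ \oo --> l.
Proof.
move=> uC; exists (lim (u @ \oo)); apply: (@cauchy_cvg R) => //.
apply: cauchy_exP => e e0; have e20 : 0 < e / 2 by rewrite divr_gt0.
have [N Ne] := uC _ e20; exists (u N); exists N => // i Ni.
apply: le_lt_trans (Ne N i _ Ni) _ => //.
by rewrite ltr_pdivrMr// ltr_pMr// ltr1n.
Qed.

Lemma Cb_sequentially_complete (L : topologicalType) :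
  sequentially_complete (Cb R L).
Proof.
move=> u uC.
have dist_le i j k : nrm ((u i) k - (u j) k : R[i]) <= nrm (u i - u j).
  exact: (nrm_le_supnorm (u i - u j)).
have uk k : exists l : R[i], forall e : R, 0 < e -> exists N, forall i, (N <= i)%N ->
    nrm ((u i) k - l : R[i]) <= e.
  have [x xE] : exists x : R, (fun i => complex.Re (u i k)) @ \oo --> x.
    apply: real_cauchy_cvg => e e0; have [N uN] := uC e e0; exists N => i j Ni Nj.
    apply: le_trans (uN i j Ni Nj); apply: le_trans (dist_le i j k).
    by rewrite -raddfB; exact: le_nrm_Re.
  have [y yE] : exists y : R, (fun i => complex.Im (u i k)) @ \oo --> y.
    apply: real_cauchy_cvg => e e0; have [N uN] := uC e e0; exists N => i j Ni Nj.
    apply: le_trans (uN i j Ni Nj); apply: le_trans (dist_le i j k).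
    by rewrite -raddfB; exact: le_nrm_Im.
  exists (x%:C + 'i * y%:C)%C => e e0; have e20 : 0 < e / 2 by rewrite divr_gt0.
  have /cvgrPdist_lt/(_ _ e20)[N1 _ N1P] := xE.
  have /cvgrPdist_lt/(_ _ e20)[N2 _ N2P] := yE.
  exists (maxn N1 N2) => i; rewrite geq_max => /andP[/N1P /= x_le /N2P /= y_le].
  rewrite [X in nrm (X - _)]complexE opprD addrACA -mulrBr -!rmorphB /=.
  apply: le_trans (nrm_ReIm _ _) _; rewrite !(distrC _ x) !(distrC _ y).
  by move: x_le y_le; lra.
have /choice[g gP] := uk.
have ug e : 0 < e -> exists N, forall i k, (N <= i)%N -> nrm ((u i) k - g k : R[i]) <= e.
  move=> e0; have e20 : 0 < e / 2 by rewrite divr_gt0.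
  have [N uN] := uC _ e20; exists N => i k Ni.
  have [N' gN'] := gP k _ e20.
  rewrite -(subrK (u (maxn N N') k) (u i k)) -addrA.
  apply: le_trans (nrmD_le _ _) _.
  have H1 := le_trans (dist_le i (maxn N N') k) (uN i (maxn N N') Ni (leq_maxl _ _)).
  have H2 := gN' (maxn N N') (leq_maxr _ _).
  by move: H1 H2; lra.
have gb : (g : L -> R[i]^o) \in bounded_continuous.
  apply/bounded_continuousP; split.
    move=> k; apply/cvgrPdist_lt => e e0.
    have ne0 : 0 < nrm e by apply: nrm_gt0 => e00; rewrite e00 ltxx in e0.
    have eE : e = (nrm e)%:C%C by rewrite nrmE gtr0_norm.
    have e40 : 0 < nrm e / 4 by rewrite divr_gt0.
    have [N gN] := ug _ e40.
    have [cu _] := bounded_continuousP _ (Cb_funP (u N)).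
    have /cvgrPdist_lt/(_ (nrm e / 4)%:C%C) := cu k; rewrite ltcR => /(_ e40).
    apply: filterS => j; rewrite -!nrmE ltcR {2}eE ltcR => uj.
    rewrite (_ : g k - g j = (g k - u N k) + ((u N k - u N j) + (u N j - g j))).
      apply: le_lt_trans (nrmD_le _ _) _.
      have := nrmD_le (u N k - u N j : R[i]) (u N j - g j).
      have := gN N k (leqnn N); rewrite nrmB; have := gN N j (leqnn N).
      by move: uj; lra.
    by rewrite !addrA !subrK.
  have [N gN] := ug 1 ltr01.
  have [_ [M uM]] := bounded_continuousP _ (Cb_funP (u N)).
  exists (1 + M) => k; rewrite -nrm_le -(subrK (u N k) (g k)).
  apply: le_trans (nrmD_le _ _) _; apply: lerD; last by rewrite nrm_le.
  by rewrite nrmB; exact: gN.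
exists (MkCb gb) => e e0; have [N gN] := ug e e0; exists N => i Ni.
apply: supnorm_le_nrm; first exact: ltW.
by move=> k; exact: gN.
Qed.
End completeness.

(** * Operator bounds and operators with spectrum on the circle *)

Section bounded_operators.
Context {R : realType} {V W : normedModType R[i]}.

Lemma blin_bounded (A : blin V W) : exists2 M : R, 0 < M &
  forall x, nrm (A x) <= M * nrm x.
Proof.
have cA : A @ (0 : V) --> (0 : W).
  by rewrite -[X in _ --> X](linear0 A); exact: blin_cont.
move: cA => /cvgrPdist_lt/(_ 1 ltr01)/nbhs_ballP[e /= e0 eA].
have ne0 : 0 < nrm e by apply: nrm_gt0 => e00; rewrite e00 ltxx in e0.
have eE : e = (nrm e)%:C%C by rewrite nrmE gtr0_norm.
exists (2 / nrm e); first by rewrite divr_gt0.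
move=> x; have [->|/eqP x0] := eqVneq x 0; first by rewrite linear0 !nrm0 mulr0.
have xp := nrm_gt0 x0.
pose t := nrm e / 2 / nrm x; have t0 : 0 < t by rewrite !divr_gt0.
have /eA : ball (0 : V) e (t%:C%C *: x).
  rewrite -ball_normE /= sub0r normrN -nrmE eE ltcR nrmZ nrm_real gtr0_norm//.
  by rewrite /t divfK ?gt_eqF// ltr_pdivrMr// ltr_pMr// ltr1n.
rewrite /= sub0r normrN -nrmE linearZ /= nrmZ nrm_real gtr0_norm//.
rewrite -[1]/(1%:C%C) ltcR mulrC -ltr_pdivlMr// => /ltW Ax; apply: le_trans Ax _.
by apply: le_of_eq; rewrite /t; field; rewrite !gt_eqF.
Qed.

Lemma le_opnorm (A : blin V W) x : nrm (A x) <= opnorm A * nrm x.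
Proof.
have [M M0 AM] := blin_bounded A.
have [->|/eqP x0] := eqVneq x 0; first by rewrite linear0 !nrm0 mulr0.
have xp := nrm_gt0 x0; rewrite -ler_pdivrMr//.
apply: ub_le_sup.
  exists M => _ [y y1 <-]; apply: le_trans (AM y) _.
  by rewrite ler_piMr ?(ltW M0)// nrm_le.
exists (((nrm x)^-1)%:C%C *: x).
  by rewrite /= -[1]/(1%:C%C) -nrm_le nrmZ nrm_real ger0_norm ?invr_ge0 ?(ltW xp)// mulVf// gt_eqF.
rewrite linearZ /= -/(nrm _) nrmZ nrm_real ger0_norm ?invr_ge0 ?(ltW xp)//.
exact: mulrC.
Qed.

Lemma opnorm_eq0 (A : blin V W) : (forall x, A x = 0) -> opnorm A = 0.
Proof.
move=> A0; rewrite /opnorm (_ : [set _ | _ in _] = [set 0]) ?sup1//.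
apply/seteqP; split=> [_ [x _ <-]|_ ->]; first by rewrite A0 normr0.
by exists 0; rewrite /= ?A0 ?normr0 ?ler01.
Qed.
End bounded_operators.

Section circle_spectrum.
Context {R : realType} {V : normedModType R[i]}.
Variables U Ui : blin V V.
Hypotheses (UK : inverse_op U Ui) (sU : spectrum_on setT U `<=` unit_circle).

Lemma off_circle_resolvent (lam : R[i]) : nrm lam != 1 ->
  bounded_below setT U lam /\ solvable setT U lam.
Proof.
move=> lam1; apply/notin_spectrum_onP => //; first by move=> a x y; rewrite linearP.
move=> /sU; rewrite /unit_circle /= => l1.
by move/eqP: lam1; apply; rewrite /nrm l1.
Qed.

Lemma circle_spectrum_growth (rho : R) : 1 < rho -> exists2 C : R, 0 < C &
  forall n x, nrm (iter n U x) <= C * rho ^+ n * nrm x.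
Proof.
have [M M0 UM] := blin_bounded U; apply: (power_growth UM) => z z1.
have [->|z0] := eqVneq z 0.
  split; first by exists 1 => // x; rewrite scale0r subr0 mul1r.
  by move=> y; exists y; rewrite scale0r subr0.
have zp : 0 < nrm z by apply: nrm_gt0; exact/eqP.
have [|[c c0 cU] sol] := @off_circle_resolvent z^-1.
  by rewrite nrmV gt_eqF// invf_gt1.
have E x : x - z *: U x = - z *: (U x - z^-1 *: x).
  by rewrite scalerBr scalerA mulNr mulfV// !scaleNr scale1r opprK addrC.
split.
  exists (nrm z * c); first by rewrite mulr_gt0.
  by move=> x; rewrite E nrmZ nrmN -mulrA ler_wpM2l ?(ltW zp)//; exact: cU.
move=> y; have [x _ xy] := sol (- z^-1 *: y) I; exists x.
by rewrite E xy scalerA mulrNN mulfV// scale1r.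
Qed.

(** [1 - z U^-1 = (U - z) U^-1], so the points inside the circle play for [U^-1] the part that those
    outside play for [U]. *)
Lemma circle_spectrum_inverse_growth (rho : R) : 1 < rho -> exists2 C : R, 0 < C &
  forall n x, nrm (iter n Ui x) <= C * rho ^+ n * nrm x.
Proof.
have [M M0 UiM] := blin_bounded Ui; apply: (power_growth UiM) => z z1.
have [N N0 UN] := blin_bounded U.
have [|[c c0 cU] sol] := @off_circle_resolvent z; first by rewrite lt_eqF.
have [UiU UUi] := UK.
split.
  exists (c / N); first by rewrite divr_gt0.
  move=> x; have := cU (Ui x) I; rewrite UUi; apply: le_trans.
  rewrite -mulrA ler_pM2l// mulrC ler_pdivrMr// mulrC.
  by have := UN (Ui x); rewrite UUi.
move=> y; have [x _ xy] := sol y I; exists (U x).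
by rewrite UiU.
Qed.
End circle_spectrum.

(** * C(NPi) as a module over C(K) by restriction of functions *)

Section restricted_module.
Context {R : realType} {K L : topologicalType}.

Definition Cb_precomp (M : topologicalType) (h : continuousType L M) (f : Cb R M) :
  Cb R L := Cb_comp f h.

Fact Cb_precomp_linear (M : topologicalType) (h : continuousType L M) :
  linear (Cb_precomp h).
Proof. by move=> a f g; apply: CbP => k. Qed.

HB.instance Definition _ (M : topologicalType) (h : continuousType L M) :=
  GRing.isLinear.Build R[i] (Cb R M) (Cb R L) *:%R (Cb_precomp h)
    (@Cb_precomp_linear M h).

Definition Cb_restrict_mul (h : continuousType L K) (f : Cb R K) (g : Cb R L) :
  Cb R L := Cb_comp f h * g.

Fact Cb_restrict_mul_linear (h : continuousType L K) (f : Cb R K) :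
  linear (Cb_restrict_mul h f).
Proof.
move=> a g g'; apply: CbP => k.
suff : f (h k) * (a * g k + g' k) = a * (f (h k) * g k) + f (h k) * g' k :> R[i].
  by [].
by rewrite mulrDr mulrCA.
Qed.

HB.instance Definition _ (h : continuousType L K) (f : Cb R K) :=
  GRing.isLinear.Build R[i] (Cb R L) (Cb R L) *:%R (Cb_restrict_mul h f)
    (@Cb_restrict_mul_linear h f).

Lemma Cb_restrict_mulDl (h : continuousType L K) (f f' : Cb R K) g :
  Cb_restrict_mul h (f + f') g = Cb_restrict_mul h f g + Cb_restrict_mul h f' g.
Proof.
apply: CbP => k; suff : (f (h k) + f' (h k)) * g k =
  f (h k) * g k + f' (h k) * g k :> R[i] by [].
exact: mulrDl.
Qed.

Lemma Cb_restrict_mulZl (h : continuousType L K) a (f : Cb R K) g :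
  Cb_restrict_mul h (a *: f) g = a *: Cb_restrict_mul h f g.
Proof.
apply: CbP => k; suff : a * f (h k) * g k = a * (f (h k) * g k) :> R[i] by [].
by rewrite mulrA.
Qed.

Lemma Cb_restrict_mulM (h : continuousType L K) (f f' : Cb R K) g :
  Cb_restrict_mul h (f * f') g = Cb_restrict_mul h f (Cb_restrict_mul h f' g).
Proof.
apply: CbP => k; suff : f (h k) * f' (h k) * g k =
  f (h k) * (f' (h k) * g k) :> R[i] by [].
by rewrite mulrA.
Qed.

Lemma Cb_restrict_mul1 (h : continuousType L K) g : Cb_restrict_mul h 1 g = g.
Proof. by apply: CbP => k; suff : 1 * g k = g k :> R[i] by []; rewrite mul1r. Qed.

Lemma Cb_restrict_mul_le (h : continuousType L K) (f : Cb R K) (g : Cb R L) :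
  nrm (Cb_restrict_mul h f g) <= supnorm f * nrm g.
Proof.
apply: supnorm_le_nrm => [|k]; first by rewrite mulr_ge0 ?supnorm_ge0 ?nrm_ge0.
rewrite /Cb_restrict_mul CbME nrmM; apply: ler_pM; rewrite ?nrm_ge0//.
  exact: (nrm_le_supnorm f (h k)).
exact: (nrm_le_supnorm g k).
Qed.

Lemma Cb_comp_le (h : continuousType L L) (g : Cb R L) :
  nrm (Cb_precomp h g) <= nrm g.
Proof.
apply: supnorm_le_nrm => [|k]; first exact: nrm_ge0.
exact: (nrm_le_supnorm g (h k)).
Qed.
End restricted_module.

Section restricted_maps.
Context {K : topologicalType}.
Variables (A : set K) (h : continuousType K K).
Hypothesis hA : forall k, A k -> A (h k).

Definition restrict_map_fun (k : A) : A := SigSub (mem_set (@hA _ (set_valP k))).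

Lemma restrict_map_continuous : continuous restrict_map_fun.
Proof.
apply: continuous_comp_initial.
have -> : set_val \o restrict_map_fun = h \o Defs.incl A by [].
by move=> k; exact: cts_fun.
Qed.

Definition restrict_map : continuousType A A := mkcts restrict_map_continuous.
End restricted_maps.

Lemma homeomorphism_inverse (K : topologicalType) (phi : continuousType K K) :
  homeomorphism phi ->
  exists psi : continuousType K K, cancel phi psi /\ cancel psi phi.
Proof.
move=> [[g phiK gK] ophi]; have cg : continuous g.
  apply/continuousP => A oA; rewrite (_ : g @^-1` A = phi @` A); first exact: ophi.
  by apply/seteqP; split=> k /= => [Agk|[l Al <-]]; [exists (g k)|rewrite phiK].
by exists (mkcts cg).
Qed.

Section main_theorem.
Context {R : realType} {K : topologicalType}.
Hypotheses (cK : compact [set: K]) (hK : hausdorff_space K)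
  (edK : extremally_disconnected K).
Variables phi psi : continuousType K K.
Hypotheses (hphi : homeomorphism phi) (phiK : cancel phi psi) (psiK : cancel psi phi).

Lemma NPi_clopen : clopen (NPi phi).
Proof.
apply: clopen_setC; apply: closure_clopen => //.
by apply: bigcup_open => n _; exact: (Pi_clopen cK hK edK phiK psiK n).1.
Qed.

Lemma NPi_invariant_set : invariant_set phi (NPi phi).
Proof.
suff iPi : invariant_set phi (Pi phi) by move=> k; split=> nk /iPi.
apply: (invariant_closure (@cts_fun _ _ phi) (@cts_fun _ _ psi) phiK psiK) => k.
by split=> -[n n0 nk]; exists n => //; exact/(Pi_invariant phiK).
Qed.

Lemma NPi_aperiodic k j : NPi phi k -> (0 < j)%N -> iter j phi k <> k.
Proof.
move=> nk j0 jk; have [n [/andP[n0 _] nPk]] := period_exists j0 jk.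
by apply: nk; apply: subset_closure; exists n.
Qed.

Let NPsi k : NPi phi k -> NPi phi (psi k).
Proof. by move=> nk; exact/(invariant_inv psiK k NPi_invariant_set). Qed.

Let act : Cb R K -> {linear Cb R (NPi phi) -> Cb R (NPi phi)} :=
  fun f => Cb_restrict_mul (Defs.incl (NPi phi)) f.
Let shift : {linear Cb R (NPi phi) -> Cb R (NPi phi)} := Cb_precomp (NPi_map hphi).
Let unshift : {linear Cb R (NPi phi) -> Cb R (NPi phi)} :=
  Cb_precomp (restrict_map NPsi).

(** [S_op] is the weighted operator of the restricted module: composition with a map does not
    increase the supremum norm, so the growth hypotheses hold with constant 1, and [chi (NPi phi)]
    acts as the identity. *)
Lemma S_op_spectra (w : Cb R K) :
  spectrum_on setT (S_op w hphi) =
    [set lam | ~ if lam == 0 then forall k, NPi phi k -> w k <> 0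
                 else dichotomy phi psi (rel_weight w lam) (NPi phi)] /\
  ap_spectrum_on setT (S_op w hphi) =
    [set lam | ~ forall k, NPi phi k -> if lam == 0 then w k <> 0
                 else ~ peak phi psi (rel_weight w lam) k].
Proof.
have mulE f g : act f g = Cb_comp f (Defs.incl (NPi phi)) * g by [].
have mD f g x : act (f + g) x = act f x + act g x by exact: Cb_restrict_mulDl.
have mZ a f x : act (a *: f) x = a *: act f x by exact: Cb_restrict_mulZl.
have mM f g x : act (f * g) x = act f (act g x) by exact: Cb_restrict_mulM.
have m1 x : act 1 x = x by exact: Cb_restrict_mul1.
have m_le f x : nrm (act f x) <= supnorm f * nrm x by exact: Cb_restrict_mul_le.
have UK : cancel shift unshift.
  move=> g; apply: CbP => k; congr (g _); apply: val_inj => /=.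
  exact: psiK.
have UiK : cancel unshift shift.
  move=> g; apply: CbP => k; congr (g _); apply: val_inj => /=.
  exact: phiK.
have Um f x : shift (act f x) = act (Cb_comp f phi) (shift x) by apply: CbP.
have Uim f x : unshift (act f x) = act (Cb_comp f psi) (unshift x) by apply: CbP.
have growth (h : continuousType (NPi phi) (NPi phi)) (rho : R) : 1 < rho ->
    exists2 C : R, 0 < C & forall n x,
      nrm (iter n (Cb_precomp h) x) <= C * rho ^+ n * nrm (x : Cb R (NPi phi)).
  move=> rho1; exists 1 => // n x; rewrite mul1r.
  apply: (@le_trans _ _ (nrm x)).
    by elim: n => //= n; apply: le_trans; exact: Cb_comp_le.
  by rewrite ler_peMl ?nrm_ge0// exprn_ege1// ltW.
have faithful : faithful_on act (NPi phi).
  move=> E cE EN [k Ek]; exists (Cb_comp (chi E) (Defs.incl (NPi phi))).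
    move=> /(congr1 (fun g : Cb R (NPi phi) => g (SigSub (mem_set (EN k Ek))))) /eqP.
    by rewrite Cb_compE /= chi_in// oner_eq0.
  rewrite /supported mulE; apply: CbP => l.
  suff : (chi E : Cb R K) (set_val l) * (chi E : Cb R K) (set_val l) =
    (chi E : Cb R K) (set_val l) by [].
  rewrite -[LHS]/((chi E * chi E : Cb R K) (set_val l)).
  by rewrite chiM// setIid.
have rangeT : range (act (chi (NPi phi))) = setT.
  apply/seteqP; split=> // g _; exists g => //; rewrite mulE.
  apply: CbP => k; suff : (chi (NPi phi) : Cb R K) (set_val k) * g k = g k by [].
  by rewrite chi_in ?mul1r//; [exact: NPi_clopen|exact: set_valP].
rewrite -rangeT; split.
  exact: (aperiodic_spectrumE cK hK edK mD mZ mM m1 m_le phiK psiK UK UiK Um Uim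
    (growth _) (growth _) (@Cb_sequentially_complete R _) w NPi_clopen
    NPi_invariant_set faithful NPi_aperiodic).
exact: (aperiodic_ap_spectrumE cK hK edK mD mZ mM m1 m_le phiK psiK UK UiK Um Uim
    (growth _) (growth _) w NPi_clopen
    NPi_invariant_set faithful NPi_aperiodic).
Qed.
End main_theorem.

Theorem theorem5p7 (R : realType) (K : topologicalType)
    (X : completeNormedModType R[i]) (m : Cb R K -> blin X X)
    (hm : kaplansky_module m)
    (U Uinv : blin X X) (hU : d_isomorphism m U) (hUinv : inverse_op U Uinv)
    (hsU : spectrum_on setT U `<=` unit_circle)
    (w : Cb R K) (phi : continuousType K K) (hphi : homeomorphism phi)
    (hUphi : forall f x, U (m f (Uinv x)) = m (Cb_comp f phi) x) :
  let T : X -> X := fun x => m w (U x) in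
  let X_ n := range_chi m (Pi_ phi n) in
  let X_Pi := range_chi m (Pi phi) in
  let X_NPi := range_chi m (NPi phi) in
  [/\ forall n, (0 < n)%N -> ap_spectrum_on (X_ n) T = spectrum_on (X_ n) T,
      spectrum_on X_Pi T = ap_spectrum_on X_Pi T /\
      (exists sigma : set R[i]^o, rotation_invariant sigma /\
        ap_spectrum_on X_Pi T =
          closure (\bigcup_(n in [set n | (0 < n)%N]) spectrum_on (X_ n) T)
          `|` sigma),
      spectrum_on X_NPi T = spectrum_on setT (S_op w hphi)
    & ap_spectrum_on X_NPi T = ap_spectrum_on setT (S_op w hphi)].
Proof.
case: hm => -[cK hK mD mZ mM m1 _ m_iso _] edK _.
have [psi [phiK psiK]] := homeomorphism_inverse hphi.
have [UK UiK] := hUinv.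
pose act (f : Cb R K) : {linear X -> X} := m f.
have m_le f x : nrm (act f x) <= supnorm f * nrm x.
  apply: le_trans (le_opnorm (m f) x) _.
  by rewrite -lecR; have := congr1 (fun z => z * (nrm x)%:C%C) (m_iso f);
    rewrite !rmorphM /= => ->.
have Um f x : U (act f x) = act (Cb_comp f phi) (U x).
  by rewrite /act -hUphi UK.
have Uim f x : Uinv (act f x) = act (Cb_comp f psi) (Uinv x).
  apply: (can_inj UK); rewrite UiK Um UiK; congr (m _ x).
  by apply: CbP => k; rewrite !Cb_compE phiK.
have U_growth := circle_spectrum_growth hsU.
have Ui_growth := circle_spectrum_inverse_growth hUinv hsU.
have complX := complete_sequentially_complete (V := X).
(* An isometric [m] cannot send the nonzero function [chi E] to the zero operator. *)
have faithful : faithful_on act setT.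
  move=> E cE _ [k Ek].
  have [[y y0]|ny] := pselect (exists y, m (chi E) y <> 0).
    by exists (m (chi E) y) => //; exact: (supported_chi (m := act) mM).
  have := m_iso (chi E); rewrite opnorm_eq0 => [/esym/normr0_eq0 chi0|x].
    have : (chi E : Cb R K) k = 0 by rewrite chi0.
    by rewrite chi_in// => /eqP; rewrite oner_eq0.
  by apply: contrapT => mx; apply: ny; exists x.
have faithfulN : faithful_on act (NPi phi) by exact: (faithful_sub faithful).
(* The spectra of [S] are now written in terms of [w] and [phi] alone; the same description on the
   side of [X] yields the last two claims. *)
have [-> ->] := S_op_spectra cK hK edK hphi phiK psiK w.
split.
- exact: (Pi_n_spectrum cK hK edK mD mM m1 m_le phiK psiK UK UiK Um Uim
    U_growth Ui_growth complX w faithful).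
- split.
    exact: (Pi_spectrum cK hK edK mD mZ mM m1 m_le phiK psiK UK UiK Um Uim
      U_growth Ui_growth complX w faithful).
  exact: (Pi_ap_spectrum_rotation cK hK edK mD mZ mM m1 m_le phiK psiK UK UiK Um Uim
    U_growth Ui_growth complX w faithful).
- exact: (aperiodic_spectrumE cK hK edK mD mZ mM m1 m_le phiK psiK UK UiK Um Uim
    U_growth Ui_growth complX w (NPi_clopen cK hK edK phiK psiK)
    (NPi_invariant_set phiK psiK) faithfulN (@NPi_aperiodic _ phi)).
- exact: (aperiodic_ap_spectrumE cK hK edK mD mZ mM m1 m_le phiK psiK UK UiK Um Uim
    U_growth Ui_growth w (NPi_clopen cK hK edK phiK psiK)
    (NPi_invariant_set phiK psiK) faithfulN (@NPi_aperiodic _ phi)).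
Qed.
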